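(* Let $(\rho(t))_{t\ge0}$ be the solution of the stochastic master equation described in the context, $\hat\rho(t)=\mathbb E[\rho(t)]$, and let $\mathcal H_S$ be a subspace of $\mathcal H$ with $\mathcal H_R=\mathcal H_S^\perp$. Assume $\mathcal H_S$ is GAS and denote $V(\rho)=\mathrm{tr}(P_R\rho)$, where $P_R$ is the orthogonal projector onto $\mathcal H_R$. Then there exists $\alpha_0>0$ such that, for every initial state $\rho_0\in\mathcal S(\mathcal H)$, $$\limsup_{t\to\infty}\frac1t\ln\big(V(\hat\rho(t))\big)\le-\alpha_0,$$ $$\limsup_{t\to\infty}\frac1t\ln\big(V(\rho(t))\big)\le-\alpha_0\quad\text{a.s.}$$ Moreover, if the condition (SP): $P_RC_j^*P_RC_jP_R>0$ (positive definite as an operator on $\mathcal H_R$) for all $j=p+1,\dots,n$, holds, then there exists $\beta_0\ge\alpha_0$ such that, for every $\rho_0\in\mathcal S(\mathcal H)$, $$\limsup_{t\to\infty}\frac1t\ln\big(V(\rho(t))\big)\le-\beta_0\quad\text{a.s.}$$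
   Context: $\mathcal H$ is a finite-dimensional complex Hilbert space, $\mathcal B(\mathcal H)$ the linear operators on it, and $\mathcal S(\mathcal H)=\{\rho\in\mathcal B(\mathcal H):\rho\ge 0,\ \mathrm{tr}\,\rho=1\}$. Fix integers $0\le p\le n$, operators $C_0,\dots,C_n\in\mathcal B(\mathcal H)$ and a self-adjoint $H\in\mathcal B(\mathcal H)$. Set $\mathcal L(\rho)=-i[H,\rho]+\sum_{i=0}^n\big(C_i\rho C_i^*-\tfrac12(C_i^*C_i\rho+\rho C_i^*C_i)\big)$, $\mathcal J_i(\rho)=C_i\rho C_i^*$, $\mathcal G_i(\rho)=C_i\rho+\rho C_i^*-\mathrm{tr}[(C_i+C_i^* )\rho]\rho$. Stochastic master equation: on a filtered probability space $(\Omega,\mathcal F,(\mathcal F_t),\mathbb P)$ satisfying the usual conditions, let $W_0,\dots,W_p$ be independent standard Wiener processes and $N_{p+1},\dots,N_n$ independent Poisson point processes on $\mathbb R\times\mathbb R_+$ of intensity $dx\,dt$, independent of the Wiener processes; $(\mathcal F_t)$ is their natural filtration. For each (deterministic) initial state $\rho_0\in\mathcal S(\mathcal H)$, $(\rho(t))$ is the unique $\mathcal S(\mathcal H)$-valued solution (existence and uniqueness are known) of $\rho(t)=\rho_0+\int_0^t\mathcal L(\rho(s-))ds+\sum_{i=0}^p\int_0^t\mathcal G_i(\rho(s-))dW_i(s)+\sum_{i=p+1}^n\int_0^t\int_{\mathbb R}\Big(\frac{\mathcal J_i(\rho(s-))}{\mathrm{tr}[\mathcal J_i(\rho(s-))]}-\rho(s-)\Big)\mathbf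 1_{0<x<\mathrm{tr}[\mathcal J_i(\rho(s-))]}[N_i(dx,ds)-dx\,ds]$. One has $\frac{d}{dt}\hat\rho(t)=\mathcal L(\hat\rho(t))$. Let $P_S$ be the orthogonal projector onto $\mathcal H_S$. $\mathcal H_S$ is GAS in mean if for all $\rho_0\in\mathcal S(\mathcal H)$, $\lim_{t\to\infty}\|\hat\rho(t)-P_S\hat\rho(t)P_S\|=0$, and GAS almost surely if for all $\rho_0\in\mathcal S(\mathcal H)$, $\lim_{t\to\infty}\|\rho(t)-P_S\rho(t)P_S\|=0$ a.s.; the two notions are equivalent, and ''GAS'' refers to either. Convention: $\ln 0=-\infty$. *)

(* Defs.v *)
From HB Require Import structures.
From mathcomp Require Import all_boot all_order all_algebra.
From mathcomp Require Import all_classical all_reals all_analysis.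
From mathcomp Require Import measurable_realfun.
From mathcomp Require Export complex.

Set Implicit Arguments.
Unset Strict Implicit.
Unset Printing Implicit Defensive.

Import Order.TTheory GRing.Theory Num.Theory.
Import numFieldNormedType.Exports.

Local Open Scope classical_set_scope.
Local Open Scope ring_scope.
Local Open Scope sesquilinear_scope.

(* The Hilbert space is C^d (column vectors, <u, v> = u^* v) and operators on
   it are d x d matrices over R[i]; the adjoint is A ^t*. *)

(* R * R with points (x, t), mark first and time second. *)
Notation plane R := (measurableTypeR R * measurableTypeR R)%type.

Section Operators.
Context {R : realType} {d : nat}.
Implicit Types (A rho H C : 'M[R[i]]_d).

(* In R[i], 0 <= z means that z is real and nonnegative, so positivity of the
   quadratic form includes self-adjointness. *)
Definition psd A : Prop := forall v : 'cV[R[i]]_d, 0 <= (v ^t* *m A *m v) 0 0.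

Definition state rho : Prop := psd rho /\ \tr rho = 1.

Definition selfadjoint A : Prop := A ^t* = A.

Definition is_orthocomp (U V : {vspace 'cV[R[i]]_d}) : Prop :=
  forall v, v \in V <-> forall u, u \in U -> u ^t* *m v = 0.

Definition is_orthoproj (U : {vspace 'cV[R[i]]_d}) A : Prop :=
  [/\ selfadjoint A, A *m A = A &
      forall v : 'cV[R[i]]_d, v \in U <-> exists u, v = A *m u].

Definition posdef_on (U : {vspace 'cV[R[i]]_d}) A : Prop :=
  forall v, v \in U -> v != 0 -> 0 < (v ^t* *m A *m v) 0 0.

Definition hsnorm A : R := Num.sqrt (complex.Re (\tr (A ^t* *m A))).

(* The real and imaginary parts of the entries of A, through which limits,
   measurability and integrals of operator-valued functions are expressed. *)
Definition mxpart (im : bool) (j k : 'I_d) A : R :=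
  if im then complex.Im (A j k) else complex.Re (A j k).

Definition of_mxpart (f : bool -> 'I_d -> 'I_d -> R) : 'M[R[i]]_d :=
  \matrix_(j, k) Complex (f false j k) (f true j k).

Definition Jop C rho := C *m rho *m C ^t*.

Definition Gop C rho :=
  C *m rho + rho *m C ^t* - (\tr ((C + C ^t*) *m rho)) *: rho.

Definition Lindblad n H (C : 'I_n.+1 -> 'M[R[i]]_d) rho :=
  - 'i *: (H *m rho - rho *m H) +
  \sum_(i < n.+1) (C i *m rho *m (C i) ^t* -
     2^-1 *: ((C i) ^t* *m C i *m rho + rho *m ((C i) ^t* *m C i))).

Definition jump_rate C rho : R := complex.Re (\tr (Jop C rho)).

Definition jump_coef C rho (x : R) : 'M[R[i]]_d :=
  if 0 < x < jump_rate C rho then (\tr (Jop C rho))^-1 *: Jop C rho - rho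
  else 0.

Definition left_lim (f : R -> 'M[R[i]]_d) (s : R) : 'M[R[i]]_d :=
  of_mxpart (fun b j k => lim (mxpart b j k (f u) @[u --> s^'-])).

Definition cadlag (f : R -> 'M[R[i]]_d) : Prop := forall b j k,
  (forall t : R, 0 <= t ->
     mxpart b j k (f u) @[u --> t^'+] --> mxpart b j k (f t)) /\
  (forall t : R, 0 < t -> cvg (mxpart b j k (f u) @[u --> t^'-])).

Definition mxint dT (T : measurableType dT) (mu : {measure set T -> \bar R})
    (D : set T) (f : T -> 'M[R[i]]_d) : 'M[R[i]]_d :=
  of_mxpart (fun b j k => \int[mu]_(x in D) mxpart b j k (f x)).

End Operators.

(* Time runs over t >= 0 in R; values at negative times are not constrained and
   are never used. *)
Section Stochastics.
Context {R : realType} {dO : measure_display} {Om : measurableType dO}.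
Variable P : probability Om R.

Definition independent_systems (I : finType) (G : I -> set (set Om)) : Prop :=
  forall (J : {set I}) (A : I -> set Om), (forall i, i \in J -> G i (A i)) ->
    P (\bigcap_(i in [set` J]) A i) = (\prod_(i in J) P (A i))%E.

Record usual_conditions (F : R -> set (set Om)) : Prop := UsualConditions {
  filt_sigma : forall t : R, 0 <= t -> sigma_algebra setT (F t);
  filt_sub : forall t : R, 0 <= t -> F t `<=` measurable;
  filt_mono : forall s t : R, 0 <= s -> s <= t -> F s `<=` F t;
  filt_complete : P.-negligible `<=` F 0;
  filt_rcont : forall t : R, 0 <= t -> \bigcap_(s in `]t, +oo[) F s `<=` F t }.

Definition adapted (F : R -> set (set Om)) (X : R -> Om -> R) : Prop :=
  forall t : R, 0 <= t -> forall B : set R, measurable B -> F t (X t @^-1` B).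

Definition process_gen (X : R -> Om -> R) (t : R) : set (set Om) :=
  \bigcup_(s in `[0, t]) preimage_set_system setT (X s) measurable.

Record standard_wiener (W : R -> Om -> R) : Prop := StandardWiener {
  wiener_meas : forall t : R, 0 <= t -> measurable_fun setT (W t);
  wiener_start : {ae P, forall w, W 0 w = 0};
  wiener_law : forall s t : R, 0 <= s -> s < t -> forall B : set R, measurable B ->
    P [set w | B (W t w - W s w)] = normal_prob 0 (Num.sqrt (t - s)) B;
  wiener_indep : forall s t : R, 0 <= s -> s < t ->
    forall A, <<s process_gen W s >> A -> forall B : set R, measurable B ->
    P (A `&` [set w | B (W t w - W s w)]) =
    (P A * P [set w | B (W t w - W s w)%R])%E;
  wiener_cont :
    {ae P, forall w, {within `[0, +oo[, continuous (W ^~ w)}} }.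

Definition plane_measure : {measure set (plane R) -> \bar R} :=
  (@lebesgue_measure R \x @lebesgue_measure R)%E.

Definition ppp_intensity (B : set (plane R)) : \bar R :=
  plane_measure (B `&` [set z | 0 <= (z.2 : R)]).

Record poisson_point_process (N : Om -> {measure set (plane R) -> \bar R}) :
    Prop := PoissonPointProcess {
  ppp_meas : forall B, measurable B ->
    measurable_fun [set: Om] (N ^~ B);
  ppp_count : forall w (r : R) B, measurable B ->
    B `<=` `[- r, r] `*` `[- r, r] -> exists k : nat, N w B = k%:R%:E;
  ppp_law : forall B (l : R), measurable B -> ppp_intensity B = l%:E ->
    forall k : nat, P [set w | N w B = k%:R%:E] =
      (l ^+ k / k`!%:R * expR (- l))%:E;
  ppp_indep : forall m (B : 'I_m -> set (plane R)),
    (forall j, measurable (B j)) -> trivIset setT B ->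
    independent_systems
      (fun j => preimage_set_system setT (fun w => N w (B j)) measurable) }.

Definition ppp_gen (N : Om -> {measure set (plane R) -> \bar R}) (t : R) :
    set (set Om) :=
  \bigcup_(B in [set B | measurable B /\ B `<=` [set z | 0 <= (z.2 : R) <= t]])
    preimage_set_system setT (fun w => N w B) measurable.

(* Simple predictable processes
   \sum_(k < sp_size) sp_val k * \1_`]sp_time k, sp_time k.+1]. *)
Record simple_process (F : R -> set (set Om)) := SimpleProcess {
  sp_size : nat;
  sp_time : nat -> R;
  sp_val : nat -> Om -> R;
  sp_time_ge0 : 0 <= sp_time 0;
  sp_time_nd : {homo sp_time : k l / (k <= l)%N >-> k <= l};
  sp_val_meas : forall k (B : set R), measurable B ->
    F (sp_time k) (sp_val k @^-1` B);
  sp_val_bound : forall k, exists M : R, forall w, `|sp_val k w| <= M }.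

Definition sp_fun F (S : simple_process F) (s : R) (w : Om) : R :=
  \sum_(k < sp_size S)
    sp_val S k w * \1_(`]sp_time S k, sp_time S k.+1]) s.

Definition sp_integral F (S : simple_process F) (W : R -> Om -> R) (t : R)
    (w : Om) : R :=
  \sum_(k < sp_size S) sp_val S k w *
    (W (Num.min (sp_time S k.+1) t) w - W (Num.min (sp_time S k) t) w).

(* I is the continuous version of the Ito integral of H with respect to W:
   the L^2 limit of the integrals of simple processes approximating H in
   L^2(P x dt) on bounded time intervals. *)
Definition is_ito_integral (F : R -> set (set Om)) (W H I : R -> Om -> R) :
    Prop :=
  [/\ adapted F I,
      {ae P, forall w, {within `[0, +oo[, continuous (I ^~ w)}} &
      exists S : nat -> simple_process F, forall t : R, 0 <= t ->
        ((\int[P]_w \int[@lebesgue_measure R]_(s in `]0%R, t])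
            ((H s w - sp_fun (S m) s w) ^+ 2)%R%:E)%E @[m --> \oo] --> 0%E) /\
        ((\int[P]_w ((I t w - sp_integral (S m) W t w) ^+ 2)%R%:E)%E
            @[m --> \oo] --> 0%E)].

End Stochastics.

Section MasterEquation.
Context {R : realType} {dO : measure_display} {Om : measurableType dO}.
Variable P : probability Om R.
Context {d n : nat}.
Variable p : nat.
Variables (W : 'I_n.+1 -> R -> Om -> R)
  (N : 'I_n.+1 -> Om -> {measure set (plane R) -> \bar R}).

(* W i is relevant only for i <= p and N i only for p < i. *)
Definition noise_gen (t : R) (i : 'I_n.+1) : set (set Om) :=
  if (i <= p)%N then process_gen (W i) t else ppp_gen (N i) t.

Record sme_noise (F : R -> set (set Om)) : Prop := SmeNoise {
  noise_usual : usual_conditions P F;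
  noise_wiener : forall i : 'I_n.+1, (i <= p)%N -> standard_wiener P (W i);
  noise_poisson : forall i : 'I_n.+1, (p < i)%N ->
    poisson_point_process P (N i);
  noise_indep : independent_systems P
    (fun i => <<s \bigcup_(t in `[0, +oo[) noise_gen t i >>);
  (* natural filtration, completed by the null sets *)
  noise_natural : forall t : R, 0 <= t ->
    F t = <<s (\bigcup_(i in setT) noise_gen t i) `|` P.-negligible >> }.

Variables (H : 'M[R[i]]_d) (C : 'I_n.+1 -> 'M[R[i]]_d).

Definition sme_equation (rho0 : 'M[R[i]]_d) (X : R -> Om -> 'M[R[i]]_d)
    (Ito : 'I_n.+1 -> R -> Om -> 'M[R[i]]_d) (w : Om) (t : R) : Prop :=
  let Xm := left_lim (X ^~ w) in
  X t w = rho0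
    + mxint (@lebesgue_measure R) `]0, t] (fun s => Lindblad H C (Xm s))
    + \sum_(i < n.+1 | (i <= p)%N) Ito i t w
    + \sum_(i < n.+1 | (p < i)%N)
        (mxint (N i w) [set z | 0 < (z.2 : R) <= t]
           (fun z => jump_coef (C i) (Xm z.2) z.1) -
         mxint plane_measure [set z | 0 < (z.2 : R) <= t]
           (fun z => jump_coef (C i) (Xm z.2) z.1)).

Record sme_solution (F : R -> set (set Om)) (rho0 : 'M[R[i]]_d)
    (X : R -> Om -> 'M[R[i]]_d) : Prop := SmeSolution {
  sol_state : forall t w, 0 <= t -> state (X t w);
  sol_adapted : forall b j k, adapted F (fun t w => mxpart b j k (X t w));
  sol_cadlag : {ae P, forall w, cadlag (X ^~ w)};
  sol_eq : exists Ito : 'I_n.+1 -> R -> Om -> 'M[R[i]]_d,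
    (forall i : 'I_n.+1, (i <= p)%N -> forall b j k,
       is_ito_integral P F (W i)
         (fun s w => mxpart b j k (Gop (C i) (left_lim (X ^~ w) s)))
         (fun t w => mxpart b j k (Ito i t w))) /\
    {ae P, forall w, forall t : R, 0 <= t -> sme_equation rho0 X Ito w t} }.

Definition mean_state (X : R -> Om -> 'M[R[i]]_d) (t : R) : 'M[R[i]]_d :=
  of_mxpart (fun b j k => fine 'E_P[fun w => mxpart b j k (X t w)]).

(* In the next two definitions rho maps each initial state to the
   corresponding solution. *)
Definition gas_mean (PS : 'M[R[i]]_d)
    (rho : 'M[R[i]]_d -> R -> Om -> 'M[R[i]]_d) : Prop :=
  forall rho0, state rho0 ->
    hsnorm (mean_state (rho rho0) t - PS *m mean_state (rho rho0) t *m PS)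
      @[t --> +oo] --> (0 : R).

Definition gas_as (PS : 'M[R[i]]_d)
    (rho : 'M[R[i]]_d -> R -> Om -> 'M[R[i]]_d) : Prop :=
  forall rho0, state rho0 -> {ae P, forall w,
    hsnorm (rho rho0 t w - PS *m rho rho0 t w *m PS)
      @[t --> +oo] --> (0 : R)}.

End MasterEquation.

Section Rates.
Context {R : realType} {d : nat}.

Definition Vfun (PR rho : 'M[R[i]]_d) : R := complex.Re (\tr (PR *m rho)).

(* limsup_(t -> +oo) (1/t) ln (v t); lne 0 = -oo. *)
Definition exp_rate (v : R -> R) : \bar R :=
  limf_esup (fun t : R => (t^-1%:E * lne (v t)%:E)%E) (pinfty_nbhs R).

Definition SP_condition n p (C : 'I_n.+1 -> 'M[R[i]]_d)
    (HR : {vspace 'cV[R[i]]_d}) (PR : 'M[R[i]]_d) : Prop :=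
  forall j : 'I_n.+1, (p < j)%N ->
    posdef_on HR (PR *m (C j) ^t* *m PR *m C j *m PR).

End Rates.

(* Main.v *)
Require Import Defs.
From mathcomp Require Import all_boot all_order all_algebra.
From mathcomp Require Import all_classical all_reals all_analysis.
From mathcomp Require Import measurable_realfun.
From mathcomp Require Import ring lra.

(* On states the linear functional [f = Vfun PR] is nonnegative and tends to 0
   along the mean flow.  The linear functionals that tend to 0 along all mean
   paths form a space on which the transpose of the Lindblad operator is
   invertible modulo those vanishing on states; this gives a functional [u] with
   [u (Lindblad rho) = - f rho].  It is nonnegative, decays geometrically along
   the mean flow, and satisfies [f ^+ 2 <= K * u] on states because [u] decreases
   with bounded second derivative and stays nonnegative.

   The noise terms of the equation have mean zero on every event of the past, so
   [u (rho t)] is a nonnegative supermartingale whose mean decays geometrically.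
   The maximal inequality on the intervals [j T, (j + 1) T] with levels
   [(3 / 4) ^+ j] and the Borel-Cantelli lemma turn the decay of the mean into
   almost sure decay, and [f ^+ 2 <= K * u] transfers both rates to [f]. *)

Set Implicit Arguments.
Unset Strict Implicit.
Unset Printing Implicit Defensive.

Import Order.TTheory GRing.Theory Num.Theory.
Import numFieldNormedType.Exports.

Local Open Scope classical_set_scope.
Local Open Scope ring_scope.

(** * Linear dynamics and the Lyapunov functional *)

(** No derivative of a mean path is ever taken. The equation controls increments, so the evolution
    enters through one estimate: a step from [s] to [t] differs from its Euler step by
    [O((t - s) ^+ 2)]. Subdivision turns this into monotonicity and into uniqueness for linear
    equations.

    The functional [f] itself need not contract: its drift may vanish at states that reach the
    subspace only through intermediate ones. Formally [u] is the time integral of [f] along the mean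
    flow; it has the missing strict drift, and being linear it calls for no Ito formula. The square
    in [f ^+ 2 <= K * u] costs a factor 2 in the rate, which is harmless since the rate only has to
    be positive.

    Two devices keep the probability elementary. Conditional expectations are replaced by integrals
    over events of the past. Joint measurability in time and outcome is never established: means of
    drift and jump integrals are limits of sums over grids whose integrand is taken at left end
    points, where the next noise increment is independent of it. *)

Lemma row_basis (K : fieldType) N (Z : 'rV[K]_N -> Prop) :
  exists r (A : 'M[K]_(r, N)),
    [/\ row_free A, forall i, Z (row i A) & forall v, Z v -> (v <= A)%MS].
Proof.
pose Q r := `[< exists A : 'M[K]_(r, N), row_free A /\ forall i, Z (row i A) >].
have Q0 : exists r, Q r.
  exists 0%N; apply/asboolP; exists 0; split; last by case.
  by rewrite /row_free mxrank0.
have Qub r : Q r -> (r <= N)%N.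
  by move/asboolP => [A [Af _]]; rewrite -(eqP Af) rank_leq_col.
have [r /asboolP [A [Afree AZ]] rmax] := ex_maxnP Q0 Qub.
(* [Z] need not be closed under addition: a free family of maximal size drawn from it spans it,
   since a vector outside the span could be appended. The basis thus consists of elements of [Z]
   itself. *)
exists r, A; split => // v Zv; apply/negPn/negP => vA.
suff /rmax : Q (r + 1)%N by rewrite addn1 ltnn.
apply/asboolP; exists (col_mx A v); split; last first.
  move=> i; case: (split_ordP i) => j ->; first by rewrite rowKu.
  by rewrite rowKd row_id.
rewrite /row_free eqn_leq rank_leq_row /= -addsmxE.
have : (A < A + v)%MS.
  by rewrite /ltmx addsmxSl /= addsmx_sub submx_refl.
by rewrite ltmxErank => /andP[_]; rewrite (eqP Afree) addn1.
Qed.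

Section EntrywiseNorm.
Context {R : realType}.

Definition mxnorm1 m n (x : 'M[R]_(m, n)) : R := \sum_i \sum_j `|x i j|.

Lemma mxnorm1_ge0 m n (x : 'M[R]_(m, n)) : 0 <= mxnorm1 x.
Proof. by apply: sumr_ge0 => i _; apply: sumr_ge0. Qed.

Lemma mxnorm1D m n (x y : 'M[R]_(m, n)) :
  mxnorm1 (x + y) <= mxnorm1 x + mxnorm1 y.
Proof.
rewrite /mxnorm1 -big_split; apply: ler_sum => i _; rewrite -big_split.
by apply: ler_sum => j _; rewrite mxE ler_normD.
Qed.

Lemma mxnorm1Z m n a (x : 'M[R]_(m, n)) : mxnorm1 (a *: x) = `|a| * mxnorm1 x.
Proof.
rewrite /mxnorm1 mulr_sumr; apply: eq_bigr => i _; rewrite mulr_sumr.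
by apply: eq_bigr => j _; rewrite mxE normrM.
Qed.

Lemma mxnorm1N m n (x : 'M[R]_(m, n)) : mxnorm1 (- x) = mxnorm1 x.
Proof. by rewrite -scaleN1r mxnorm1Z normrN1 mul1r. Qed.

Lemma mxnorm1_0 m n : mxnorm1 (0 : 'M[R]_(m, n)) = 0.
Proof. by rewrite -(scale0r 0) mxnorm1Z normr0 mul0r. Qed.

Lemma ler_mxnorm1 m n (x : 'M[R]_(m, n)) i j : `|x i j| <= mxnorm1 x.
Proof.
rewrite /mxnorm1 (bigD1 i) //= (bigD1 j) //= -addrA lerDl addr_ge0 //.
  exact: sumr_ge0.
by apply: sumr_ge0 => *; apply: sumr_ge0.
Qed.

Lemma mxnorm1_eq0 m n (x : 'M[R]_(m, n)) : mxnorm1 x <= 0 -> x = 0.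
Proof.
move=> x0; apply/matrixP => i j; rewrite mxE; apply/eqP.
by rewrite -normr_le0 (le_trans (ler_mxnorm1 _ _ _)).
Qed.

Lemma mxnorm1M m n q (A : 'M[R]_(m, n)) (B : 'M[R]_(n, q)) :
  mxnorm1 (A *m B) <= mxnorm1 A * mxnorm1 B.
Proof.
rewrite /mxnorm1 mulr_suml; apply: ler_sum => i _.
have step j : `|(A *m B) i j| <= \sum_k `|A i k| * `|B k j|.
  rewrite mxE (le_trans (ler_norm_sum _ _ _)) //.
  by apply: ler_sum => k _; rewrite normrM.
apply: (le_trans (ler_sum _ (fun j _ => step j))).
rewrite exchange_big mulr_suml; apply: ler_sum => k _ /=.
rewrite -mulr_sumr; apply: ler_wpM2l => //.
by rewrite [leRHS](bigD1 k) //= lerDl; apply: sumr_ge0 => *; apply: sumr_ge0.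
Qed.

End EntrywiseNorm.

Lemma cvg_sumr {R : realType} (T I : Type) (F : set_system T) {FF : Filter F}
    (r : seq I) (P : pred I) (f : I -> T -> R) (l : I -> R) :
  (forall i, P i -> f i x @[x --> F] --> l i) ->
  \sum_(i <- r | P i) f i x @[x --> F] --> \sum_(i <- r | P i) l i.
Proof. by move=> fl; apply: cvg_big => //; exact: add_continuous. Qed.

Lemma cvg_sumr0 {R : realType} (T I : Type) (F : set_system T) {FF : Filter F}
    (r : seq I) (P : pred I) (f : I -> T -> R) :
  (forall i, P i -> f i x @[x --> F] --> (0 : R)) ->
  \sum_(i <- r | P i) f i x @[x --> F] --> (0 : R).
Proof.
move=> f0; have := @cvg_sumr R T I F _ r P f (fun=> 0) f0.
by rewrite /= big1_eq; apply.
Qed.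

(** * Functions controlled up to quadratic errors *)

Section QuadraticSteps.
Context {R : realType}.

Lemma ler_div_nat0 (x c : R) : (forall n : nat, x <= c / n.+1%:R) -> x <= 0.
Proof.
move=> xc; rewrite leNgt; apply/negP => x0.
have c0 : 0 < c by have := xc 0%N; rewrite divr1; lra.
have [n /= nP] : exists n : nat, c / x < n.+1%:R.
  exists (Num.truncn (c / x)); apply: truncnS_gt.
have := xc n; rewrite ler_pdivlMr // mulrC -ler_pdivlMr // => /le_lt_trans.
by move=> /(_ _ nP); rewrite ltxx.
Qed.

(** On [n.+1] equal substeps the quadratic errors add up to [k * (t - s) ^+ 2 / n.+1], which is
    arbitrarily small. *)
Lemma quad_nonincreasing (g : R -> R) (a k : R) :
  (forall s t, a <= s -> s <= t -> g t - g s <= k * (t - s) ^+ 2) ->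
  forall s t, a <= s -> s <= t -> g t <= g s.
Proof.
move=> gk s t as_ st; rewrite -subr_le0.
apply: (@ler_div_nat0 _ (k * (t - s) ^+ 2)) => n.
have n0 : n.+1%:R != 0 :> R by rewrite pnatr_eq0.
pose h := (t - s) / n.+1%:R.
have h0 : 0 <= h by rewrite divr_ge0 // subr_ge0.
have step (i : nat) : g (s + i%:R * h) - g s <= i%:R * (k * h ^+ 2).
  clearbody h; elim: i => [|i IH]; first by rewrite !mul0r addr0 subrr.
  have := gk (s + i%:R * h) (s + i.+1%:R * h).
  have ih : 0 <= i%:R * h by rewrite mulr_ge0.
  rewrite -natr1 !mulrDl !mul1r.
  set u := i%:R * h in ih IH *; clearbody u => /(_ ltac:(lra) ltac:(lra)).
  by rewrite (_ : _ - (_ + _) = h); [lra | ring].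
have := step n.+1; rewrite (_ : s + _ = t); last first.
  by rewrite /h mulrC divfK // addrC subrK.
move/le_trans; apply; rewrite le_eqVlt; apply/orP; left; apply/eqP.
by rewrite /h; field; move: n0; rewrite -natr1 addrC.
Qed.

(** Discrete Gronwall argument: an Euler step of length [h] multiplies the norm by at most
    [1 + b * h <= expR (b * h)] and adds [k * h ^+ 2]. After [n.+1] steps the accumulated bound is
    of order [1 / n.+1]. *)
Lemma linear_ode_unique r (B : 'M[R]_r) (y : R -> 'cV[R]_r) (k : R) :
  (forall s t, 0 <= s -> s <= t ->
     mxnorm1 (y t - y s - (t - s) *: (B *m y s)) <= k * (t - s) ^+ 2) ->
  y 0 = 0 -> forall t, 0 <= t -> y t = 0.
Proof.
move=> yk y0 t t0; apply: mxnorm1_eq0; set b := mxnorm1 B.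
have k0 : 0 <= k.
  by have := yk 0 1 (lexx _) ler01; rewrite subr0 expr1n mulr1; apply: le_trans (mxnorm1_ge0 _).
have b0 : 0 <= b := mxnorm1_ge0 _.
apply: (@ler_div_nat0 _ (k * t ^+ 2 * expR (b * t))) => n.
have n0 : n.+1%:R != 0 :> R by rewrite pnatr_eq0.
pose h := t / n.+1%:R.
have h0 : 0 <= h by rewrite divr_ge0.
have step (i : nat) :
    mxnorm1 (y (i%:R * h)) <= i%:R * (k * h ^+ 2) * expR (b * h * i%:R).
  elim: i => [|i IH]; first by rewrite !mul0r y0 mxnorm1_0.
  have ih : 0 <= i%:R * h by rewrite mulr_ge0.
  set u := i%:R * h in IH ih *.
  have -> : i.+1%:R * h = u + h by rewrite -natr1 mulrDl mul1r.
  have uhu : u + h - u = h by ring.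
  have := yk u (u + h) ih; rewrite lerDl uhu => /(_ h0) yuh.
  have yle : mxnorm1 (y (u + h)) <= k * h ^+ 2 + (1 + b * h) * mxnorm1 (y u).
    rewrite -addrA -opprD in yuh.
    rewrite -[y (u + h)](subrK (y u + h *: (B *m y u))).
    apply: le_trans (mxnorm1D _ _) _; apply: lerD => //.
    apply: le_trans (mxnorm1D _ _) _; rewrite [leRHS]mulrDl mul1r lerD2l.
    rewrite mxnorm1Z (ger0_norm h0) (_ : b * h * mxnorm1 (y u) = h * (b * mxnorm1 (y u))); last by ring.
    by rewrite ler_wpM2l // mxnorm1M.
  apply: (le_trans yle).
  have bh0 : 0 <= b * h by rewrite mulr_ge0.
  have eP : 1 + b * h <= expR (b * h) by exact: expR_ge1Dx.
  have e1 : 1 <= expR (b * h * i.+1%:R).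
    by apply: le_trans (expR_ge1Dx _); rewrite lerDl mulr_ge0.
  have kh : 0 <= k * h ^+ 2 by rewrite mulr_ge0 // sqr_ge0.
  rewrite -natr1 [in X in _ <= X]mulrDl mul1r [leRHS]mulrDl addrC; apply: lerD.
    rewrite mulrDr mulr1 expRD mulrA [leRHS]mulrC; apply: ler_pM => //.
    - by rewrite addr_ge0.
    - exact: mxnorm1_ge0.
  by rewrite natr1; apply: ler_peMr.
have := step n.+1; rewrite (_ : n.+1%:R * h = t); last first.
  by rewrite /h mulrC divfK.
move/le_trans; apply; rewrite (_ : b * h * _ = b * t); last first.
  by rewrite -mulrA /h divfK.
rewrite le_eqVlt; apply/orP; left; apply/eqP.
by rewrite /h; field; move: n0; rewrite -natr1 addrC.
Qed.

(* Landau's argument; the quadratic bound stands for a bounded second derivative. *)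
Lemma quad_derivative_cvg0 (g h : R -> R) (k : R) :
  (forall s t, 0 <= s -> s <= t ->
     `|g t - g s - (t - s) * h s| <= k * (t - s) ^+ 2) ->
  g t @[t --> +oo] --> (0 : R) -> h t @[t --> +oo] --> (0 : R).
Proof.
move=> ghk /cvgrPdist_lt g0; apply/cvgrPdist_lt => e e0.
have k0 : 0 <= k.
  by have := ghk 0 1 (lexx _) ler01; rewrite subr0 expr1n mulr1; apply: le_trans.
(* Over a time [d] the difference quotient of [g] differs from [h t] by at most [k * d <= e / 2];
   two values of [g] below [e * d / 4] contribute the other half. The [+ 1] covers [k = 0]. *)
pose d := e / (2 * (k + 1)).
have k1 : 0 < k + 1 by lra.
have d0 : 0 < d by rewrite divr_gt0 // mulr_gt0.
have kd : k * d <= e / 2.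
  by rewrite /d (_ : _ * (_ / _) = e / 2 * (k / (k + 1))) ?ler_piMr //; [lra| rewrite ler_pdivrMr //; lra | field; lra].
have [M [Mr MP]] := g0 (e * d / 4) ltac:(by rewrite divr_gt0 // mulr_gt0).
exists (Num.max M 0); split; first by rewrite num_real.
move=> t /=; rewrite gt_max => /andP[Mt t0]; rewrite sub0r normrN.
have := ghk t (t + d) (ltW t0); rewrite lerDl (ltW d0) => /(_ isT).
rewrite (_ : t + d - t = d); last by ring.
have := MP t Mt; have := MP (t + d) ltac:(lra).
rewrite /= !sub0r !normrN !ltr_norml ler_norml => /andP[a1 a2] /andP[b1 b2] /andP[c1 c2].
have dd : k * d ^+ 2 <= e / 2 * d by rewrite expr2 mulrA ler_pM2r.
by apply/andP; split; rewrite -(ltr_pM2r d0); lra.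
Qed.

End QuadraticSteps.

Section Lyapunov.
Context {R : realType}.

Definition pairmx N (phi : 'rV[R]_N) (x : 'cV[R]_N) : R := (phi *m x) 0 0.

Lemma pairmxE N (phi : 'rV[R]_N) x : pairmx phi x = \sum_i phi 0 i * x i 0.
Proof. by rewrite /pairmx mxE. Qed.

Lemma pairmxB N (phi : 'rV[R]_N) x y : pairmx phi (x - y) = pairmx phi x - pairmx phi y.
Proof. by rewrite /pairmx mulmxBr !mxE. Qed.

Lemma pairmxZ N (phi : 'rV[R]_N) a x : pairmx phi (a *: x) = a * pairmx phi x.
Proof. by rewrite /pairmx -scalemxAr mxE. Qed.

Lemma pairmxA M N (phi : 'rV[R]_N) (A : 'M[R]_(N, M)) x :
  pairmx (phi *m A) x = pairmx phi (A *m x).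
Proof. by rewrite /pairmx mulmxA. Qed.

Lemma pairmx_sum M N (u : 'rV[R]_M) (A : 'M[R]_(M, N)) x :
  pairmx (u *m A) x = \sum_i u 0 i * pairmx (row i A) x.
Proof.
rewrite pairmxA pairmxE; apply: eq_bigr => i _; congr (_ * _).
by rewrite /pairmx -row_mul [RHS]mxE.
Qed.

Lemma ler_pairmx N (phi : 'rV[R]_N) x : `|pairmx phi x| <= mxnorm1 phi * mxnorm1 x.
Proof. exact: le_trans (ler_mxnorm1 _ _ _) (mxnorm1M _ _). Qed.

Lemma mxnorm1_cols M N (A : 'M[R]_(M, N)) : mxnorm1 A = \sum_j mxnorm1 (col j A).
Proof.
rewrite /mxnorm1 exchange_big; apply: eq_bigr => j _; apply: eq_bigr => i _.
by rewrite big_ord1 mxE.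
Qed.

Lemma cvg_mxnorm1_0 M N (A : R -> 'M[R]_(M, N)) :
  (forall i j, A t i j @[t --> +oo] --> (0 : R)) ->
  mxnorm1 (A t) @[t --> +oo] --> (0 : R).
Proof.
move=> A0; rewrite /mxnorm1.
apply: cvg_sumr0 => i _; apply: cvg_sumr0 => j _.
by rewrite -(normr0 R); apply: cvg_norm; exact: A0.
Qed.

Lemma nonincreasing_cvg0_ge0 (g : R -> R) :
  (forall s t, 0 <= s -> s <= t -> g t <= g s) -> g t @[t --> +oo] --> (0 : R) ->
  forall t, 0 <= t -> 0 <= g t.
Proof.
move=> gd /cvgrPdist_lt g0 t t0; rewrite leNgt; apply/negP => gt0.
have [|M [Mr MP]] := g0 (- g t); first by rewrite oppr_gt0.
pose u := Num.max t (M + 1).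
have tu : t <= u by rewrite le_max lexx.
have Mu : M < u by rewrite lt_max ltrDl ltr01 orbT.
have := MP u Mu; have := gd _ _ t0 tu; rewrite /= sub0r normrN => a b.
by rewrite ltr0_norm in b; lra.
Qed.

(* phi tends to 0 along all paths for phi in a space Z which is stable under
   phi |-> phi L; on Z this map is injective, hence onto, which gives U with
   U L = - f.  Geometric decay holds because the flow acts on the coordinates
   of a basis of Z by matrices tending to 0. *)
Lemma lyapunov_functional N (S : 'cV[R]_N -> Prop) (m : 'cV[R]_N -> R -> 'cV[R]_N)
    (L : 'M[R]_N) (f : 'rV[R]_N) (k b : R) :
  (forall x (s t : R), S x -> 0 <= s -> s <= t ->
     mxnorm1 (m x t - m x s - (t - s) *: (L *m m x s)) <= k * (t - s) ^+ 2) ->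
  (forall x (t : R), S x -> 0 <= t -> mxnorm1 (m x t) <= b) ->
  (forall x, S x -> m x 0 = x) ->
  (forall phi : 'rV[R]_N, (forall x, S x -> pairmx phi x = 0) ->
     forall x (t : R), S x -> 0 <= t -> pairmx phi (m x t) = 0) ->
  (forall x (t : R), S x -> 0 <= t -> 0 <= pairmx f (m x t)) ->
  (forall x, S x -> pairmx f (m x t) @[t --> +oo] --> (0 : R)) ->
  exists (U : 'rV[R]_N) (K c T : R), [/\ 0 < T,
    forall x, S x -> pairmx (U *m L) x = - pairmx f x,
    forall x, S x -> 0 <= pairmx U x,
    forall x, S x -> pairmx f x ^+ 2 <= K * pairmx U x &
    forall x (j : nat), S x -> pairmx U (m x (j%:R * T)) <= c * 2^-1 ^+ j].
Proof.
move=> mL mb m0 mS mf mcvg.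
(* A functional on the whole space is not determined by its values on [S], so everything moves to
   coordinates in a basis of the span of [S] chosen inside [S]: the columns of [Q], with left
   inverse [Qi]. *)
have [q [A0 [A0free A0S A0full]]] := row_basis (fun v : 'rV[R]_N => S v^T).
pose Q := A0^T; pose Qi := (pinvmx A0)^T.
have QiQ : Qi *m Q = 1%:M by rewrite -trmx_mul mulmxVp // trmx1.
have Qicol j : Qi *m col j Q = col j 1%:M by rewrite !colE mulmxA QiQ.
have QS j : S (col j Q) by have := A0S j; rewrite tr_row.
have QQi x : S x -> Q *m Qi *m x = x.
  move=> Sx; apply: trmx_inj; rewrite !trmx_mul !trmxK mulmxA mulmxKpV //.
  by apply: A0full; rewrite trmxK.
have QQim x (t : R) : S x -> 0 <= t -> Q *m Qi *m m x t = m x t.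
  move=> Sx t0; apply/eqP; rewrite eq_sym -subr_eq0 -{1}(mul1mx (m x t)) -mulmxBl.
  apply/eqP/matrixP => i j; rewrite !ord1 [RHS]mxE.
  (* The rows of [1%:M - Q *m Qi] vanish on [S]; by [mS] they vanish along the paths, which
     therefore stay in the span of [S]. *)
  have : pairmx (row i (1%:M - Q *m Qi)) (m x t) = 0.
    apply: mS => // z Sz.
    by rewrite /pairmx -row_mul [LHS]mxE mulmxBl mul1mx QQi // subrr mxE.
  by rewrite /pairmx -row_mul [X in X = _]mxE.
pose L' := Qi *m L *m Q; pose m' x t := Qi *m m x t.
pose k' := mxnorm1 Qi * k.
have m'L x (s t : R) : S x -> 0 <= s -> s <= t ->
    mxnorm1 (m' x t - m' x s - (t - s) *: (L' *m m' x s)) <= k' * (t - s) ^+ 2.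
  move=> Sx s0 st.
  rewrite /L' /m' -!mulmxA (mulmxA Q) QQim // scalemxAr -!mulmxBr.
  apply: le_trans (mxnorm1M _ _) _; rewrite /k' -mulrA ler_wpM2l ?mxnorm1_ge0 //.
  exact: mL.
have dotm'L phi x (s t : R) : S x -> 0 <= s -> s <= t ->
    `|pairmx phi (m' x t) - pairmx phi (m' x s) - (t - s) * pairmx (phi *m L') (m' x s)|
    <= mxnorm1 phi * k' * (t - s) ^+ 2.
  move=> Sx s0 st; rewrite pairmxA -pairmxZ -!pairmxB.
  apply: le_trans (ler_pairmx _ _) _; rewrite -mulrA ler_wpM2l ?mxnorm1_ge0 //.
  exact: m'L.
pose Z phi := forall x, S x -> pairmx phi (m' x t) @[t --> +oo] --> (0 : R).
have ZL phi : Z phi -> Z (phi *m L').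
  move=> Zphi x Sx.
  apply: (@quad_derivative_cvg0 _ (fun t => pairmx phi (m' x t)) _ _ _ (Zphi x Sx)).
  by move=> s t; exact: dotm'L.
have [r [A [Afree AZ Afull]]] := row_basis Z.
have Zlin (u : 'rV_r) : Z (u *m A).
  move=> x Sx; under eq_fun do rewrite pairmx_sum.
  apply: cvg_sumr0 => i _; rewrite -(mulr0 (u 0 i)).
  by apply: cvgMl_tmp; exact: AZ.
have AL : (A *m L' <= A)%MS.
  by apply/row_subP => i; rewrite row_mul; apply/Afull/ZL.
have Zf : Z (f *m Q).
  move=> x Sx; have := mcvg x Sx; apply: cvg_trans; apply: near_eq_cvg.
  near=> t; rewrite pairmxA /m' mulmxA QQim //.
(* If [v] in [Z] satisfies [v *m L' = 0], it has only quadratic increments along a path and so is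
   constant there. Its limit is 0, hence it vanishes on the basis vectors and is 0. *)
have Zinj : (A :&: kermx L')%MS == 0.
  apply/rowV0P => v; rewrite sub_capmx => /andP[/submxP[u ->{v}] /sub_kermxP uAL].
  set v := u *m A in uAL *.
  have gk x s1 s2 : S x -> 0 <= s1 -> s1 <= s2 ->
      `|pairmx v (m' x s2) - pairmx v (m' x s1)| <= mxnorm1 v * k' * (s2 - s1) ^+ 2.
    move=> Sx s10 s12; have := dotm'L v x s1 s2 Sx s10 s12.
    by rewrite uAL {3}/pairmx mul0mx mxE mulr0 subr0.
  have v0 x : S x -> pairmx v (m' x 0) = 0.
    move=> Sx; pose g s := pairmx v (m' x s).
    have g1 : 0 <= g 0.
      apply: (nonincreasing_cvg0_ge0 (g := g)) => //; last exact: Zlin.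
      apply: (quad_nonincreasing (k := mxnorm1 v * k')) => s1 s2 s10 s12.
      exact: le_trans (ler_norm _) (gk _ _ _ Sx s10 s12).
    have g2 : 0 <= - g 0.
      apply: (nonincreasing_cvg0_ge0 (g := fun t => - g t)) => //; last first.
        by rewrite -[X in _ --> X]oppr0; apply: cvgN; exact: Zlin.
      apply: (quad_nonincreasing (k := mxnorm1 v * k')) => s1 s2 s10 s12.
      apply: le_trans (gk _ _ _ Sx s10 s12).
      by rewrite -opprD -normrN ler_norm.
    by apply/eqP; rewrite eq_le g1 -oppr_ge0 g2.
  apply/rowP => j; rewrite [RHS]mxE; have := v0 _ (QS j).
  by rewrite /m' m0 // Qicol /pairmx colE mul1mx -colE [X in X = _]mxE.
(* An injective endomorphism of a finite-dimensional space is onto: equal ranks turn the inclusion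
   [AL] into an equality. *)
have ALA : (A <= A *m L')%MS.
  have [_] := mxrank_leqif_eq AL; rewrite (mxrank_injP _ Zinj) eqxx.
  by move=> /esym/andP[].
have /submxP[u uE] : (- (f *m Q) <= A *m L')%MS.
  by rewrite eqmx_opp; apply: submx_trans ALA; apply: Afull.
pose U := u *m A *m Qi.
have UL x : S x -> pairmx (U *m L) x = - pairmx f x.
  move=> Sx; have e : U *m L *m (Q *m Qi *m x) = u *m (A *m L') *m (Qi *m x).
    by rewrite /U /L' !mulmxA.
  rewrite /pairmx -{1}(QQi _ Sx) e -uE mulNmx -mulmxA (mulmxA Q) QQi //.
  by rewrite [LHS]mxE.
have Um' x t : pairmx U (m x t) = pairmx (u *m A) (m' x t) by rewrite /U pairmxA.
have Ucvg x : S x -> pairmx U (m x t) @[t --> +oo] --> (0 : R).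
  by move=> Sx; under eq_fun do rewrite Um'; exact: Zlin.
have ULm x (t : R) : S x -> 0 <= t -> pairmx (U *m L) (m x t) = - pairmx f (m x t).
  move=> Sx t0; apply/eqP; rewrite -addr_eq0; apply/eqP.
  have := mS (U *m L + f); rewrite /pairmx => /(_ _ x t Sx t0); rewrite mulmxDl mxE; apply.
  by move=> z Sz; rewrite mulmxDl mxE; have := UL z Sz; rewrite /pairmx => ->; rewrite addNr.
pose K := mxnorm1 U * `|k| + 1.
have K0 : 0 < K by rewrite ltr_wpDl // mulr_ge0 // mxnorm1_ge0.
have UK x (s t : R) : S x -> 0 <= s -> s <= t ->
    pairmx U (m x t) - pairmx U (m x s) + (t - s) * pairmx f (m x s) <= K * (t - s) ^+ 2.
  move=> Sx s0 st; rewrite -[X in _ + X]opprK -mulrN -ULm // (pairmxA U) -pairmxZ -!pairmxB.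
  apply: le_trans (ler_norm _) _; apply: le_trans (ler_pairmx _ _) _.
  rewrite /K mulrDl mul1r -mulrA ler_wpDr ?sqr_ge0 // ler_wpM2l ?mxnorm1_ge0 //.
  by apply: le_trans (mL _ _ _ Sx s0 st) _; rewrite ler_wpM2r ?sqr_ge0 // ler_norm.
(* The drift of [U] is [- f <= 0], so [U] decreases along paths; as it tends to 0 it cannot be
   negative. *)
have Udecr x : S x -> forall s t, 0 <= s -> s <= t -> pairmx U (m x t) <= pairmx U (m x s).
  move=> Sx; apply: (quad_nonincreasing (k := K)) => s t s0 st.
  apply: le_trans (UK _ _ _ Sx s0 st); rewrite lerDl mulr_ge0 ?subr_ge0 //.
  exact: mf.
have Uge0 x : S x -> forall t, 0 <= t -> 0 <= pairmx U (m x t).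
  by move=> Sx; apply: nonincreasing_cvg0_ge0; [exact: Udecr|exact: Ucvg].
(* [B] is the matrix of [L'] in the basis [A] of [Z], so that [y = A *m m'] solves an equation in
   which only [B] appears. *)
pose B := A *m L' *m pinvmx A.
have BA : A *m L' = B *m A by rewrite /B mulmxKpV.
pose y x t := A *m m' x t.
(* The columns of [Phi t] are the paths issued from the basis vectors [col j Q]. *)
pose Phi (t : R) : 'M[R]_q := \matrix_(i, j) m' (col j Q) t i 0.
have colPhi t j : col j (Phi t) = m' (col j Q) t.
  by apply/colP => i; rewrite !mxE.
have PhiL s t : 0 <= s -> s <= t ->
    mxnorm1 (Phi t - Phi s - (t - s) *: (L' *m Phi s)) <= q%:R * k' * (t - s) ^+ 2.
  move=> s0 st; rewrite mxnorm1_cols -mulrA mulr_natl -[X in _ *+ X]card_ord -sumr_const.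
  apply: ler_sum => j _; rewrite !linearB /= linearZ /= !colE -mulmxA -!colE !colPhi.
  exact: m'L.
pose E t := A *m Phi t *m pinvmx A.
(* A semigroup property is not among the assumptions on [m]. It comes from uniqueness: both sides
   solve the equation of matrix [B] and agree at [t = 0]. *)
have Eflow x s : S x -> 0 <= s -> forall t, 0 <= t -> y x (s + t) = E t *m y x s.
  move=> Sx s0 t t0; apply/eqP; rewrite -subr_eq0; apply/eqP; move: t t0.
  pose k1 := mxnorm1 A * k' + mxnorm1 A * (q%:R * k') * mxnorm1 (pinvmx A *m y x s).
  apply: (@linear_ode_unique _ _ B _ k1); last first.
    rewrite addr0 /E (_ : Phi 0 = 1%:M) ?mulmx1 ?mulmxVp ?mul1mx ?subrr //.
    by apply/matrixP => i j; rewrite mxE /m' m0 // Qicol mxE.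
  move=> t1 t2 t10 t12; rewrite mulmxBr scalerBr.
  rewrite [X in mxnorm1 X](_ : _ =
     A *m (m' x (s + t2) - m' x (s + t1) - (s + t2 - (s + t1)) *: (L' *m m' x (s + t1))) -
     A *m (Phi t2 - Phi t1 - (t2 - t1) *: (L' *m Phi t1)) *m (pinvmx A *m y x s)).
    apply: le_trans (mxnorm1D _ _) _; rewrite mxnorm1N mulrDl; apply: lerD.
      apply: le_trans (mxnorm1M _ _) _; rewrite -mulrA ler_wpM2l ?mxnorm1_ge0 //.
      rewrite (_ : t2 - t1 = s + t2 - (s + t1)); last by ring.
      by apply: m'L; rewrite ?lerD2l ?addr_ge0.
    apply: le_trans (mxnorm1M _ _) _; rewrite [leRHS]mulrAC.
    rewrite ler_wpM2r ?mxnorm1_ge0 //; apply: le_trans (mxnorm1M _ _) _.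
    by rewrite -mulrA ler_wpM2l ?mxnorm1_ge0 // PhiL.
  rewrite (_ : s + t2 - (s + t1) = t2 - t1); last by ring.
  have e1 : B *m y x (s + t1) = A *m (L' *m m' x (s + t1)) by rewrite /y mulmxA -BA mulmxA.
  have e2 t : E t *m y x s = A *m Phi t *m (pinvmx A *m y x s) by rewrite /E !mulmxA.
  have e3 : B *m (A *m Phi t1 *m (pinvmx A *m y x s)) =
      A *m (L' *m Phi t1) *m (pinvmx A *m y x s) by rewrite !mulmxA -BA !mulmxA.
  rewrite !e2 e3 e1 !mulmxBr !mulmxBl -!scalemxAr -!scalemxAl.
  by rewrite !opprD !opprK !addrA [LHS](ACl (1*3*5*2*4*6)).
(* Up to the constant factor [pinvmx A], the entries of [E t] pair elements of [Z] with paths issued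
   from [S]. *)
have Ecvg : mxnorm1 (E t) @[t --> +oo] --> (0 : R).
  apply: cvg_mxnorm1_0 => i j; rewrite /E; under eq_fun do rewrite mxE.
  apply: cvg_sumr0 => l _; rewrite -(mul0r (pinvmx A l j)); apply: cvgMr_tmp.
  have := AZ i _ (QS l); apply: cvg_trans; apply: near_eq_cvg; apply: nearW => t.
  by rewrite -colPhi colE /pairmx mulmxA -colE !mxE; apply: eq_bigr => ? _; rewrite !mxE.
have [T [T0 ET]] : exists T, 0 < T /\ mxnorm1 (E T) <= 2^-1.
  move/cvgrPdist_le : Ecvg => /(_ 2^-1 ltac:(by rewrite invr_gt0))[M [_ MP]].
  exists (Num.max 1 (M + 1)); split; first by rewrite lt_max ltr01.
  have := MP (Num.max 1 (M + 1)); rewrite /= sub0r normrN lt_max ltrDl ltr01 orbT.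
  by move=> /(_ isT); apply: le_trans; exact: ler_norm.
pose c := mxnorm1 u * (mxnorm1 A * (mxnorm1 Qi * b)).
have y0 x : S x -> mxnorm1 (y x 0) <= mxnorm1 A * (mxnorm1 Qi * b).
  move=> Sx; apply: le_trans (mxnorm1M _ _) _; rewrite ler_wpM2l ?mxnorm1_ge0 //.
  apply: le_trans (mxnorm1M _ _) _; rewrite ler_wpM2l ?mxnorm1_ge0 //.
  exact: mb.
have yT x (j : nat) : S x -> mxnorm1 (y x (j%:R * T)) <= 2^-1 ^+ j * mxnorm1 (y x 0).
  move=> Sx; elim: j => [|j IH]; first by rewrite mul0r mul1r.
  rewrite -natr1 mulrDl mul1r (Eflow x _ Sx (mulr_ge0 (ler0n _ j) (ltW T0)) T (ltW T0)).
  apply: le_trans (mxnorm1M _ _) _; rewrite exprS -mulrA.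
  by apply: ler_pM => //; exact: mxnorm1_ge0.
exists U, (4 * K), c, T; split => //.
- by move=> x Sx; rewrite -{1}(m0 x Sx); exact: Uge0.
- move=> x Sx; set v := pairmx f x.
  have v0 : 0 <= v by rewrite /v -{1}(m0 x Sx); exact: mf.
  (* The time [h = v / (2 * K)] maximises [h * v - K * h ^+ 2], a lower bound of [U] at [x] because
     [U] is still nonnegative at time [h]. The maximum is [v ^+ 2 / (4 * K)]. *)
  have h0 : 0 <= v / (2 * K) by rewrite divr_ge0 // mulr_ge0 // ltW.
  have := UK x 0 (v / (2 * K)) Sx (lexx _) h0; have := Uge0 x Sx _ h0.
  rewrite m0 // subr0 -/v => a1 a2.
  have : v / (2 * K) * v - K * (v / (2 * K)) ^+ 2 <= pairmx U x by lra.
  rewrite (_ : _ - _ = v ^+ 2 / (4 * K)); last by field; rewrite gt_eqF.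
  by rewrite ler_pdivrMr ?mulr_gt0 // mulrC.
- move=> x j Sx; rewrite Um' pairmxA; apply: le_trans (ler_norm _) _.
  apply: le_trans (ler_pairmx _ _) _; rewrite /c -mulrA ler_wpM2l ?mxnorm1_ge0 //.
  by apply: le_trans (yT x j Sx) _; rewrite mulrC ler_wpM2r ?exprn_ge0 ?invr_ge0 // y0.
Unshelve. all: by end_near. Qed.

End Lyapunov.

(** * States in real coordinates *)

Section RealCoordinates.
Local Open Scope sesquilinear_scope.
Local Open Scope complex_scope.
Context {R : realType} {d : nat}.
Implicit Types (M rho : 'M[R[i]]_d) (g : 'M[R[i]]_d -> R).

(** Real scalars only: real and imaginary parts of complex-linear functionals are not
    complex-linear. *)
Definition rlin g : Prop := forall (a : R) M M', g (a%:C *: M + M') = a * g M + g M'.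

Lemma rlin0 g : rlin g -> g 0 = 0.
Proof.
by move=> gl; have := gl 1 0 0; rewrite scaler0 addr0 mul1r; move: (g 0) => x; lra.
Qed.

Lemma rlinD g M M' : rlin g -> g (M + M') = g M + g M'.
Proof. by move=> gl; have := gl 1 M M'; rewrite scale1r mul1r. Qed.

Lemma rlinZ g (a : R) M : rlin g -> g (a%:C *: M) = a * g M.
Proof. by move=> gl; have := gl a M 0; rewrite addr0 (rlin0 gl) addr0. Qed.

Lemma rlinB g M M' : rlin g -> g (M - M') = g M - g M'.
Proof.
move=> gl; rewrite addrC -scaleN1r (_ : (-1 : R[i]) = (-1 : R)%:C) ?gl; last first.
  by rewrite rmorphN1.
by rewrite mulN1r addrC.
Qed.

Lemma rlin_sum g (I : Type) (r : seq I) (P : pred I) (f : I -> 'M[R[i]]_d) :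
  rlin g -> g (\sum_(i <- r | P i) f i) = \sum_(i <- r | P i) g (f i).
Proof.
move=> gl; apply: (big_morph g (fun x y => rlinD x y gl) (rlin0 gl)).
Qed.

Lemma ReD (x y : R[i]) : complex.Re (x + y) = complex.Re x + complex.Re y.
Proof. by case: x; case: y. Qed.

Lemma ImD (x y : R[i]) : complex.Im (x + y) = complex.Im x + complex.Im y.
Proof. by case: x; case: y. Qed.

Lemma ReZ (a : R) (x : R[i]) : complex.Re (a%:C * x) = a * complex.Re x.
Proof. by case: x => b c /=; rewrite mul0r subr0. Qed.

Lemma ImZ (a : R) (x : R[i]) : complex.Im (a%:C * x) = a * complex.Im x.
Proof. by case: x => b c /=; rewrite mul0r addr0. Qed.

Lemma mxpart_rlin b j k : rlin (mxpart b j k : 'M[R[i]]_d -> R).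
Proof.
by move=> a M M'; rewrite /mxpart !mxE; case: b; rewrite ?(ReD, ImD) ?(ReZ, ImZ).
Qed.

Lemma rlin_mxpart (T : 'M[R[i]]_d -> 'M[R[i]]_d) :
  (forall c M M', T (c *: M + M') = c *: T M + T M') ->
  forall b j k, rlin (fun M => mxpart b j k (T M)).
Proof. by move=> Tl b j k a M M' /=; rewrite Tl (mxpart_rlin b j k). Qed.

Lemma rlin_Re (tau : 'M[R[i]]_d -> R[i]) :
  (forall c M M', tau (c *: M + M') = c * tau M + tau M') ->
  rlin (fun M => complex.Re (tau M)).
Proof. by move=> tl a M M'; rewrite tl ReD ReZ. Qed.

Lemma rlin_Im (tau : 'M[R[i]]_d -> R[i]) :
  (forall c M M', tau (c *: M + M') = c * tau M + tau M') ->
  rlin (fun M => complex.Im (tau M)).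
Proof. by move=> tl a M M'; rewrite tl ImD ImZ. Qed.

Definition partidx := (bool * ('I_d * 'I_d))%type.

Definition pmx (a : partidx) M : R := mxpart a.1 a.2.1 a.2.2 M.

Definition unit_mx (a : partidx) : 'M[R[i]]_d :=
  (if a.1 then 'i else 1) *: delta_mx a.2.1 a.2.2.

Lemma pmx_rlin a : rlin (pmx a). Proof. exact: mxpart_rlin. Qed.

Lemma mx_sum_parts M : M = \sum_a (pmx a M)%:C *: unit_mx a.
Proof.
have pairE (F : partidx -> 'M[R[i]]_d) :
    \sum_a F a = \sum_b \sum_j \sum_k F (b, (j, k)).
  transitivity (\sum_b \sum_jk F (b, jk)).
    by rewrite pair_bigA; apply: eq_bigr => -[].
  by apply: eq_bigr => b _; rewrite pair_bigA; apply: eq_bigr => -[].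
rewrite pairE big_bool /= -big_split /=; under [RHS]eq_bigr do rewrite -big_split.
rewrite {1}(matrix_sum_delta M); apply: eq_bigr => j _; apply: eq_bigr => k _.
rewrite /unit_mx /pmx /mxpart /= !scalerA -scalerDl; congr (_ *: _).
by case: (M j k) => x y; apply/eqP; rewrite eq_complex /=; apply/andP; split; apply/eqP; ring.
Qed.

Lemma rlinE g M : rlin g -> g M = \sum_a pmx a M * g (unit_mx a).
Proof.
move=> gl; rewrite {1}(mx_sum_parts M) rlin_sum //.
by apply: eq_bigr => a _; rewrite rlinZ.
Qed.

Lemma mxpart_inj M M' : (forall b j k, mxpart b j k M = mxpart b j k M') -> M = M'.
Proof.
move=> e; rewrite (mx_sum_parts M) (mx_sum_parts M').
by apply: eq_bigr => a _; rewrite /pmx e.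
Qed.

Lemma mxpart_of b j k f : mxpart b j k (of_mxpart f : 'M[R[i]]_d) = f b j k.
Proof. by rewrite /mxpart mxE; case: b. Qed.

Lemma rlin_cvg g (T : Type) (F : set_system T) {FF : Filter F} (X : T -> 'M[R[i]]_d) M :
  rlin g -> (forall b j k, mxpart b j k (X t) @[t --> F] --> mxpart b j k M) ->
  g (X t) @[t --> F] --> g M.
Proof.
move=> gl XM; rewrite (rlinE M gl); under eq_fun do rewrite (rlinE _ gl).
by apply: cvg_sumr => a _; apply: cvgMr_tmp; exact: XM.
Qed.

Definition rlin_bound g : R := \sum_a `|g (unit_mx a)|.

Lemma rlin_bound_ge0 g : 0 <= rlin_bound g. Proof. exact: sumr_ge0. Qed.

Lemma rlin_le g M c : rlin g -> (forall b j k, `|mxpart b j k M| <= c) ->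
  `|g M| <= rlin_bound g * c.
Proof.
move=> gl Mc; rewrite (rlinE M gl) (le_trans (ler_norm_sum _ _ _)) // mulr_suml.
apply: ler_sum => a _; rewrite normrM mulrC ler_wpM2l //; exact: Mc.
Qed.

(** Matrices as real columns of length [2 * d ^ 2], the setting of [lyapunov_functional]: there the
    Lindblad operator is a real matrix, and a real-linear functional is a row. *)
Definition xi M : 'cV[R]_#|{: partidx}| := \col_a pmx (enum_val a) M.

Definition xi_dual g : 'rV[R]_#|{: partidx}| := \row_a g (unit_mx (enum_val a)).

Lemma xi_dualE g M : rlin g -> pairmx (xi_dual g) (xi M) = g M.
Proof.
move=> gl; rewrite pairmxE (rlinE M gl) [RHS](reindex_onto enum_val enum_rank) /=; last first.
  by move=> a _; rewrite enum_rankK.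
apply: eq_big => [a|a _]; first by rewrite enum_valK eqxx.
by rewrite !mxE mulrC.
Qed.

Lemma pairmx_xi_rlin phi : rlin (fun M => pairmx phi (xi M)).
Proof.
move=> a M M'; rewrite !pairmxE mulr_sumr -big_split; apply: eq_bigr => i _ /=.
by rewrite !mxE pmx_rlin; ring.
Qed.

Definition xi_op (T : 'M[R[i]]_d -> 'M[R[i]]_d) : 'M[R]_#|{: partidx}| :=
  \matrix_(a, b) pmx (enum_val a) (T (unit_mx (enum_val b))).

Lemma xi_opE (T : 'M[R[i]]_d -> 'M[R[i]]_d) M :
  (forall c M M', T (c *: M + M') = c *: T M + T M') -> xi_op T *m xi M = xi (T M).
Proof.
move=> Tl; apply/colP => a; rewrite [RHS]mxE.
rewrite -(@xi_dualE (fun M => pmx (enum_val a) (T M))); last exact: rlin_mxpart.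
by rewrite pairmxE mxE; apply: eq_bigr => b _; rewrite !mxE.
Qed.

Lemma rmxnorm1_le (x : 'cV[R]_#|{: partidx}|) c :
  (forall a, `|x a 0| <= c) -> mxnorm1 x <= #|{: partidx}|%:R * c.
Proof.
move=> xc; rewrite /mxnorm1 mulr_natl -[X in _ *+ X]card_ord -sumr_const.
by apply: ler_sum => a _; rewrite big_ord1.
Qed.

End RealCoordinates.

(** * Positive matrices and states *)

Section States.
Local Open Scope sesquilinear_scope.
Local Open Scope complex_scope.
Context {R : realType} {d : nat}.
Implicit Types (M rho C H : 'M[R[i]]_d).

Lemma linear_sandwich (A B : 'M[R[i]]_d) c M M' :
  A *m (c *: M + M') *m B = c *: (A *m M *m B) + A *m M' *m B.
Proof. by rewrite mulmxDr mulmxDl -scalemxAr -scalemxAl. Qed.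

Lemma Jop_linear C c M M' : Jop C (c *: M + M') = c *: Jop C M + Jop C M'.
Proof. exact: linear_sandwich. Qed.

Lemma Lindblad_linear n H (C : 'I_n.+1 -> 'M[R[i]]_d) c M M' :
  Lindblad H C (c *: M + M') = c *: Lindblad H C M + Lindblad H C M'.
Proof.
rewrite /Lindblad [in RHS]scalerDr scaler_sumr [RHS]addrACA -big_split /=; congr (_ + _).
  rewrite mulmxDr -scalemxAr mulmxDl -scalemxAl opprD addrACA -scalerBr.
  by move: (H *m M - _) (H *m M' - _) => a a'; rewrite scalerDr !scalerA mulrC.
apply: eq_bigr => i _; rewrite linear_sandwich mulmxDr mulmxDl -!scalemxAr -!scalemxAl.
set D := C i ^t* *m C i.
move: (C i *m M *m _) (C i *m M' *m _) (D *m M) (D *m M') (M *m D) (M' *m D).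
move=> J J' a a' b b'.
have -> : c *: a + a' + (c *: b + b') = c *: (a + b) + (a' + b').
  by rewrite scalerDr addrACA.
by rewrite scalerDr scalerA mulrC -scalerA opprD addrACA -scalerBr.
Qed.

Definition qform M (u v : 'cV[R[i]]_d) : R[i] := (u ^t* *m M *m v) 0 0.

Lemma qform_linear (u v : 'cV[R[i]]_d) c M M' :
  qform (c *: M + M') u v = c * qform M u v + qform M' u v.
Proof. by rewrite /qform mulmxDr mulmxDl -scalemxAr -scalemxAl !mxE. Qed.

Lemma ctmxD m n (A B : 'M[R[i]]_(m, n)) : (A + B) ^t* = A ^t* + B ^t*.
Proof. by rewrite linearD /= map_mxD. Qed.

Lemma ctmxZ m n c (A : 'M[R[i]]_(m, n)) : (c *: A) ^t* = c^* *: A ^t*.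
Proof. by rewrite linearZ /= map_mxZ. Qed.

Lemma ctmxM m n q (A : 'M[R[i]]_(m, n)) (B : 'M[R[i]]_(n, q)) :
  (A *m B) ^t* = B ^t* *m A ^t*.
Proof. by rewrite trmx_mul map_mxM. Qed.

Lemma ctmxK m n (A : 'M[R[i]]_(m, n)) : A ^t* ^t* = A.
Proof. by apply/matrixP => i j; rewrite !mxE conjCK. Qed.

Lemma qform_delta M j k : qform M (delta_mx j 0) (delta_mx k 0) = M j k.
Proof.
by rewrite /qform trmx_delta map_delta_mx -rowE -colE !mxE.
Qed.

Lemma qform_pair M j k (c : R[i]) :
  let v := delta_mx j 0 + c *: delta_mx k 0 in
  qform M v v = M j j + c * M j k + c^* * M k j + c^* * c * M k k.
Proof.
move=> v; rewrite -!qform_delta /qform /v ctmxD ctmxZ.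
move: (delta_mx j 0) (delta_mx k 0) => x y.
rewrite mulmxDr !mulmxDl -!scalemxAr -!scalemxAl [LHS]mxE [X in X + _ = _]mxE.
rewrite [X in _ + X + _ = _]mxE [X in _ + X = _]mxE [X in _ + (X + _) = _]mxE.
rewrite [X in _ + (_ + X) = _]mxE [X in _ + (_ + _ * X) = _]mxE.
by rewrite !addrA mulrCA mulrA [LHS](ACl (1*3*2*4)).
Qed.

Lemma psd_pair M j k (c : R[i]) : psd M ->
  let z := M j j + c * M j k + c^* * M k j + c^* * c * M k k in
  complex.Im z = 0 /\ 0 <= complex.Re z.
Proof.
move=> Mp z; have /= := qform_pair M j k c; rewrite -/z => <-.
have := Mp (delta_mx j 0 + c *: delta_mx k 0); rewrite lecE /=.
by case/andP => /eqP -> ->.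
Qed.

Lemma psdP M : psd M <-> forall v, complex.Im (qform M v v) = 0 /\ 0 <= complex.Re (qform M v v).
Proof.
split=> h v; have := h v; rewrite -/(qform M v v) lecE /=.
  by case/andP => /eqP -> ->.
by move=> [-> ->]; rewrite eqxx.
Qed.

Lemma psd_diag M j : psd M -> complex.Im (M j j) = 0 /\ 0 <= complex.Re (M j j).
Proof. by move/psdP => /(_ (delta_mx j 0)); rewrite qform_delta. Qed.

Lemma Re_trace M : complex.Re (\tr M) = \sum_j complex.Re (M j j).
Proof. by rewrite /mxtrace (big_morph (@complex.Re R) (@ReD R) (erefl : complex.Re (0 : R[i]) = 0)). Qed.

Lemma Im_trace M : complex.Im (\tr M) = \sum_j complex.Im (M j j).
Proof. by rewrite /mxtrace (big_morph (@complex.Im R) (@ImD R) (erefl : complex.Im (0 : R[i]) = 0)). Qed.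

Lemma psd_trace M : psd M -> complex.Im (\tr M) = 0 /\ 0 <= complex.Re (\tr M).
Proof.
move=> Mp; rewrite Im_trace Re_trace; split.
  by apply: big1 => j _; have [] := psd_diag j Mp.
by apply: sumr_ge0 => j _; have [] := psd_diag j Mp.
Qed.

Lemma psd_diag_le M j : psd M -> complex.Re (M j j) <= complex.Re (\tr M).
Proof.
move=> Mp; rewrite Re_trace (bigD1 j) //= lerDl; apply: sumr_ge0 => k _.
by have [] := psd_diag k Mp.
Qed.

(** Testing positivity on [delta_mx j 0 + c *: delta_mx k 0] with [c] among [1], [-1], ['i], [- 'i]
    gives hermitian symmetry and bounds each part of [M j k] by half the sum of two diagonal
    entries. *)
Lemma psd_mxpart M b j k : psd M -> `|mxpart b j k M| <= complex.Re (\tr M).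
Proof.
move=> Mp; have ji := psd_diag_le j Mp; have ki := psd_diag_le k Mp.
have [j0 _] := psd_diag j Mp; have [k0 _] := psd_diag k Mp.
have := psd_pair j k 1 Mp; have := psd_pair j k (-1) Mp.
have := psd_pair j k 'i Mp; have := psd_pair j k (- 'i) Mp.
rewrite /mxpart.
move: j0 k0 ji ki; case: (M j j) => a1 b1; case: (M k k) => a2 b2.
case: (M j k) => x y; case: (M k j) => x' y' /= -> -> ji ki [A1 A2] [B1 B2] [C1 C2] [D1 D2].
by rewrite ler_norml; case: b; apply/andP; split; lra.
Qed.

Lemma state_mxpart rho b j k : state rho -> `|mxpart b j k rho| <= 1.
Proof. by move=> [rp r1]; have := psd_mxpart b j k rp; rewrite r1. Qed.

Lemma qform_Jop C rho v : qform (Jop C rho) v v = qform rho (C ^t* *m v) (C ^t* *m v).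
Proof. by rewrite /qform /Jop ctmxM ctmxK !mulmxA. Qed.

Lemma psd_Jop C rho : psd rho -> psd (Jop C rho).
Proof. by move/psdP => rp; apply/psdP => v; rewrite qform_Jop. Qed.

(** A state is cut out by equalities and weak inequalities for real-linear functionals, all
    preserved by limits. The case needed is that of left limits of paths. *)
Lemma state_cvg (T : Type) (F : set_system T) {FF : ProperFilter F}
    (X : T -> 'M[R[i]]_d) M :
  (\forall t \near F, state (X t)) ->
  (forall b j k, mxpart b j k (X t) @[t --> F] --> mxpart b j k M) -> state M.
Proof.
move=> sX XM.
have ge g a : rlin g -> (forall M', state M' -> a <= g M') -> a <= g M.
  move=> gl ag; apply: (cvgr_to_ge (rlin_cvg gl XM)).
  by near=> t; apply: ag; near: t.
have eq g a : rlin g -> (forall M', state M' -> g M' = a) -> g M = a.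
  move=> gl ag; apply/eqP; rewrite eq_le; apply/andP; split.
    apply: (cvgr_to_le (rlin_cvg gl XM)).
    by near=> t; rewrite ag //; near: t.
  by apply: ge => // M' /ag ->.
split.
  apply/psdP => v; split.
    by apply: eq (rlin_Im (qform_linear v v)) _ => M' [/psdP/(_ v)[]].
  by apply: ge (rlin_Re (qform_linear v v)) _ => M' [/psdP/(_ v)[]].
have tl c (M1 M2 : 'M[R[i]]_d) : \tr (c *: M1 + M2) = c * \tr M1 + \tr M2.
  by rewrite mxtraceD mxtraceZ.
apply/eqP; rewrite eq_complex; apply/andP; split; apply/eqP.
  by apply: eq (rlin_Re tl) _ => M' [_ ->].
by apply: eq (rlin_Im tl) _ => M' [_ ->].
Unshelve. all: by end_near. Qed.

End States.

(** * The functional V, jump rates and jump amplitudes *)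

Section Observables.
Local Open Scope sesquilinear_scope.
Local Open Scope complex_scope.
Context {R : realType} {d : nat}.
Implicit Types (M rho C PR PS : 'M[R[i]]_d) (HR HS : {vspace 'cV[R[i]]_d}).

Lemma trM_linear (A : 'M[R[i]]_d) c M M' :
  \tr (A *m (c *: M + M')) = c * \tr (A *m M) + \tr (A *m M').
Proof. by rewrite mulmxDr mxtraceD -scalemxAr mxtraceZ. Qed.

Lemma trJop_linear C c M M' :
  \tr (Jop C (c *: M + M')) = c * \tr (Jop C M) + \tr (Jop C M').
Proof. by rewrite Jop_linear mxtraceD mxtraceZ. Qed.

Lemma Vfun_rlin PR : rlin (Vfun PR).
Proof. exact: rlin_Re (trM_linear PR). Qed.

Lemma Vfun_ge0 HR PR rho : is_orthoproj HR PR -> psd rho -> 0 <= Vfun PR rho.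
Proof.
move=> [sa idem _] rp; have := (psd_trace (psd_Jop PR rp)).2.
by rewrite /Jop sa mxtrace_mulC mulmxA idem.
Qed.

Lemma orthoproj_mul0 HS HR PS PR : is_orthocomp HS HR -> is_orthoproj HS PS ->
  is_orthoproj HR PR -> PR *m PS = 0.
Proof.
move=> HSR [sS _ PSE] [sR _ PRE].
suff e : PS *m PR = 0 by rewrite -sS -sR -ctmxM e trmx0 map_mx0.
apply/matrixP => j k; rewrite -qform_delta [RHS]mxE.
have : PR *m delta_mx k 0 \in HR by apply/PRE; eexists.
move/HSR => /(_ (PS *m delta_mx j 0)).
rewrite (_ : PS *m _ \in HS); last by apply/PSE; eexists.
move=> /(_ isT); rewrite ctmxM sS /qform !mulmxA => ->.
by rewrite mxE.
Qed.

Lemma ler_hsnorm M b j k : `|mxpart b j k M| <= hsnorm M.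
Proof.
rewrite /hsnorm -sqrtr_sqr ler_wsqrtr // Re_trace.
have e l : complex.Re ((M ^t* *m M) l l) =
    \sum_m (complex.Re (M m l) ^+ 2 + complex.Im (M m l) ^+ 2).
  rewrite mxE (big_morph (@complex.Re R) (@ReD R) (erefl : complex.Re (0 : R[i]) = 0)).
  by apply: eq_bigr => m _; rewrite !mxE; case: (M m l) => x y /=; ring.
under eq_bigr do rewrite e.
rewrite (bigD1 k) //= (bigD1 j) //= -!addrA.
have g0 l m : 0 <= complex.Re (M m l) ^+ 2 + complex.Im (M m l) ^+ 2.
  by rewrite addr_ge0 ?sqr_ge0.
rewrite addrA ler_wpDr //.
  by rewrite addr_ge0 //; apply: sumr_ge0 => *; rewrite ?sumr_ge0.
by rewrite /mxpart; case: b; rewrite ?lerDl ?lerDr ?sqr_ge0.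
Qed.

(** Since [PR *m PS = 0], the functional does not see [PS *m M *m PS]; it is therefore controlled by
    the very quantity whose decay defines GAS. *)
Lemma Vfun_hsnorm HS HR PS PR M : is_orthocomp HS HR -> is_orthoproj HS PS ->
  is_orthoproj HR PR ->
  `|Vfun PR M| <= rlin_bound (Vfun PR) * hsnorm (M - PS *m M *m PS).
Proof.
move=> HSR pS pR.
rewrite (_ : Vfun PR M = Vfun PR (M - PS *m M *m PS)); last first.
  rewrite rlinB; last exact: Vfun_rlin.
  rewrite [X in _ - X](_ : _ = 0) ?subr0 //.
  by rewrite /Vfun !mulmxA (orthoproj_mul0 HSR pS pR) !mul0mx mxtrace0.
by apply: rlin_le; [exact: Vfun_rlin|exact: ler_hsnorm].
Qed.

Lemma jump_rate_rlin C : rlin (jump_rate C).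
Proof. exact: rlin_Re (trJop_linear C). Qed.

Lemma trJopE C rho : psd rho -> \tr (Jop C rho) = (jump_rate C rho)%:C.
Proof.
move=> /(psd_Jop C)/psd_trace[]; rewrite /jump_rate.
by case: (\tr _) => x y /= ->.
Qed.

(** Marks above this bound produce no jump from any state, so the jump integrals live on bounded
    boxes. The added 1 makes the bound strict and positive. *)
Definition jump_bound C : R := rlin_bound (jump_rate C) + 1.

Lemma jump_rate_lt C rho : state rho -> jump_rate C rho < jump_bound C.
Proof.
move=> sr; rewrite /jump_bound; apply: (@le_lt_trans _ _ (rlin_bound (jump_rate C) * 1)).
  apply: le_trans (ler_norm _) (rlin_le (jump_rate_rlin C) _).
  by move=> b j k; exact: state_mxpart.
by rewrite mulr1 ltrDl.
Qed.

Lemma jump_bound_gt0 C : 0 < jump_bound C.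
Proof. by rewrite ltr_wpDl // rlin_bound_ge0. Qed.

Definition jump_val C b j k rho : R :=
  (jump_rate C rho)^-1 * mxpart b j k (Jop C rho) - mxpart b j k rho.

Lemma mxpart_jump C b j k rho x : psd rho ->
  mxpart b j k (jump_coef C rho x) =
  if 0 < x < jump_rate C rho then jump_val C b j k rho else 0.
Proof.
move=> rp; rewrite /jump_coef; case: ifP => _; last exact: (rlin0 (mxpart_rlin b j k)).
rewrite (rlinB _ _ (mxpart_rlin b j k)) trJopE // -fmorphV.
by rewrite (rlinZ _ _ (mxpart_rlin b j k)).
Qed.

(** The entries of a positive matrix are bounded by its trace, so normalising by the rate keeps them
    below 1 however small the rate is. *)
Lemma jump_val_le C b j k rho : state rho -> 0 < jump_rate C rho ->
  `|jump_val C b j k rho| <= 2.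
Proof.
move=> sr r0; apply: le_trans (ler_normB _ _) _.
rewrite (_ : 2 = 1 + 1 :> R) // lerD ?state_mxpart //.
rewrite normrM normfV (gtr0_norm r0) mulrC ler_pdivrMr // mul1r.
by have [sp _] := sr; exact: (psd_mxpart b j k (psd_Jop C sp)).
Qed.

(* The indicator of 0 < x < rate is replaced by a continuous cut-off, so that
   the integrand can be approximated along grids. *)
Definition jump_app (q : nat) C b j k (x : R) rho : R :=
  Num.min 1 (q%:R * Num.max 0 (jump_rate C rho - x)) * jump_val C b j k rho.

Lemma jump_app0 q C b j k x rho : jump_rate C rho <= x -> jump_app q C b j k x rho = 0.
Proof.
by move=> rx; rewrite /jump_app max_l ?subr_le0 // mulr0 min_r ?mul0r.
Qed.

Lemma jump_app_le q C b j k x rho : state rho -> 0 <= x ->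
  `|jump_app q C b j k x rho| <= 2.
Proof.
move=> sr x0; have [rx|xr] := leP (jump_rate C rho) x.
  by rewrite jump_app0 // normr0.
rewrite /jump_app normrM -[leRHS]mul1r ler_pM //.
  by rewrite ger0_norm ?ge_min ?lexx // le_min ler01 mulr_ge0 // le_max lexx.
by apply: jump_val_le => //; apply: le_lt_trans xr.
Qed.

Lemma cvg_jump_app_q C b j k x rho : state rho -> 0 < x ->
  jump_app q C b j k x rho @[q --> \oo] --> mxpart b j k (jump_coef C rho x).
Proof.
move=> [rp _] x0; rewrite mxpart_jump // x0 /=.
have [xr|rx] := ltP x (jump_rate C rho); last first.
  by under eq_fun do rewrite jump_app0 //; exact: cvg_cst.
apply: cvg_near_cst; near=> q.
rewrite /jump_app min_l ?mul1r // max_r; last by rewrite subr_ge0 ltW.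
rewrite -ler_pdivrMr ?subr_gt0 // mul1r.
apply: le_trans (ltW (truncnS_gt _)) _; rewrite ler_nat.
by near: q; exact: nbhs_infty_ge.
Unshelve. all: by end_near. Qed.

(** Where the rate vanishes its inverse is discontinuous; there [x > 0] eventually exceeds the rates
    along the sequence, and the cut-off makes the terms 0. *)
Lemma cvg_jump_app q C b j k (u : nat -> R) (X : nat -> 'M[R[i]]_d) (x : R) rho :
  state rho -> 0 < x -> u m @[m --> \oo] --> x ->
  (forall b' j' k', mxpart b' j' k' (X m) @[m --> \oo] --> mxpart b' j' k' rho) ->
  jump_app q C b j k (u m) (X m) @[m --> \oo] --> jump_app q C b j k x rho.
Proof.
move=> [rp _] x0 ux Xr.
have rX : jump_rate C (X m) @[m --> \oo] --> jump_rate C rho.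
  exact: rlin_cvg (jump_rate_rlin C) Xr.
have [r0|r0] := ltP 0 (jump_rate C rho); last first.
  rewrite jump_app0; last exact: le_trans r0 (ltW x0).
  have c : u m - jump_rate C (X m) @[m --> \oo] --> x - jump_rate C rho by exact: cvgB.
  apply: cvg_near_cst; near=> m; apply: jump_app0.
  have : 0 < u m - jump_rate C (X m).
    by near: m; apply: (cvgr_gt _ c); rewrite subr_gt0 (le_lt_trans r0).
  by rewrite subr_gt0 => /ltW.
pose h y := Num.min 1 (q%:R * Num.max 0 y) : R.
have ch : continuous h.
  move=> y; apply: (@continuous_min R R (cst 1) (fun y => q%:R * Num.max 0 y) y).
    exact: cst_continuous.
  apply: cvgM; first exact: cvg_cst.
  by apply: (@continuous_max R R (cst 0) id y) => //; exact: cst_continuous.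
apply: cvgM.
  have H : h (jump_rate C (X m) - u m) @[m --> \oo] --> h (jump_rate C rho - x).
    by apply: continuous_cvg; [exact: ch|exact: cvgB].
  exact: H.
apply: cvgB => //; apply: cvgM; first by apply: cvgV => //; rewrite gt_eqF.
exact: rlin_cvg (rlin_mxpart (Jop_linear C) b j k) Xr.
Unshelve. all: by end_near. Qed.

Lemma measurable_invr : measurable_fun setT (fun r : R => r^-1).
Proof.
rewrite -(setUv [set 0 : R]); apply/measurable_funU => //.
  exact: measurableC.
split; first exact: measurable_fun_set1.
apply: open_continuous_measurable_fun.
  by apply: closed_openC; exact: closed_eq.
by move=> r /set_mem /= /eqP r0; apply: inv_continuous.
Qed.

Lemma measurable_rlin dT (T : measurableType dT) (D : set T) (X : T -> 'M[R[i]]_d) g :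
  rlin g -> (forall b j k, measurable_fun D (fun w => mxpart b j k (X w))) ->
  measurable_fun D (fun w => g (X w)).
Proof.
move=> gl mX; under eq_fun do rewrite (rlinE _ gl).
by apply: measurable_sum => a; apply: measurable_funM => //; exact: mX.
Qed.

Lemma measurable_jump_app dT (T : measurableType dT) (D : set T) (X : T -> 'M[R[i]]_d)
    q C b j k x :
  measurable D -> (forall b j k, measurable_fun D (fun w => mxpart b j k (X w))) ->
  measurable_fun D (fun w => jump_app q C b j k x (X w)).
Proof.
move=> mD mX; have mr := measurable_rlin (jump_rate_rlin C) mX.
apply: measurable_funM.
  apply: measurable_minr => //; apply: measurable_funM => //.
  by apply: measurable_maxr => //; apply: measurable_funB.
apply: measurable_funB => //; apply: measurable_funM.
  by apply: (measurableT_comp measurable_invr).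
exact: measurable_rlin (rlin_mxpart (Jop_linear C) b j k) mX.
Qed.

End Observables.

(** * Limits of integrals along grids *)

Lemma Rintegral_dominated {R : realType} d (T : measurableType d)
    (mu : {measure set T -> \bar R}) (D : set T) (f_ : nat -> T -> R) (f g : T -> R) :
  measurable D -> (forall n, measurable_fun D (f_ n)) ->
  (forall x, D x -> f_ n x @[n --> \oo] --> f x) ->
  mu.-integrable D (EFin \o g) -> (forall n x, D x -> `|f_ n x| <= g x) ->
  mu.-integrable D (EFin \o f) /\
  \int[mu]_(x in D) f_ n x @[n --> \oo] --> \int[mu]_(x in D) f x.
Proof.
move=> mD mf_ f_f gi f_g.
have mf : measurable_fun D f by exact: measurable_fun_cvg f_f.
have [] := @dominated_convergence _ T R mu D mD (fun n => EFin \o f_ n) (EFin \o f) (EFin \o g).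
- by move=> n; exact/measurable_EFinP.
- exact/measurable_EFinP.
- by apply: aeW => x Dx; apply: cvg_EFin; [exact: nearW|exact: f_f].
- exact: gi.
- by apply: aeW => x n Dx /=; rewrite lee_fin; exact: f_g.
move=> fi _ cv; split => //.
apply: fine_cvg; rewrite fineK //.
by apply: integrable_fin_num.
Qed.

Section Grid.
Context {R : realType}.
Implicit Types (a b u : R) (m k : nat).

Definition gpt a b m k : R := a + (b - a) * (k%:R / m.+1%:R).

Lemma gpt0 a b m : gpt a b m 0 = a.
Proof. by rewrite /gpt mul0r mulr0 addr0. Qed.

Lemma gptS a b m : gpt a b m m.+1 = b.
Proof. by rewrite /gpt divff ?pnatr_eq0// mulr1 addrC subrK. Qed.

Lemma gpt_step a b m k : gpt a b m k.+1 - gpt a b m k = (b - a) / m.+1%:R.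
Proof. by rewrite /gpt -natr1; ring. Qed.

Lemma gpt_le a b m k l : a <= b -> (k <= l)%N -> gpt a b m k <= gpt a b m l.
Proof.
move=> ab kl; rewrite /gpt lerD2l ler_wpM2l ?subr_ge0 // ler_pM2r ?invr_gt0 //.
by rewrite ler_nat.
Qed.

Definition gcell a b m k : set R := `]gpt a b m k, gpt a b m k.+1].

Definition gfun a b m (h : R -> R) u : R :=
  \sum_(k < m.+1) h (gpt a b m k) * \1_(gcell a b m k) u.

Lemma gcell_unique a b m k l u : a <= b -> gcell a b m k u -> gcell a b m l u -> k = l.
Proof.
move=> ab; rewrite /gcell /= !in_itv /= => /andP[k1 k2] /andP[l1 l2].
have [kl|kl|//] := ltngtP k l.
- by have := lt_le_trans l1 (le_trans k2 (gpt_le m ab kl)); rewrite ltxx.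
- by have := lt_le_trans k1 (le_trans l2 (gpt_le m ab kl)); rewrite ltxx.
Qed.

Lemma gcell_ex a b m u : a < u -> u <= b -> exists2 k, (k < m.+1)%N & gcell a b m k u.
Proof.
move=> au ub; pose Q j := u <= gpt a b m j.
have Qex : exists j, Q j by exists m.+1; rewrite /Q gptS.
have [j Qj jmin] := ex_minnP Qex.
have j0 : (0 < j)%N.
  by rewrite lt0n; apply/eqP => j0; move: Qj; rewrite j0 /Q gpt0 leNgt au.
exists j.-1; first by rewrite prednK //; apply: jmin; rewrite /Q gptS.
rewrite /gcell /= in_itv /= prednK // -/(Q j) Qj andbT ltNge; apply/negP => Qp.
by have := jmin _ Qp; rewrite leqNgt prednK // leqnn.
Qed.

Lemma gfun_cell a b m k h u : a <= b -> (k < m.+1)%N -> gcell a b m k u ->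
  gfun a b m h u = h (gpt a b m k).
Proof.
move=> ab km ku; rewrite /gfun (bigD1 (Ordinal km)) //= indicE mem_set // mulr1.
rewrite big1 ?addr0 // => l lk; rewrite indicE memNset ?mulr0 // => lu.
by move/eqP: lk; apply; apply: val_inj => /=; exact: gcell_unique lu ku.
Qed.

Lemma gcell_sub a b m k u : a <= b -> (k < m.+1)%N -> gcell a b m k u -> a < u <= b.
Proof.
move=> ab km; rewrite /gcell /= in_itv /= => /andP[k1 k2]; apply/andP; split.
  by apply: le_lt_trans k1; rewrite -{1}(gpt0 a b m) gpt_le.
by apply: (le_trans k2); rewrite -{2}(gptS a b m) gpt_le.
Qed.

Lemma gfun_out a b m h u : a <= b -> ~~ (a < u <= b) -> gfun a b m h u = 0.
Proof.
move=> ab /negP uab; rewrite /gfun big1 // => k _; rewrite indicE memNset ?mulr0 //.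
by move/(gcell_sub ab (ltn_ord k)).
Qed.

(** The last grid point strictly before [u]. Along a cadlag path the values at these points converge
    to the left limit at [u], which is what enters the equation. *)
Definition lgrid a b m u : R := gfun a b m id u.

Lemma gfun_lgrid a b m h u : a < u -> u <= b -> gfun a b m h u = h (lgrid a b m u).
Proof.
move=> au ub; have ab := ltW (lt_le_trans au ub).
by have [k km ku] := gcell_ex m au ub; rewrite /lgrid !(gfun_cell _ ab km ku).
Qed.

Lemma lgridP a b m u : a < u -> u <= b ->
  a <= lgrid a b m u < u /\ u - lgrid a b m u <= (b - a) / m.+1%:R.
Proof.
move=> au ub; have ab := ltW (lt_le_trans au ub).
have [k km ku] := gcell_ex m au ub; rewrite /lgrid !(gfun_cell _ ab km ku).
move: ku; rewrite /gcell /= in_itv /= => /andP[k1 k2]; rewrite k1 andbT; split.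
  by rewrite -{1}(gpt0 a b m) gpt_le.
by rewrite -(gpt_step a b m k) lerD2r.
Qed.

Lemma cvg_c_divS (c : R) : c / m.+1%:R @[m --> \oo] --> (0 : R).
Proof.
rewrite -(mulr0 c); apply: cvgMl_tmp.
exact: cvg_harmonic.
Qed.

Lemma cvg_lgrid a b u : a < u -> u <= b -> lgrid a b m u @[m --> \oo] --> u.
Proof.
move=> au ub; apply: (@squeeze_cvgr _ _ _ _ (fun m => u - (b - a) / m.+1%:R) (fun=> u)).
- apply: nearW => m; have [/andP[_ /ltW ->] h] := lgridP m au ub.
  by rewrite andbT lerBlDr addrC -lerBlDr.
- by rewrite -[X in _ --> X]subr0; apply: cvgB; [exact: cvg_cst|exact: cvg_c_divS].
- exact: cvg_cst.
Qed.

Lemma measurable_gcell a b m k : measurable (gcell a b m k).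
Proof. exact: measurable_itv. Qed.

(* Grids exhausting the line, with mesh tending to 0. *)
Definition lgridT m u : R := lgrid (- m.+1%:R) m.+1%:R (m.+1 * m.+1) u.

(** There are [(m.+1 * m.+1).+1] cells on a length [2 * m.+1], which gives the mesh. *)
Lemma lgridT_dist m u : - m.+1%:R < u -> u <= m.+1%:R ->
  `|u - lgridT m u| <= 2 / m.+1%:R.
Proof.
move=> h1 h2; have [/andP[g1 g2] g3] := lgridP (m.+1 * m.+1) h1 h2.
rewrite /lgridT ger0_norm; last by rewrite subr_ge0 ltW.
apply: (le_trans g3).
have m0 : (0 : R) < m.+1%:R by [].
move: m0; rewrite -[(m.+1 * m.+1).+1%:R]natr1 natrM; set n : R := m.+1%:R => m0.
have nn : 0 < n * n + 1 by rewrite addr_gt0 // mulr_gt0.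
rewrite ler_pdivrMr // mulrAC ler_pdivlMr //; nra.
Qed.

Lemma lgridT_le m u : `|lgridT m u| <= `|u| + 2.
Proof.
have m0 : (0 : R) < m.+1%:R by [].
have [/andP[h1 h2]|h] := boolP (- m.+1%:R < u <= m.+1%:R); last first.
  by rewrite /lgridT /lgrid gfun_out // ?normr0 ?addr_ge0 //; lra.
have := lgridT_dist h1 h2.
have : 2 / m.+1%:R <= 2 :> R by rewrite ler_pdivrMr // ler_peMr // ler1n.
move=> /[swap] /le_trans /[apply] h.
rewrite -[X in `|X|](subrK u) addrC; apply: le_trans (ler_normD _ _) _.
by rewrite lerD2l distrC.
Qed.

Lemma cvg_lgridT u : lgridT m u @[m --> \oo] --> u.
Proof.
apply/cvgrPdist_le => e e0.
near=> m; have um : `|u| < m.+1%:R.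
  apply: lt_trans (truncnS_gt `|u|) _; rewrite ltr_nat ltnS.
  by near: m; exists (Num.truncn `|u|).+1.
move: um; rewrite ltr_norml => /andP[h1 /ltW h2].
apply: le_trans (lgridT_dist h1 h2) _.
have : `|2 / m.+1%:R| <= e :> R.
  near: m; have /cvgrPdist_le/(_ e e0) := cvg_c_divS 2.
  by apply: filterS => m; rewrite sub0r normrN.
by rewrite ger0_norm // divr_ge0.
Unshelve. all: by end_near. Qed.

Lemma lgridTE m u : lgridT m u = \sum_(k < (m.+1 * m.+1).+1)
  gpt (- m.+1%:R) m.+1%:R (m.+1 * m.+1) k * \1_(gcell (- m.+1%:R) m.+1%:R (m.+1 * m.+1) k) u.
Proof. by []. Qed.

End Grid.

(** * Integrals determined by level sets *)

Section Transfer.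
Context {R : realType}.

Lemma measurable_lgridT d (T : measurableType d) (X : T -> R) D m :
  measurable D -> measurable_fun D X -> measurable_fun D (fun w => lgridT m (X w)).
Proof.
move=> mD mX; under eq_fun do rewrite lgridTE.
apply: measurable_sum => k; apply: measurable_funM => //.
apply: (@measurableT_comp _ _ _ _ _ _ (\1_(gcell _ _ _ _) : R -> R) _ X) => //.
by apply: measurable_indic; exact: measurable_gcell.
Qed.

Lemma Rintegral_indicr d (T : measurableType d) (mu : {measure set T -> \bar R})
    (D A : set T) (f : T -> R) :
  \int[mu]_(x in D) (\1_A x * f x) = \int[mu]_(x in D `&` A) f x.
Proof.
rewrite Rintegral_mkcondr; apply: eq_Rintegral => x _ /=.
rewrite /restrict indicE; case: ifPn => xA; last by rewrite mul0r.
by rewrite mul1r.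
Qed.

Lemma Rintegral_sum d (T : measurableType d) (mu : {measure set T -> \bar R})
    (D : set T) (I : Type) (r : seq I) (f : I -> T -> R) :
  measurable D -> (forall i, mu.-integrable D (EFin \o f i)) ->
  mu.-integrable D (EFin \o (fun x => \sum_(i <- r) f i x)) /\
  \int[mu]_(x in D) (\sum_(i <- r) f i x) = \sum_(i <- r) \int[mu]_(x in D) f i x.
Proof.
move=> mD fi; elim: r => [|i r [IH1 IH2]].
  split.
    rewrite (_ : _ \o _ = cst 0%E); first exact: integrable0.
    by apply/funext => x /=; rewrite big_nil.
  by under eq_Rintegral do rewrite big_nil; rewrite /Rintegral integral0 big_nil.
have e : (fun x => \sum_(j <- i :: r) f j x) = f i \+ (fun x => \sum_(j <- r) f j x).
  by apply/funext => x; rewrite big_cons.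
rewrite e big_cons -IH2 -RintegralD //; split => //.
by have := integrableD mD (fi i) IH1; apply: eq_integrable.
Qed.

Lemma integrable_indic_mul d (T : measurableType d) (mu : {measure set T -> \bar R})
    (D A : set T) (f : T -> R) :
  measurable D -> measurable A -> mu.-integrable D (EFin \o f) ->
  mu.-integrable D (EFin \o (fun x => \1_A x * f x)).
Proof.
move=> mD mA fi; have mf : measurable_fun D f.
  by apply/measurable_EFinP; case/integrableP: fi.
apply: le_integrable fi => //.
  by apply/measurable_EFinP; apply: measurable_funM.
move=> x _ /=; rewrite lee_fin normrM ler_piMl // indicE.
by case: (_ \in _); rewrite ?normr1 ?normr0.
Qed.

Lemma Rintegral_lgridT d (T : measurableType d) (mu : {measure set T -> \bar R})
    (A : set T) (X z : T -> R) m :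
  measurable A -> measurable_fun setT X -> mu.-integrable A (EFin \o z) ->
  \int[mu]_(x in A) (lgridT m (X x) * z x) =
  \sum_(k < (m.+1 * m.+1).+1) gpt (- m.+1%:R) m.+1%:R (m.+1 * m.+1) k *
    \int[mu]_(x in A `&` X @^-1` gcell (- m.+1%:R) m.+1%:R (m.+1 * m.+1) k) z x.
Proof.
move=> mA mX zi; set g := gpt _ _ _; set c := gcell _ _ _.
have mc k : measurable (X @^-1` c k).
  by rewrite -[X in measurable X]setTI; apply: mX => //; exact: measurable_gcell.
have ci k : mu.-integrable A (EFin \o (fun x => \1_(X @^-1` c k) x * z x)).
  exact: integrable_indic_mul.
have e x : lgridT m (X x) * z x =
    \sum_(k < (m.+1 * m.+1).+1) g k * (\1_(X @^-1` c k) x * z x).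
  by rewrite lgridTE mulr_suml; apply: eq_bigr => k _; rewrite mulrA.
under eq_Rintegral do rewrite e.
rewrite (Rintegral_sum _ mA _).2 => [|k]; last first.
  by have := integrableZl mA (g k) (ci k); apply: eq_integrable.
by apply: eq_bigr => k _; rewrite RintegralZl // Rintegral_indicr.
Qed.

(** Rounding [X1] and [X2] to a grid turns both integrals into finite combinations, with the same
    coefficients, of the level-set integrals of the hypothesis; dominated convergence removes the
    rounding. Equality of laws and independence, which concern events, become identities of
    expectations in this way. *)
Lemma Rintegral_transfer d1 (T1 : measurableType d1) (mu1 : {measure set T1 -> \bar R})
    d2 (T2 : measurableType d2) (mu2 : {measure set T2 -> \bar R})
    (A1 : set T1) (A2 : set T2) (X1 z1 : T1 -> R) (X2 z2 : T2 -> R) (c : R) :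
  measurable A1 -> measurable A2 ->
  measurable_fun setT X1 -> measurable_fun setT X2 ->
  mu1.-integrable A1 (EFin \o z1) -> mu1.-integrable A1 (EFin \o (X1 \* z1)) ->
  mu2.-integrable A2 (EFin \o z2) -> mu2.-integrable A2 (EFin \o (X2 \* z2)) ->
  (forall E, measurable E -> \int[mu1]_(x in A1 `&` X1 @^-1` E) z1 x =
     c * \int[mu2]_(x in A2 `&` X2 @^-1` E) z2 x) ->
  \int[mu1]_(x in A1) (X1 x * z1 x) = c * \int[mu2]_(x in A2) (X2 x * z2 x).
Proof.
move=> mA1 mA2 mX1 mX2 z1i Xz1i z2i Xz2i EE.
have cv d (T : measurableType d) (mu : {measure set T -> \bar R}) (A : set T)
    (X z : T -> R) : measurable A -> measurable_fun setT X ->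
    mu.-integrable A (EFin \o z) -> mu.-integrable A (EFin \o (X \* z)) ->
    \int[mu]_(x in A) (lgridT m (X x) * z x) @[m --> \oo] -->
    \int[mu]_(x in A) (X x * z x).
  move=> mA mX zi Xzi.
  have mz : measurable_fun A z by apply/measurable_EFinP; case/integrableP: zi.
  have [] := @Rintegral_dominated _ _ _ mu A (fun m x => lgridT m (X x) * z x)
     (fun x => X x * z x) (fun x => `|X x * z x| + 2 * `|z x|) mA => //.
  - move=> m; apply: measurable_funM => //; apply: measurable_lgridT => //.
    exact: measurable_funTS.
  - by move=> x _; apply: cvgMr_tmp; exact: cvg_lgridT.
  - have := integrableD mA (integrable_abse Xzi) (integrableZl mA 2 (integrable_abse zi)).
    by apply: eq_integrable.
  - by move=> m x _; rewrite !normrM -mulrDl ler_wpM2r // lgridT_le.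
have := cv _ _ _ _ _ _ mA1 mX1 z1i Xz1i.
under eq_fun do rewrite (Rintegral_lgridT _ mA1 mX1 z1i).
move/cvg_unique; apply => //.
have := @cvgMl_tmp _ _ _ _ _ c _ (cv _ _ _ _ _ _ mA2 mX2 z2i Xz2i).
under eq_fun do rewrite (Rintegral_lgridT _ mA2 mX2 z2i).
move=> /(_ _) H; apply: cvg_trans H; apply: near_eq_cvg; apply: nearW => m /=.
rewrite mulr_sumr; apply: eq_bigr => k _.
by rewrite (EE _ (measurable_gcell _ _ _ k)) [LHS]mulrCA.
Qed.

End Transfer.

(** * Means of normal and Poisson variables *)

Section NormalMean.
Context {R : realType}.
Notation mu := (@lebesgue_measure R).

Lemma ge0_integral_oppr (G : R -> R) : continuous G -> (forall x, 0 <= G x) ->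
  (\int[mu]_x (G x)%:E = \int[mu]_x (G (- x))%:E)%E.
Proof.
move=> cG G0.
have half (F : R -> R) : continuous F -> (forall x, 0 <= F x) ->
    (\int[mu]_(x in `]-oo, 0%R]) (F x)%:E = \int[mu]_(x in `[0%R, +oo[) (F (- x))%:E)%E.
  move=> cF F0; rewrite -{1}oppr0 ge0_integration_by_substitutionNy //.
  exact: continuous_subspaceT.
have split (F : R -> R) : continuous F -> (forall x, 0 <= F x) ->
    (\int[mu]_x (F x)%:E = \int[mu]_(x in `]-oo, 0%R]) (F x)%:E +
      \int[mu]_(x in `[0%R, +oo[) (F x)%:E)%E.
  move=> cF F0; have mF : measurable_fun setT F by exact: continuous_measurable_fun.
  rewrite -(setUv `]-oo, 0%R]) ge0_integral_setU //=; last 4 first.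
  - exact: measurableC.
  - by apply/measurable_EFinP; apply: measurable_funTS.
  - by move=> x _; rewrite lee_fin.
  - exact/disj_setPCl.
  congr (_ + _)%E; rewrite setCitvl integral_itv_obnd_cbnd //.
  by apply/measurable_EFinP; apply: measurable_funTS.
have cGN : continuous (fun x => G (- x)).
  by move=> x; apply: (@continuous_comp _ _ _ -%R G); [exact: opp_continuous|exact: cG].
rewrite split // [RHS]split // (half G) // (half (fun x => G (- x))) // addeC.
by under [in RHS]eq_integral do rewrite opprK.
Qed.

Variable s : R.
Hypothesis s0 : s != 0.
Let pdf := normal_pdf 0 s.

Lemma normal_pdf0N x : pdf (- x) = pdf x.
Proof. by rewrite /pdf normal_pdfE // /normal_fun !subr0 sqrrN. Qed.

(** The absolute value of [x] is at most [expR x + expR (- x)]. Completing the square, [expR x]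
    times the centred density is [expR (s ^+ 2 / 2)] times the density centred at [s ^+ 2], and
    symmetrically for [expR (- x)]. *)
Lemma integrable_norm_normal_pdf : mu.-integrable setT (EFin \o (fun x => x * pdf x)).
Proof.
have s20 : s ^+ 2 != 0 by rewrite expf_neq0.
pose g x := expR (s ^+ 2 / 2) * (normal_pdf (s ^+ 2) s x + normal_pdf (- s ^+ 2) s x).
have gi : mu.-integrable setT (EFin \o g).
  have := integrableZl measurableT (expR (s ^+ 2 / 2)) (integrableD measurableT
    (integrable_normal_pdf (s ^+ 2) s) (integrable_normal_pdf (- s ^+ 2) s)).
  by apply: eq_integrable.
apply: le_integrable gi => //.
  apply/measurable_EFinP; apply: measurable_funM => //; exact: measurable_normal_pdf.
move=> x _ /=; rewrite lee_fin [leRHS]ger0_norm; last first.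
  by rewrite /g mulr_ge0 ?expR_ge0 // addr_ge0 // normal_pdf_ge0.
rewrite normrM (ger0_norm (normal_pdf_ge0 _ _ _)) /g /pdf !normal_pdfE //.
rewrite /normal_fun subr0 -mulrDr mulrCA [leRHS]mulrCA ler_wpM2l ?normal_peak_ge0 //.
have shift (e : R) : e ^+ 2 = 1 -> expR (s ^+ 2 / 2) *
    expR (- (x - e * s ^+ 2) ^+ 2 / (s ^+ 2 *+ 2)) = expR (e * x) * expR (- x ^+ 2 / (s ^+ 2 *+ 2)).
  move=> e1; rewrite -!expRD; congr expR; rewrite -mulr_natr sqrrB exprMn e1 mul1r.
  by field.
rewrite mulrDr.
have := shift 1; rewrite expr1n mul1r => ->//; have := shift (-1); rewrite sqrrN expr1n mulN1r => -> //.
rewrite mulN1r mul1r -mulrDl ler_wpM2r ?expR_ge0 //.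
have a1 := expR_ge1Dx x; have a2 := expR_ge1Dx (- x).
have := expR_gt0 x; have := expR_gt0 (- x) => a3 a4.
by rewrite ler_norml; apply/andP; split; lra.
Qed.

(** Write [x] as the difference of its positive and negative parts; reflection exchanges their
    integrals. *)
Lemma normal_mean0 : \int[mu]_x (x * pdf x) = 0.
Proof.
pose G x := Num.max x 0 * pdf x.
have cG : continuous G.
  move=> x; apply: cvgM; last exact: continuous_normal_pdf.
  by apply: (@continuous_max _ _ id (cst 0)) => //; exact: cst_continuous.
have G0 x : 0 <= G x by rewrite /G mulr_ge0 ?normal_pdf_ge0 // le_max lexx orbT.
have Gi (F : R -> R) : measurable_fun setT F -> (forall x, `|F x| <= `|x|) ->
    mu.-integrable setT (EFin \o (fun x => F x * pdf x)).
  move=> mF Fx; apply: le_integrable integrable_norm_normal_pdf => //.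
    apply/measurable_EFinP; apply: measurable_funM => //; exact: measurable_normal_pdf.
  by move=> x _ /=; rewrite lee_fin !normrM ler_wpM2r.
have e x : x * pdf x = G x - G (- x).
  rewrite /G normal_pdf0N -mulrBl; congr (_ * _).
  by case: (leP 0 x) => x0; case: (leP 0 (- x)) => y0; lra.
under eq_Rintegral do rewrite e.
rewrite RintegralB //.
- by rewrite /Rintegral -ge0_integral_oppr // subrr.
- apply: Gi => [|x].
    by apply: measurable_maxr.
  by rewrite ger0_norm ?le_max ?lexx ?orbT // ge_max normr_ge0 ler_norm.
- rewrite (_ : _ \o _ = EFin \o (fun x => Num.max (- x) 0 * pdf x)); last first.
    by apply/funext => x /=; rewrite /G normal_pdf0N.
  apply: Gi => [|x].
    by apply: measurable_maxr.
  by rewrite ger0_norm ?le_max ?lexx ?orbT // ge_max normr_ge0 -normrN ler_norm.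
Qed.

End NormalMean.

Lemma mul_cst1 {R : realType} (T : Type) (f : T -> R) : (fun w => f w * cst 1 w) = f.
Proof. by apply/funext => w; rewrite /= mulr1. Qed.

Section Laws.
Context {R : realType} {dO : measure_display} {Om : measurableType dO}.
Variable P : probability Om R.

Lemma integrable_bounded (D : set Om) (f : Om -> R) M : measurable D ->
  measurable_fun D f -> (forall w, D w -> `|f w| <= M) -> P.-integrable D (EFin \o f).
Proof.
move=> mD mf fM; have Mi : P.-integrable D (EFin \o cst M).
  by apply: (integrableS measurableT) => //; exact: finite_measure_integrable_cst.
apply: le_integrable Mi => //; first exact/measurable_EFinP.
by move=> w Dw /=; rewrite lee_fin; apply: le_trans (fM w Dw) (ler_norm _).
Qed.

Lemma Rintegral_prob1 (A : set Om) : measurable A ->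
  \int[P]_(w in A) 1 = fine (P A).
Proof. by move=> mA; rewrite Rintegral_cst // mul1r. Qed.

Lemma measurable_preim (eta : Om -> R) (E : set R) : measurable_fun setT eta ->
  measurable E -> measurable (eta @^-1` E).
Proof. by move=> me mE; rewrite -[X in measurable X]setTI; exact: me. Qed.

(* The transfer of integrals is applied twice: to eta with weight 1, then to Y
   with weight eta. *)
Lemma indep_Rintegral (G : set (set Om)) (eta Y : Om -> R) (A : set Om) M :
  G `<=` measurable -> setI_closed G ->
  measurable_fun setT eta -> P.-integrable setT (EFin \o eta) ->
  (forall B E, G B -> measurable E ->
     P (B `&` eta @^-1` E) = (P B * P (eta @^-1` E))%E) ->
  (forall E, measurable E -> G (Y @^-1` E)) -> (forall w, `|Y w| <= M) -> G A ->
  \int[P]_(w in A) (Y w * eta w) = \int[P]_(w in A) Y w * \int[P]_w eta w.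
Proof.
move=> Gm GI meta etai ind GY YM GA.
have mY : measurable_fun setT Y by move=> _ E mE; rewrite setTI; exact/Gm/GY.
have i1 (B : set Om) : measurable B -> P.-integrable B (EFin \o cst 1).
  by move=> mB; apply: (@integrable_bounded _ _ 1) => // w _; rewrite normr1.
have step1 B : G B -> \int[P]_(w in B) eta w = fine (P B) * \int[P]_w eta w.
  move=> GB; have mB := Gm _ GB.
  have etaB : P.-integrable B (EFin \o eta) by apply: (integrableS measurableT).
  have := @Rintegral_transfer R _ _ P _ _ P B setT eta (cst 1) eta (cst 1) (fine (P B)).
  rewrite /GRing.mul_fun !mul_cst1.
  apply => //; [exact: i1|exact: i1|].
  move=> E mE; have mE' := measurable_preim meta mE.
  rewrite setTI !Rintegral_prob1 //; last exact: measurableI.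
  by rewrite ind // fineM // fin_num_measure.
have mA := Gm _ GA.
have etaA : P.-integrable A (EFin \o eta) by apply: (integrableS measurableT).
have := @Rintegral_transfer R _ _ P _ _ P A A Y eta Y (cst 1) (\int[P]_w eta w).
rewrite /GRing.mul_fun !mul_cst1 => H; rewrite mulrC; apply: H => //.
- apply: le_integrable (integrableZl mA M etaA) => //.
    apply/measurable_EFinP; apply: measurable_funM; first exact: measurable_funTS.
    by apply: measurable_funTS.
  move=> w _ /=; rewrite lee_fin normrM [leRHS]normrM ler_wpM2r //.
  exact: le_trans (YM w) (ler_norm _).
- exact: i1.
- by apply: (@integrable_bounded _ _ M) => //; exact: measurable_funTS.
- move=> E mE; have GAE : G (A `&` Y @^-1` E) by apply: GI => //; exact: GY.
  by rewrite step1 // (Rintegral_prob1 (Gm _ GAE)) mulrC.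
Qed.

(** Transfer presupposes integrability, which is not known beforehand. The truncations of the
    absolute value at [n] are bounded, so transfer applies to them and bounds their means by the
    absolute moment [c] of the density; monotone convergence then gives integrability of [eta]. *)
Lemma normal_law_mean0 (eta : Om -> R) s : s != 0 -> measurable_fun setT eta ->
  (forall B, measurable B -> P (eta @^-1` B) = normal_prob 0 s B) ->
  P.-integrable setT (EFin \o eta) /\ \int[P]_w eta w = 0.
Proof.
move=> s0 meta law; pose mu := @lebesgue_measure R; pose pdf := normal_pdf 0 s.
have pdfi : mu.-integrable setT (EFin \o pdf) by exact: integrable_normal_pdf.
have xpdfi := integrable_norm_normal_pdf s0.
have transf (h : R -> R) : measurable_fun setT h -> P.-integrable setT (EFin \o (h \o eta)) ->
    mu.-integrable setT (EFin \o (h \* pdf)) ->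
    \int[P]_w h (eta w) = \int[mu]_x (h x * pdf x).
  move=> mh hi hpi.
  have := @Rintegral_transfer R _ _ P _ _ mu setT setT (h \o eta) (cst 1) h pdf 1.
  rewrite /GRing.mul_fun !mul_cst1 mul1r; apply => //.
  - exact: measurableT_comp.
  - by apply: (@integrable_bounded _ _ 1) => // w _; rewrite normr1.
  - move=> E mE; rewrite !setTI mul1r.
    have mhE : measurable (h @^-1` E) by rewrite -[X in measurable X]setTI; exact: mh.
    rewrite Rintegral_prob1; last exact: measurable_preim (measurableT_comp mh meta) mE.
    by rewrite (_ : (h \o eta) @^-1` E = eta @^-1` (h @^-1` E)) // law.
pose c := \int[mu]_x (`|x| * pdf x).
have npdfi : mu.-integrable setT (EFin \o (fun x => `|x| * pdf x)).
  apply: le_integrable xpdfi => //.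
    apply/measurable_EFinP; apply: measurable_funM => //; exact: measurable_normal_pdf.
  by move=> x _ /=; rewrite lee_fin !normrM normr_id.
pose h (n : nat) (x : R) := Num.min `|x| n%:R.
have mh n : measurable_fun setT (h n) by apply: measurable_minr => //; exact: measurableT_comp.
have h0 n x : 0 <= h n x by rewrite le_min normr_ge0 ler0n.
have hb n : \int[P]_w h n (eta w) <= c.
  have hx n' x : `|h n' x * pdf x| <= `| (`|x| * pdf x) |.
    rewrite !normrM ler_wpM2r // (ger0_norm (h0 _ _)) normr_id.
    by rewrite ge_min lexx.
  have hpi : mu.-integrable setT (EFin \o (h n \* pdf)).
    apply: le_integrable npdfi => //.
      apply/measurable_EFinP; apply: measurable_funM; [exact: mh|exact: measurable_normal_pdf].
    by move=> x _ /=; rewrite lee_fin.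
  rewrite transf //; last first.
    apply: (@integrable_bounded _ _ n%:R) => //; first exact: measurableT_comp.
    by move=> w _; rewrite ger0_norm //= ge_min lexx orbT.
  apply: le_Rintegral => // x _.
  by rewrite ler_wpM2r ?normal_pdf_ge0 // ge_min lexx.
have etai : P.-integrable setT (EFin \o eta).
  apply/integrableP; split; first exact/measurable_EFinP.
  apply: (@le_lt_trans _ _ c%:E); last exact: ltry.
  have lim w : limn (fun n => (h n (eta w))%:E) = `|(eta w)%:E|%E.
    apply: cvg_lim => //; apply: cvg_near_cst; near=> n; congr EFin.
    rewrite /h min_l //; apply: le_trans (ltW (truncnS_gt _)) _; rewrite ler_nat.
    by near: n; exact: nbhs_infty_ge.
  under eq_integral do rewrite -lim.
  rewrite monotone_convergence //; first last.
  - by move=> w _ n m nm; rewrite lee_fin /h le_min !ge_min lexx /= ler_nat nm orbT.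
  - by move=> n w _; rewrite lee_fin.
  - by move=> n; apply/measurable_EFinP; exact: measurableT_comp.
  apply: lime_le.
    apply: ereal_nondecreasing_is_cvgn => n m nm; apply: ge0_le_integral => //.
    - by move=> x _; rewrite lee_fin.
    - by apply/measurable_EFinP; exact: measurableT_comp.
    - by apply/measurable_EFinP; exact: measurableT_comp.
    - by move=> w _; rewrite lee_fin /h le_min !ge_min lexx /= ler_nat nm orbT.
  apply: nearW => n; rewrite -(@fineK _ (\int[P]_w _)%E) ?lee_fin; first exact: hb.
  apply: integrable_fin_num => //.
  apply: (@integrable_bounded _ _ n%:R) => //; first exact: measurableT_comp.
  by move=> w _; rewrite ger0_norm //= ge_min lexx orbT.
split => //; have := transf id; rewrite normal_mean0 //; apply => //.
Unshelve. all: by end_near. Qed.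

(** Cancelling [k] against its factorial leaves [l] times the exponential series shifted by one
    index. *)
Lemma poisson_law_mean (N : Om -> \bar R) (l : R) : 0 <= l -> measurable_fun setT N ->
  (forall w, exists k : nat, N w = k%:R%:E) ->
  (forall k : nat, P [set w | N w = k%:R%:E] = (l ^+ k / k`!%:R * expR (- l))%:E) ->
  P.-integrable setT N /\ \int[P]_w fine (N w) = l.
Proof.
move=> l0 mN Nk law.
have mNk (k : nat) : measurable [set w | N w = k%:R%:E].
  by have := mN measurableT _ (emeasurable_set1 (k%:R%:E : \bar R)); rewrite setTI.
pose f (k : nat) w := (k%:R * \1_[set w | N w = k%:R%:E] w : R)%:E.
have f0 k w : (0 <= f k w)%E by rewrite lee_fin mulr_ge0.
have fE w : (\sum_(0 <= k <oo) f k w)%E = N w.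
  have [k Nwk] := Nk w.
  apply: cvg_lim => //; apply: cvg_near_cst; near=> n.
  have kn : (k < n)%N by near: n; exact: nbhs_infty_gt.
  rewrite big_mkord (bigD1 (Ordinal kn)) //= big1; last first.
    move=> j jk; rewrite /f indicE memNset ?mulr0 //= Nwk => -[/eqP].
    by rewrite eqr_nat => /eqP kj; move/eqP: jk; apply; apply: val_inj.
  by rewrite adde0 /f indicE mem_set //= mulr1 Nwk.
have intN : (\int[P]_w N w = l%:E)%E.
  under eq_integral do rewrite -fE.
  rewrite integral_nneseries //; last first.
    move=> k; apply/measurable_EFinP; apply: measurable_funM => //.
  have fk k : (\int[P]_w f k w = (k%:R * (l ^+ k / k`!%:R * expR (- l)))%:E)%E.
    under eq_integral do rewrite /f EFinM.
    rewrite ge0_integralZl ?lee_fin // ?(integral_indic _ measurableT (mNk k)) ?setIT //; last first.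
      by apply/measurable_EFinP; exact: measurable_indic.
    by rewrite EFinM; congr (_ * _)%E; exact: law.
  under eq_eseriesr do rewrite fk.
  apply: cvg_lim => //.
  rewrite -(cvg_shiftn 1) /=.
  have e n : (\sum_(0 <= k < n + 1) (k%:R * (l ^+ k / k`!%:R * expR (- l)))%:E)%E =
      (l * expR (- l) * series (exp_coeff l) n)%:E.
    rewrite sumEFin addn1 big_nat_recl // mul0r add0r /series /= mulr_sumr; congr EFin.
    apply: eq_bigr => k _; rewrite /exp_coeff /= factS natrM exprS.
    have h1 : k.+1%:R != 0 :> R by rewrite pnatr_eq0.
    have h2 : (k`!)%:R != 0 :> R by rewrite pnatr_eq0 -lt0n fact_gt0.
    move: h1 h2; move: (k.+1%:R : R) (k`!%:R : R) => a b a0 b0.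
    by field; rewrite a0 b0.
  under eq_fun do rewrite e.
  have : (l * expR (- l) * series (exp_coeff l) n)%:E @[n --> \oo] -->
      (l * expR (- l) * expR l)%:E.
    apply: cvg_EFin; first exact: nearW.
    by apply: cvgMl_tmp; exact: is_cvg_series_exp_coeff.
  by rewrite -mulrA -expRD addNr expR0 mulr1.
have N0 w : (0 <= N w)%E by have [k ->] := Nk w; rewrite lee_fin.
split; last by rewrite /Rintegral -[RHS]/(fine l%:E) -intN; congr fine;
  apply: eq_integral => w _; rewrite fineK //; have [k ->] := Nk w.
apply/integrableP; split => //.
by under eq_integral do rewrite gee0_abs //; rewrite intN ltry.
Unshelve. all: by end_near. Qed.

End Laws.

(** * Independence of the future noise *)

Lemma g_sigma_setI (T : pointedType) (G : set (set T)) : setI_closed <<s G >>.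
Proof.
move=> A B GA GB.
exact: (@measurableI _ (g_sigma_algebraType G) A B GA GB).
Qed.

Section IndependentSystems.
Context {R : realType} {dO : measure_display} {Om : measurableType dO}.
Variable P : probability Om R.

Lemma probDI (A B : set Om) : measurable A -> measurable B ->
  P A = (P (A `\` B) + P (A `&` B))%E.
Proof. exact: measureDI. Qed.

Lemma prob_symdiff (A B : set Om) : measurable A -> measurable B ->
  P.-negligible ((A `\` B) `|` (B `\` A)) -> P A = P B.
Proof.
move=> mA mB N; rewrite (probDI mA mB) (probDI mB mA) setIC.
have zA : P (A `\` B) = 0%E.
  apply: measure_negligible; first exact: measurableD.
  by apply: negligibleS N; exact: subsetUl.
have zB : P (B `\` A) = 0%E.
  apply: measure_negligible; first exact: measurableD.
  by apply: negligibleS N; exact: subsetUr.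
by rewrite zA zB.
Qed.

Lemma dynkin_indep (G : set (set Om)) (E : set Om) :
  setI_closed G -> G `<=` measurable -> measurable E ->
  (forall B, G B -> P (B `&` E) = (P B * P E)%E) ->
  forall B, <<s G >> B -> P (B `&` E) = (P B * P E)%E.
Proof.
move=> GI Gm mE GE.
pose K := [set B | measurable B /\ P (B `&` E) = (P B * P E)%E].
suff : <<s G >> `<=` K by move=> h B /h[].
have PEf : P E \is a fin_num by exact: fin_num_measure.
apply: lambda_system_subset => //; last by move=> B GB; split; [exact: Gm|exact: GE].
split => //.
- split; first exact: measurableT.
  by rewrite setTI probability_setT mul1e.
- move=> A B BA [mA EA] [mB EB]; split; first exact: measurableD.
  have mAB : measurable (A `\` B) by exact: measurableD.
  have e1 : P (A `&` E) = (P ((A `\` B) `&` E) + P (B `&` E))%E.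
    rewrite (probDI (measurableI _ _ mA mE) mB); congr (P _ + P _)%E.
      by rewrite setDE setIAC.
    by rewrite setIAC (setIidr BA).
  have e2 : P A = (P (A `\` B) + P B)%E.
    by rewrite (probDI mA mB) (setIidr BA).
  move: e1; rewrite EA EB e2.
  have : P ((A `\` B) `&` E) \is a fin_num by rewrite fin_num_measure //; exact: measurableI.
  have : P (A `\` B) \is a fin_num by exact: fin_num_measure.
  have : P B \is a fin_num by exact: fin_num_measure.
  move: PEf; case: (P B) => // z; case: (P (A `\` B)) => // y.
  case: (P ((A `\` B) `&` E)) => // x; case: (P E) => // t _ _ _ _ [e].
  by congr EFin; lra.
- move=> F ndF FK; have mF i : measurable (F i) by have [] := FK i.
  have mU : measurable (\bigcup_i F i) by exact: bigcupT_measurable.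
  split => //.
  have c1 : P (F i) @[i --> \oo] --> P (\bigcup_i F i) by exact: nondecreasing_cvg_mu.
  have c2 : P (F i `&` E) @[i --> \oo] --> P ((\bigcup_i F i) `&` E).
    rewrite setI_bigcupl; apply: nondecreasing_cvg_mu.
    - by move=> i; exact: measurableI.
    - by apply: bigcupT_measurable => i; exact: measurableI.
    - move=> i j ij; apply/subsetPset; apply: setSI; apply/subsetPset; exact: ndF.
  have e i : P (F i `&` E) = (P (F i) * P E)%E by have [] := FK i.
  have c3 : P (F i `&` E) @[i --> \oo] --> (P (\bigcup_i F i) * P E)%E.
    rewrite (_ : (fun i => _) = (fun i => P (F i) * P E)%E); last exact/funext.
    exact: cvgeZr.
  by apply: (cvg_unique _ c2 c3) => //; exact: ereal_hausdorff.
Qed.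

(** The filtration contains null sets, which need not fit the product form of independent events.
    Allowing null modifications keeps stability under intersection and does not change
    probabilities. *)
Definition null_modification (G : set (set Om)) : set (set Om) :=
  [set B | measurable B /\ exists2 B0, G B0 & P.-negligible ((B `\` B0) `|` (B0 `\` B))].

(** Only the source [i0] is restricted, to the smaller system [H]; all others enter in full. On an
    intersection with one event per source, [E] merges with the factor at [i0], and joint
    independence factors it out. *)
Lemma indep_complement (I : finType) (G : I -> set (set Om)) (i0 : I) (H : set (set Om))
    (E : set Om) :
  independent_systems P G ->
  (forall i, G i `<=` measurable) ->
  (forall i, setI_closed (G i)) -> (forall i, G i setT) -> (forall i, G i set0) ->
  H `<=` G i0 -> setI_closed H -> H setT -> H set0 ->
  G i0 E -> (forall B, H B -> G i0 (B `&` E)) ->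
  (forall B, H B -> P (B `&` E) = (P B * P E)%E) ->
  P.-negligible `<=` measurable ->
  forall B, <<s (\bigcup_i (if i == i0 then H else G i)) `|` P.-negligible >> B ->
    P (B `&` E) = (P B * P E)%E.
Proof.
move=> ind Gm GI GT G0 HG HI HT H0 GE GHE HE Pc.
pose G' i := if i == i0 then H else G i.
have G'G i : G' i `<=` G i by rewrite /G'; case: eqP => [->|_]; [exact: HG|exact: subset_refl].
have G'I i : setI_closed (G' i) by rewrite /G'; case: ifP => _; [exact: HI|exact: GI].
have G'T i : G' i setT by rewrite /G'; case: ifP.
have G'0 i : G' i set0 by rewrite /G'; case: ifP.
pose Pi := [set B | exists2 D : I -> set Om, (forall i, G' i (D i)) &
   B = \bigcap_(i in [set` [set: I]%SET]) D i].
have mE := Gm _ _ GE.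
have PiI : setI_closed Pi.
  move=> _ _ [D1 D1G ->] [D2 D2G ->]; exists (fun i => D1 i `&` D2 i).
    by move=> i; exact: G'I.
  by rewrite bigcapI.
have Pim : Pi `<=` measurable.
  move=> _ [D DG ->]; apply: fin_bigcap_measurable => // i _.
  exact/Gm/G'G.
have PiG' i : G' i `<=` Pi.
  move=> B GB; exists (fun j => if j == i then B else setT).
    by move=> j; case: eqP => [->|] //.
  apply/seteqP; split => [w Bw j _|w /(_ i)]; first by case: eqP.
  by rewrite eqxx; apply; rewrite /= finset.in_setT.
have PiE B : Pi B -> P (B `&` E) = (P B * P E)%E.
  move=> [D DG ->].
  have iT (j : I) : [set` [set: I]%SET] j by rewrite /= finset.in_setT.
  pose D' i := if i == i0 then D i `&` E else D i.
  have D'G i : G i (D' i).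
    rewrite /D'; case: eqP => [->|_]; last exact/G'G.
    by apply: GHE; have := DG i0; rewrite /G' eqxx.
  have -> : \bigcap_(i in [set` [set: I]%SET]) D i `&` E = \bigcap_(i in [set` [set: I]%SET]) D' i.
    apply/seteqP; split => [w [Dw Ew] i _|w D'w].
      by rewrite /D'; case: eqP => _; [split => //|]; exact: Dw.
    have D'w0 := D'w i0 (iT i0); rewrite /D' eqxx in D'w0.
    split; last by case: D'w0.
    move=> i _; have := D'w i (iT i); rewrite /D'; case: eqP => // _.
    by case.
  rewrite (ind [set: I]%SET D') // (ind [set: I]%SET D); last by move=> i _; exact/G'G.
  rewrite (bigD1 i0) ?finset.in_setT //= [in RHS](bigD1 i0) ?finset.in_setT //= {1}/D' eqxx.
  rewrite HE; last by have := DG i0; rewrite /G' eqxx.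
  rewrite -!muleA; congr (_ * _)%E; rewrite muleC; congr (_ * _)%E.
  by apply: eq_bigr => i /andP[_ /negbTE ii0]; rewrite /D' ii0.
pose Pi' := null_modification Pi.
have Pi'I : setI_closed Pi'.
  move=> A B [mA [A0 PA0 NA]] [mB [B0 PB0 NB]]; split; first exact: measurableI.
  exists (A0 `&` B0); first exact: PiI.
  apply: negligibleS (negligibleU NA NB) => w.
  move=> [[[Aw Bw] nAB]|[[Aw Bw] nAB]].
    have [A0w|A0w] := pselect (A0 w); last by left; left.
    by right; left; split => // B0w; apply: nAB.
  have [A0w|A0w] := pselect (A w); last by left; right.
  by right; right; split => // B0w; apply: nAB.
have Pi'E B : Pi' B -> P (B `&` E) = (P B * P E)%E.
  move=> [mB [B0 PB0 NB]]; have mB0 := Pim _ PB0.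
  rewrite (prob_symdiff mB mB0 NB) -(PiE _ PB0); apply: prob_symdiff.
  - exact: measurableI.
  - exact: measurableI.
  - by apply: negligibleS NB => w [[[Bw Ew] n]|[[Bw Ew] n]]; [left|right]; split => // ?; apply: n.
move=> B GB; apply: (dynkin_indep Pi'I _ mE Pi'E); first by move=> ? [].
apply: sub_sigma_algebra2 GB => A [[i _ GA]|NA].
  have PA : Pi A by exact: PiG' GA.
  split; first exact: Pim.
  by exists A => //; rewrite setDv setU0; exact: negligible_set0.
split; first exact: Pc.
exists set0; first exact: PiG' (G'0 i0).
by rewrite setD0 set0D setU0.
Qed.

End IndependentSystems.

(** * Poisson counts before and after a given time *)

Section PoissonFuture.
Context {R : realType} {dO : measure_display} {Om : measurableType dO}.
Variable P : probability Om R.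
Variable N : Om -> {measure set (plane R) -> \bar R}.
Hypothesis pN : poisson_point_process P N.
Hypothesis Pc : P.-negligible `<=` measurable.

Let sys (B : set (plane R)) : set (set Om) :=
  preimage_set_system setT (fun w => N w B) measurable.

Let sys_measurable B : measurable B -> sys B `<=` measurable.
Proof.
by move=> mB _ [E mE <-]; exact: (ppp_meas pN mB).
Qed.

Let sys_setI B : setI_closed (sys B).
Proof.
move=> _ _ [E1 mE1 <-] [E2 mE2 <-]; exists (E1 `&` E2); first exact: measurableI.
by rewrite !setTI.
Qed.

Let sysT B : sys B setT.
Proof. by exists setT => //; rewrite setTI. Qed.

Let sys0 B : sys B set0.
Proof. by exists set0 => //; rewrite setTI. Qed.

(** Independence of counts is postulated for disjoint sets, so a finite family is cut into the atoms
    it generates; [J] indexes the members that contain the point. *)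
Let atom m (A : 'I_m -> set (plane R)) (J : {set 'I_m}) : set (plane R) :=
  [set z | forall j, A j z <-> j \in J].

Let atom_measurable m (A : 'I_m -> set (plane R)) J :
  (forall j, measurable (A j)) -> measurable (atom A J).
Proof.
move=> mA; rewrite (_ : atom A J = \bigcap_(j in [set: 'I_m])
    (if j \in J then A j else ~` A j)).
  apply: fin_bigcap_measurable => // j _; case: ifP => _ //; exact: measurableC.
apply/seteqP; split => [z Az j _|z Az j].
  by case: ifPn => jJ; [exact/Az|move/Az; exact/negP].
by have := Az j I; case: ifPn => jJ Ajz; split => // /Ajz.
Qed.

Let atom_unique m (A : 'I_m -> set (plane R)) J J' z : atom A J z -> atom A J' z -> J = J'.
Proof.
move=> a a'; apply/setP => j; apply/idP/idP => [/(a j)/(a' j)//|/(a' j)/(a j)//].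
Qed.

Let ppp_indep_finite (a : R) m (A : 'I_m -> set (plane R)) cell (E : set (\bar R)) B :
  (forall j, measurable (A j)) -> (forall j, A j `<=` [set z | (z.2 : R) <= a]) ->
  measurable cell -> cell `<=` [set z | a < (z.2 : R)] -> measurable E ->
  <<s \bigcup_j sys (A j) >> B ->
  P (B `&` (N ^~ cell) @^-1` E) = (P B * P ((N ^~ cell) @^-1` E))%E.
Proof.
move=> mA Aa mcell acell mE GB.
pose K := #|{: {set 'I_m}}|.
(* The atom of the empty index set meets no [A j], so its index is free to carry [cell], which is
   disjoint from the other atoms because it lies at later times. *)
pose T (k : 'I_K) := if enum_val k == finset.set0 then cell else atom A (enum_val k).
have mT k : measurable (T k) by rewrite /T; case: ifP => // _; exact: atom_measurable.
have cellA J z : J != finset.set0 -> cell z -> ~ atom A J z.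
  move=> /set0Pn[j jJ] /acell /= az /(_ j) [_ /(_ jJ)/Aa] /=.
  by rewrite leNgt az.
have tT : trivIset setT T.
  move=> k l _ _ [z]; rewrite /T; case: ifPn => [/eqP k0|k0]; case: ifPn => [/eqP l0|l0] [z1 z2].
  - by apply: enum_val_inj; rewrite k0 l0.
  - by have := cellA _ _ l0 z1 z2.
  - by have := cellA _ _ k0 z2 z1.
  - by apply: enum_val_inj; exact: atom_unique z1 z2.
pose k0 : 'I_K := enum_rank finset.set0.
have Tk0 : T k0 = cell by rewrite /T /k0 enum_rankK eqxx.
(* The count of [cell] belongs to the future, so the past has only the trivial system at [k0]. *)
pose M := (\bigcup_k (if k == k0 then [set X | X = setT \/ X = set0] else sys (T k)))
  `|` P.-negligible.
have sysE : sys cell ((N ^~ cell) @^-1` E) by exists E => //; rewrite setTI.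
apply: (@indep_complement _ _ _ P _ (fun k => sys (T k)) k0 [set X | X = setT \/ X = set0])
  => //.
- exact: (ppp_indep pN mT tT).
- by move=> k; exact: (sys_measurable (mT k)).
- by move=> _ [->|->].
- move=> _ _ [->|->] [->|->]; rewrite ?setTI ?setIT ?set0I ?setI0;
  by [left|right|right|right].
- by left.
- by right.
- by rewrite /= Tk0.
- by move=> _ [->|->]; rewrite /= Tk0 ?setTI ?set0I.
- by move=> _ [->|->]; rewrite ?setTI ?set0I ?probability_setT ?measure0 ?mul1e ?mul0e.
apply: GB; split; first exact: smallest_sigma_algebra.
move=> X [j _ [F mF <-]]; rewrite setTI.
pose T' (J : {set 'I_m}) := if j \in J then atom A J else set0.
(* The count of [A j] is the sum of the counts of its atoms, hence measurable for the past. *)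
have AE w : N w (A j) = (\sum_(J \in [set: {set 'I_m}]) N w (T' J))%E.
  rewrite -measure_fin_bigcup //=; last 2 first.
  - move=> J J' _ _ [z []]; rewrite /T'; case: ifP => // _ z1; case: ifP => // _ z2.
    exact: atom_unique z1 z2.
  - by move=> J _; rewrite /T'; case: ifP => // _; exact: atom_measurable.
  congr (N w _); apply/seteqP; split => [z Ajz|z [J _]]; last first.
    by rewrite /T'; case: ifP => // jJ /(_ j)[_]; apply.
  pose J : {set 'I_m} := [set l | `[< A l z >]]%SET.
  exists J => //; rewrite /T' ifT; last by rewrite inE; exact/asboolP.
  by move=> l; rewrite inE; split => [?|]; [exact/asboolP|move/asboolP].
have mM : measurable_fun setT ((fun w => N w (A j)) : g_sigma_algebraType M -> \bar R).
  under eq_fun do rewrite AE.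
  apply: emeasurable_fsum; first exact: finite_finset.
  move=> J; rewrite /T'; case: ifPn => jJ; last first.
    by under eq_fun do rewrite measure0; exact: measurable_cst.
  move=> _ F' mF'; apply: sub_sigma_algebra; left; exists (enum_rank J) => //.
  have J0 : J != finset.set0 by apply/set0Pn; exists j.
  rewrite ifN; last by apply: contra J0 => /eqP/enum_rank_inj ->.
  by exists F' => //; rewrite /T enum_rankK (negbTE J0).
by have := mM measurableT F mF; rewrite setTI.
Qed.

Lemma ppp_future (a : R) cell (E : set (\bar R)) B :
  measurable cell -> cell `<=` [set z | a < (z.2 : R)] -> measurable E ->
  <<s ppp_gen N a >> B ->
  P (B `&` (N ^~ cell) @^-1` E) = (P B * P ((N ^~ cell) @^-1` E))%E.
Proof.
move=> mcell acell mE.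
(* Events that depend on finitely many counts; to intersect two of them, the two families are
   concatenated. *)
pose Pi := [set D | exists m (A : 'I_m -> set (plane R)),
  [/\ forall j, measurable (A j), forall j, A j `<=` [set z | (z.2 : R) <= a] &
   <<s \bigcup_j sys (A j) >> D]].
have sub m (A : 'I_m -> set (plane R)) : (forall j, measurable (A j)) ->
    <<s \bigcup_j sys (A j) >> `<=` @measurable _ Om.
  move=> mA; apply: smallest_sub; first exact: sigma_algebra_measurable.
  by move=> X [j _]; exact: sys_measurable.
move=> GB; apply: (@dynkin_indep _ _ _ P Pi) => //.
- move=> D1 D2 [m1 [A1 [mA1 Aa1 D1A]]] [m2 [A2 [mA2 Aa2 D2A]]].
  pose A (i : 'I_(m1 + m2)) := match fintype.split i with inl j => A1 j | inr j => A2 j end.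
  have Al j : A (lshift m2 j) = A1 j by rewrite /A (unsplitK (inl j)).
  have Ar j : A (rshift m1 j) = A2 j by rewrite /A (unsplitK (inr j)).
  exists (m1 + m2)%N, A; split.
  - by move=> i; rewrite /A; case: fintype.split.
  - by move=> i; rewrite /A; case: fintype.split.
  apply: g_sigma_setI.
    apply: sub_sigma_algebra2 D1A => X [j _]; rewrite -Al => ?.
    by exists (lshift m2 j).
  apply: sub_sigma_algebra2 D2A => X [j _]; rewrite -Ar => ?.
  by exists (rshift m1 j).
- by move=> D [m [A [mA _]]]; exact: sub.
- have := ppp_meas pN mcell; move=> /(_ measurableT E mE); rewrite setTI //.
- by move=> D [m [A [mA Aa DA]]]; exact: (ppp_indep_finite mA Aa mcell acell mE DA).
apply: sub_sigma_algebra2 GB => X [D [mD Dt] DX].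
exists 1%N, (fun=> D); split => //.
  by move=> _ z /Dt /= /andP[].
by apply: sub_sigma_algebra; exists ord0.
Qed.

End PoissonFuture.

Section NoiseFuture.
Context {R : realType} {dO : measure_display} {Om : measurableType dO}.
Variable P : probability Om R.
Context {n : nat} {p : nat}.
Variables (W : 'I_n.+1 -> R -> Om -> R)
  (N : 'I_n.+1 -> Om -> {measure set (plane R) -> \bar R}).
Variable F : R -> set (set Om).
Hypothesis hnoise : sme_noise P p W N F.

Lemma noise_complete : P.-negligible `<=` measurable.
Proof.
have u := noise_usual hnoise.
by apply: subset_trans (filt_complete u) (filt_sub u (lexx 0)).
Qed.

Lemma filt_meas t : 0 <= t -> F t `<=` measurable.
Proof. by move=> t0; exact: (filt_sub (noise_usual hnoise) t0). Qed.

Lemma filt_setI t : 0 <= t -> setI_closed (F t).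
Proof.
move=> t0; have := sigma_algebra_id (filt_sigma (noise_usual hnoise) t0) => <-.
exact: g_sigma_setI.
Qed.

Lemma noise_gen_meas t i : 0 <= t -> noise_gen p W N t i `<=` measurable.
Proof.
move=> t0; rewrite /noise_gen; case: ifPn => ip.
  move=> X [s]; rewrite /= in_itv /= => /andP[s0 _] [E mE <-].
  exact: (wiener_meas (noise_wiener hnoise ip) s0).
rewrite -ltnNge in ip; move=> X [B [mB _] [E mE <-]].
exact: (ppp_meas (noise_poisson hnoise ip) mB).
Qed.

(** The hypothesis is independence from the past of the same source; joint independence of the
    sources and completion by null sets extend it to the whole filtration. *)
Lemma noise_future (a : R) (i0 : 'I_n.+1) (E : set Om) : 0 <= a ->
  <<s \bigcup_(t in `[0, +oo[) noise_gen p W N t i0 >> E ->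
  (forall B, <<s noise_gen p W N a i0 >> B -> P (B `&` E) = (P B * P E)%E) ->
  forall B, F a B -> P (B `&` E) = (P B * P E)%E.
Proof.
move=> a0 GE HE B; rewrite (noise_natural hnoise a0) => FB.
pose G i := <<s \bigcup_(t in `[0, +oo[) noise_gen p W N t i >>.
have aG i : <<s noise_gen p W N a i >> `<=` G i.
  by apply: sub_sigma_algebra2 => X Xa; exists a => //=; rewrite in_itv /= a0.
apply: (@indep_complement _ _ _ P _ G i0 <<s noise_gen p W N a i0 >>) => //.
- exact: noise_indep hnoise.
- move=> i; apply: smallest_sub; first exact: sigma_algebra_measurable.
  move=> X [t /=]; rewrite in_itv /= andbT => t0; exact: noise_gen_meas.
- by move=> i; exact: g_sigma_setI.
- by move=> i; exact: (@measurableT _ (g_sigma_algebraType _)).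
- by move=> i; exact: sigma_algebra0.
- exact: g_sigma_setI.
- by exact: (@measurableT _ (g_sigma_algebraType _)).
- exact: sigma_algebra0.
- by move=> C /aG GC; exact: g_sigma_setI.
- exact: noise_complete.
apply: sub_sigma_algebra2 FB => X [[i _ Xi]|NX]; [left|by right].
exists i => //; case: eqP => [<-|_]; first exact: sub_sigma_algebra.
by apply: aG; exact: sub_sigma_algebra.
Qed.

Definition wincr (i : 'I_n.+1) (a b : R) (w : Om) : R := W i b w - W i a w.

Lemma wiener_future (i : 'I_n.+1) (a b : R) (E : set R) B : (i <= p)%N -> 0 <= a -> a < b ->
  measurable E -> F a B ->
  P (B `&` wincr i a b @^-1` E) =
  (P B * P (wincr i a b @^-1` E))%E.
Proof.
move=> ip a0 ab mE FB; apply: (@noise_future a i) FB => //; last first.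
  rewrite /noise_gen ip => C GC.
  exact: (wiener_indep (noise_wiener hnoise ip) a0 ab GC mE).
pose G := \bigcup_(t in `[0, +oo[) noise_gen p W N t i.
have mW t : 0 <= t -> measurable_fun setT (W i t : g_sigma_algebraType G -> R).
  move=> t0 _ E' mE'; rewrite setTI; apply: sub_sigma_algebra; exists t.
    by rewrite /= in_itv /= t0.
  rewrite /noise_gen ip; exists t; first by rewrite /= in_itv /= t0 lexx.
  by exists E' => //; rewrite setTI.
have : measurable_fun setT (wincr i a b : g_sigma_algebraType G -> R).
  by apply: measurable_funB; apply: mW => //; exact: le_trans (ltW ab).
by move=> /(_ measurableT E mE); rewrite setTI.
Qed.

Lemma poisson_future (i : 'I_n.+1) (a : R) (cell : set (plane R)) (b : R) (E : set (\bar R)) B :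
  (p < i)%N -> 0 <= a -> measurable cell ->
  cell `<=` [set z | a < (z.2 : R) <= b] -> measurable E -> F a B ->
  P (B `&` (N i ^~ cell) @^-1` E) = (P B * P ((N i ^~ cell) @^-1` E))%E.
Proof.
move=> ip a0 mcell cab mE FB; have ip' : (i <= p)%N = false by rewrite leqNgt ip.
apply: (@noise_future a i) FB => //; last first.
  rewrite /noise_gen ip' => C GC.
  apply: (ppp_future (noise_poisson hnoise ip) noise_complete mcell _ mE GC).
  by move=> z /cab /= /andP[].
apply: sub_sigma_algebra; exists (Num.max b 0).
  by rewrite /= in_itv /= le_max lexx orbT.
rewrite /noise_gen ip'; exists cell; last by exists E => //; rewrite setTI.
split => // z /cab /= /andP[az zb]; rewrite (le_trans a0 (ltW az)) /=.
by rewrite le_max zb.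
Qed.

Lemma wiener_mean (i : 'I_n.+1) (a b : R) (Y : Om -> R) A M : (i <= p)%N -> 0 <= a -> a <= b ->
  (forall E, measurable E -> F a (Y @^-1` E)) -> (forall w, `|Y w| <= M) -> F a A ->
  P.-integrable setT (EFin \o (wincr i a b)) /\
  \int[P]_(w in A) (Y w * wincr i a b w) = 0.
Proof.
(* Equal times are treated apart, since a normal law of deviation 0 has no density. *)
move=> ip a0; rewrite le_eqVlt => /predU1P[<-{b}|ab] FY YM FA.
  split.
    rewrite (_ : _ \o _ = cst 0%E); last by apply/funext => w; rewrite /= /wincr subrr.
    exact: integrable0.
  under eq_Rintegral do rewrite /wincr subrr mulr0.
  by rewrite /Rintegral integral0.
have wW := noise_wiener hnoise ip.
have b0 : 0 <= b := le_trans a0 (ltW ab).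
have mW : measurable_fun setT (wincr i a b).
  by apply: measurable_funB; exact: (wiener_meas wW).
have s0 : Num.sqrt (b - a) != 0 by rewrite gt_eqF // sqrtr_gt0 subr_gt0.
have [Wi W0] := normal_law_mean0 s0 mW (fun B mB => wiener_law wW a0 ab mB).
split => //; rewrite (indep_Rintegral (filt_meas a0) (filt_setI a0) mW Wi _ FY YM FA).
  by rewrite W0 mulr0.
by move=> B E FB mE; exact: wiener_future.
Qed.

Definition pcell (x1 x2 t1 t2 : R) : set (plane R) := `]x1, x2] `*` `]t1, t2].

Lemma measurable_pcell x1 x2 t1 t2 : measurable (pcell x1 x2 t1 t2).
Proof. by apply: measurableX; exact: measurable_itv. Qed.

Lemma plane_pcell (x1 x2 t1 t2 : R) : x1 <= x2 -> t1 <= t2 ->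
  @plane_measure R (pcell x1 x2 t1 t2) = ((x2 - x1) * (t2 - t1))%:E.
Proof.
move=> x12 t12; rewrite /pcell.
have L (a b : R) : a <= b -> @lebesgue_measure R `]a, b] = (b - a)%:E.
  move=> ab; rewrite lebesgue_measure_itv /= lte_fin; case: ltP => // ba.
  by rewrite (le_anti (introT andP (conj ab ba))) subrr.
rewrite [LHS](@product_measure1E _ _ _ _ R (@lebesgue_measure R) (@lebesgue_measure R)).
- by rewrite [X in (X * _)%E]L // [X in (_ * X)%E]L.
- exact: measurable_itv.
- exact: measurable_itv.
Qed.

Lemma ppp_pcell_nat (i : 'I_n.+1) w (x1 x2 t1 t2 : R) : (p < i)%N ->
  exists k : nat, N i w (pcell x1 x2 t1 t2) = k%:R%:E.
Proof.
move=> ip; pose r := `|x1| + `|x2| + `|t1| + `|t2|.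
apply: (ppp_count (noise_poisson hnoise ip) w (r := r) (measurable_pcell _ _ _ _)).
have := ler_norm x2; have := ler_norm t2; have := ler_norm (- x1); have := ler_norm (- t1).
rewrite !normrN; have := normr_ge0 x1; have := normr_ge0 x2; have := normr_ge0 t1; have := normr_ge0 t2.
move=> ? ? ? ? ? ? ? ? [x t] [] /=; rewrite !in_itv /= => /andP[? ?] /andP[? ?].
by rewrite /r; split; apply/andP; split; lra.
Qed.

(** Compensation on one cell: its count is independent of the past of [t1] and its mean is its
    area. *)
Lemma poisson_mean (i : 'I_n.+1) (x1 x2 t1 t2 : R) (Y : Om -> R) A M : (p < i)%N ->
  x1 <= x2 -> 0 <= t1 -> t1 <= t2 ->
  (forall E, measurable E -> F t1 (Y @^-1` E)) -> (forall w, `|Y w| <= M) -> F t1 A ->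
  P.-integrable setT (EFin \o (fun w => fine (N i w (pcell x1 x2 t1 t2)))) /\
  \int[P]_(w in A) (Y w * fine (N i w (pcell x1 x2 t1 t2))) =
    \int[P]_(w in A) Y w * ((x2 - x1) * (t2 - t1)).
Proof.
move=> ip x12 t10 t12 FY YM FA; set cell := pcell x1 x2 t1 t2.
have pN := noise_poisson hnoise ip.
have mcell : measurable cell := measurable_pcell _ _ _ _.
have inten : @ppp_intensity R cell = ((x2 - x1) * (t2 - t1))%:E.
  rewrite /ppp_intensity setIidl ?plane_pcell // => z [_ /=].
  by rewrite in_itv /= => /andP[/ltW + _]; exact: le_trans.
have Nk w := @ppp_pcell_nat i w x1 x2 t1 t2 ip.
have mN : measurable_fun setT (N i ^~ cell) := ppp_meas pN mcell.
have [|Ni EN] := poisson_law_mean _ mN Nk (ppp_law pN mcell inten).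
  by rewrite mulr_ge0 // subr_ge0.
have Ni' : P.-integrable setT (EFin \o (fun w => fine (N i w cell))).
  by apply: eq_integrable Ni => // w _ /=; have [k ->] := Nk w.
split => //; rewrite -EN.
have mfN : measurable_fun setT (fun w => fine (N i w cell)).
  by apply: measurableT_comp.
apply: (indep_Rintegral (filt_meas t10) (filt_setI t10) mfN Ni' _ FY YM FA).
move=> B E FB mE.
have -> : (fun w => fine (N i w cell)) @^-1` E = (N i ^~ cell) @^-1` (EFin @` E).
  apply/seteqP; split => w /=; have [k ->] := Nk w; first by move=> Ek; exists k%:R.
  by move=> [r Er] [<-].
apply: (poisson_future (a := t1) (b := t2)) => //.
  by move=> z [_] /=; rewrite in_itv.
exact: measurable_image_EFin.
Qed.

End NoiseFuture.

(** * Mean-zero noise terms *)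

Section FieldLimits.
Context {R : realType}.

Lemma integrable_cst_on d (T : measurableType d) (mu : {measure set T -> \bar R})
    (D : set T) (c M : R) : measurable D -> mu D = c%:E -> mu.-integrable D (EFin \o cst M).
Proof.
move=> mD muD; apply/integrableP; split; first exact/measurable_EFinP.
rewrite (eq_integral (cst `|M|%:E)) // (@integral_cst _ T R mu D mD) muD.
by rewrite -EFinM ltry.
Qed.

Lemma integrable_bounded_on d (T : measurableType d) (mu : {measure set T -> \bar R})
    (D : set T) (f : T -> R) (c M : R) : measurable D -> mu D = c%:E ->
  measurable_fun D f -> (forall x, D x -> `|f x| <= M) -> mu.-integrable D (EFin \o f).
Proof.
move=> mD muD mf fM; apply: le_integrable (integrable_cst_on M mD muD) => //.
  exact/measurable_EFinP.
by move=> x Dx /=; rewrite lee_fin; apply: le_trans (fM x Dx) (ler_norm _).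
Qed.

Lemma Rintegral_le_bound d (T : measurableType d) (mu : {measure set T -> \bar R})
    (D : set T) (f : T -> R) (c M : R) : measurable D -> mu D = c%:E ->
  measurable_fun D f -> (forall x, D x -> `|f x| <= M) ->
  `|\int[mu]_(x in D) f x| <= M * c.
Proof.
move=> mD muD mf fM; have fi := integrable_bounded_on mD muD mf fM.
apply: le_trans (le_normr_Rintegral mD fi) _.
apply: (@le_trans _ _ (\int[mu]_(x in D) cst M x)).
  apply: le_Rintegral => //; last exact: integrable_cst_on muD.
  by have := integrable_abse fi; apply: eq_integrable.
by rewrite Rintegral_cst // muD.
Qed.

Lemma Rintegral_step d (T : measurableType d) (mu : {measure set T -> \bar R})
    (D : set T) (c : R) (I : finType) (a : I -> R) (B : I -> set T) :
  measurable D -> mu D = c%:E -> (forall i, measurable (B i)) -> (forall i, B i `<=` D) ->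
  \int[mu]_(x in D) (\sum_i a i * \1_(B i) x) = \sum_i a i * fine (mu (B i)).
Proof.
move=> mD muD mB BD.
have ii i : mu.-integrable D (EFin \o (\1_(B i) : T -> R)).
  apply: (integrable_bounded_on (M := 1) mD muD) => [|x _].
    exact: measurable_indic.
  by rewrite indicE; case: (_ \in _); rewrite ?normr1 ?normr0.
rewrite (Rintegral_sum _ mD _).2 => [|i]; last first.
  by have := integrableZl mD (a i) (ii i); apply: eq_integrable.
apply: eq_bigr => i _; rewrite RintegralZl //; congr (_ * _).
by rewrite /Rintegral integral_indic // setIC (setIidr (BD i)).
Qed.

Lemma measurable_step d (T : measurableType d) (D : set T) (I : finType)
    (a : I -> R) (B : I -> set T) : (forall i, measurable (B i)) ->
  measurable_fun D (fun x => \sum_i a i * \1_(B i) x).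
Proof.
move=> mB; apply: measurable_sum => i; apply: measurable_funM => //.
Qed.

Context {dO : measure_display} {Om : measurableType dO}.
Variable P : probability Om R.

(** The measure may depend on the outcome, as the Poisson one does. Instead of joint measurability
    in point and outcome, only the sections and the integrated field are asked to be measurable, and
    both conditions pass to pointwise limits. *)
Record bounded_field d (T : measurableType d) (mu : Om -> {measure set T -> \bar R})
    (D : set T) (A : set Om) (M : R) (g : T -> Om -> R) : Prop := BoundedField {
  bf_meas : forall w, A w -> measurable_fun D (g ^~ w);
  bf_le : forall w z, A w -> D z -> `|g z w| <= M;
  bf_int_meas : measurable_fun A (fun w => \int[mu w]_(z in D) g z w) }.

(** Dominated convergence twice: inside with the constant [M], outside with [M * c w], where the
    random mass [c] of [D] is integrable. *)
Lemma field_limit d (T : measurableType d) (mu : Om -> {measure set T -> \bar R})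
    (D : set T) (A : set Om) (M : R) (c : Om -> R) (g_ : nat -> T -> Om -> R) g :
  measurable D -> measurable A -> 0 <= M -> (forall w, A w -> mu w D = (c w)%:E) ->
  P.-integrable A (EFin \o c) ->
  (forall m, bounded_field mu D A M (g_ m)) ->
  (forall w z, A w -> D z -> g_ m z w @[m --> \oo] --> g z w) ->
  bounded_field mu D A M g /\
  \int[P]_(w in A) \int[mu w]_(z in D) g_ m z w @[m --> \oo] -->
  \int[P]_(w in A) \int[mu w]_(z in D) g z w.
Proof.
move=> mD mA M0 muD ci bf gcv.
have inner w : A w -> measurable_fun D (g ^~ w) /\
    \int[mu w]_(z in D) g_ m z w @[m --> \oo] --> \int[mu w]_(z in D) g z w.
  move=> Aw.
  have [] := @Rintegral_dominated R d T (mu w) D (fun m z => g_ m z w) (g ^~ w) (cst M) mD.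
  - by move=> m; exact: bf_meas (bf m) w Aw.
  - by move=> z Dz; exact: gcv.
  - exact: integrable_cst_on mD (muD w Aw).
  - by move=> m z Dz; exact: bf_le (bf m) w z Aw Dz.
  - by move=> /integrableP[/measurable_EFinP mg _] cv.
have gM w z : A w -> D z -> `|g z w| <= M.
  move=> Aw Dz; apply: (cvgr_to_le (cvg_norm (gcv w z Aw Dz))).
  by apply: nearW => m; exact: bf_le (bf m) w z Aw Dz.
have [] := @Rintegral_dominated R _ Om P A
  (fun m w => \int[mu w]_(z in D) g_ m z w) (fun w => \int[mu w]_(z in D) g z w)
  (fun w => M * c w) mA.
- by move=> m; exact: bf_int_meas (bf m).
- by move=> w Aw; have [] := inner w Aw.
- by have := integrableZl mA M ci; apply: eq_integrable.
- move=> m w Aw; apply: Rintegral_le_bound mD (muD w Aw) _ _.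
    exact: bf_meas (bf m) w Aw.
  by move=> z Dz; exact: bf_le (bf m) w z Aw Dz.
move=> /integrableP[/measurable_EFinP mI _] cv; split => //; split => //.
by move=> w Aw; have [] := inner w Aw.
Qed.

Lemma bf_integrable_out d (T : measurableType d) (mu : Om -> {measure set T -> \bar R})
    (D : set T) (A : set Om) (M : R) (c : Om -> R) g :
  measurable D -> measurable A -> (forall w, A w -> mu w D = (c w)%:E) ->
  P.-integrable A (EFin \o c) -> bounded_field mu D A M g ->
  P.-integrable A (EFin \o (fun w => \int[mu w]_(z in D) g z w)).
Proof.
move=> mD mA muD ci bf.
have Mci : P.-integrable A (EFin \o (fun w => M * c w)).
  by have := integrableZl mA M ci; apply: eq_integrable.
apply: le_integrable Mci => //; first exact/measurable_EFinP/(bf_int_meas bf).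
move=> w Aw /=; rewrite lee_fin; apply: le_trans (ler_norm _).
apply: Rintegral_le_bound mD (muD w Aw) _ _; first exact: bf_meas bf w Aw.
by move=> z Dz; exact: bf_le bf w z Aw Dz.
Qed.

End FieldLimits.

Lemma cvg_cst_eq {R : realType} (c l : R) : (fun=> c) m @[m --> \oo] --> l -> c = l.
Proof. by move=> h; rewrite -(cvg_lim (@Rhausdorff R) h) lim_cst //; exact: Rhausdorff. Qed.

Lemma Rintegral_prob_cst {R : realType} {dO : measure_display} {Om : measurableType dO}
  (P : probability Om R) (c : R) : \int[P]_w cst c w = c.
Proof.
rewrite Rintegral_cst // [X in fine X](_ : _ = 1%E) ?mulr1 //.
exact: (@probability_setT _ _ _ P).
Qed.

(** * Ito integrals have constant mean on events of the past *)

Section ItoMean.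
Context {R : realType} {dO : measure_display} {Om : measurableType dO}.
Variable P : probability Om R.

(** Bounding the absolute value of [x] by [e + e^-1 * x ^+ 2] does the work of the Cauchy-Schwarz
    inequality. With [e / 3] in place of [e] and a second moment below [(e / 3) ^+ 2], the mean is
    below [2 * e / 3]. *)
Lemma cvg_L2_Rintegral (f : nat -> Om -> R) (A : set Om) : measurable A ->
  (forall m, measurable_fun setT (f m)) ->
  (\int[P]_w ((f m w) ^+ 2)%:E)%E @[m --> \oo] --> 0%E ->
  (\forall m \near \oo, P.-integrable setT (EFin \o f m)) /\
  \int[P]_(w in A) f m w @[m --> \oo] --> (0 : R).
Proof.
move=> mA mf f0.
have sqi m e : (\int[P]_w ((f m w) ^+ 2)%:E < e%:E)%E ->
    P.-integrable setT (EFin \o (fun w => f m w ^+ 2)).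
  move=> fe; apply/integrableP; split.
    by apply/measurable_EFinP; exact: measurable_funX.
  under eq_integral do rewrite /= ger0_norm ?sqr_ge0 //.
  by apply: lt_trans fe _; exact: ltry.
have bnd m e : P.-integrable setT (EFin \o (fun w => f m w ^+ 2)) -> 0 < e ->
    P.-integrable setT (EFin \o (fun w => e + e^-1 * f m w ^+ 2)) /\
    forall w, `|f m w| <= e + e^-1 * f m w ^+ 2.
  move=> sq e0; split.
    have := integrableD measurableT (finite_measure_integrable_cst P e measurableT)
      (integrableZl measurableT e^-1 sq).
    by apply: eq_integrable.
  move=> w; rewrite -(ler_pM2l e0) mulrDr mulrA divff ?gt_eqF // mul1r.
  rewrite -(real_normK (num_real (f m w))); have := normr_ge0 (f m w); move: `|f m w| => x x0; nra.
have fi m e : (\int[P]_w ((f m w) ^+ 2)%:E < e%:E)%E -> P.-integrable setT (EFin \o f m).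
  move=> /sqi sq; have [bi bw] := bnd m 1 sq ltr01.
  apply: le_integrable bi => //; first exact/measurable_EFinP.
  by move=> w _ /=; rewrite lee_fin; apply: le_trans (bw w) (ler_norm _).
have ev e : 0 < e -> \forall m \near \oo, (\int[P]_w ((f m w) ^+ 2)%:E < e%:E)%E.
  by move=> e0; apply: (f0 [set u | (u < e%:E)%E]); apply: open_ereal_lt'; rewrite lte_fin.
split; first by apply: filterS (ev 1 ltr01) => m; exact: fi.
apply/cvgrPdist_lt => e e0.
have e3 : 0 < e / 3 by rewrite divr_gt0.
have : 0 < (e / 3) ^+ 2 by rewrite exprn_gt0.
move=> /ev; apply: filterS => m fm; rewrite sub0r normrN.
have [bi bw] := bnd m (e / 3) (sqi _ _ fm) e3.
have fim := fi _ _ fm.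
have fimA : P.-integrable A (EFin \o f m) by apply: (integrableS measurableT).
apply: le_lt_trans (le_normr_Rintegral mA fimA) _.
apply: (@le_lt_trans _ _ (\int[P]_w `|f m w|)).
  rewrite Rintegral_mkcond; apply: le_Rintegral => //.
  - apply: le_integrable fim => //.
      apply/measurable_EFinP; apply/(measurable_restrictT _ mA).
      by apply: measurable_funTS; exact: measurableT_comp.
    move=> w _ /=; rewrite lee_fin /restrict; case: ifP => _; rewrite ?normr_id //.
    by rewrite normr0.
  - by have := integrable_abse fim; apply: eq_integrable.
  - move=> w _; rewrite /restrict; case: ifP => _; rewrite ?lexx ?normr_ge0 //.
apply: (@le_lt_trans _ _ (\int[P]_w (e / 3 + (e / 3)^-1 * f m w ^+ 2))).
  apply: le_Rintegral => //.
  by have := integrable_abse fim; apply: eq_integrable.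
have sq := sqi _ _ fm.
have -> : \int[P]_w (e / 3 + (e / 3)^-1 * f m w ^+ 2) =
    e / 3 + (e / 3)^-1 * \int[P]_w f m w ^+ 2.
  rewrite (@RintegralD _ _ _ P setT (cst (e / 3)) (fun w => (e / 3)^-1 * f m w ^+ 2)) //.
  - by congr (_ + _); [exact: Rintegral_prob_cst|rewrite RintegralZl].
  - exact: finite_measure_integrable_cst.
  - by have := integrableZl measurableT (e / 3)^-1 sq; apply: eq_integrable.
have : \int[P]_w f m w ^+ 2 < (e / 3) ^+ 2.
  rewrite /Rintegral -lte_fin fineK //; exact: integrable_fin_num.
rewrite expr2 -ltr_pdivrMl // => h; lra.
Qed.

Context {n : nat} {p : nat}.
Variables (W : 'I_n.+1 -> R -> Om -> R)
  (N : 'I_n.+1 -> Om -> {measure set (plane R) -> \bar R}).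
Variable F : R -> set (set Om).
Hypothesis hnoise : sme_noise P p W N F.

Lemma filtT t : 0 <= t -> F t setT.
Proof.
move=> t0; have [F0 FC _] := filt_sigma (noise_usual hnoise) t0.
by rewrite -(setD0 setT); exact: FC.
Qed.

Lemma adapted_cst t (c : R) (E : set R) : 0 <= t -> F t ((cst c : Om -> R) @^-1` E).
Proof.
move=> t0; have [F0 _ _] := filt_sigma (noise_usual hnoise) t0.
have [Ec|Ec] := pselect (E c).
  by rewrite (_ : _ @^-1` _ = setT); [exact: filtT|apply/seteqP; split].
by rewrite (_ : _ @^-1` _ = set0) //; apply/seteqP; split.
Qed.

Lemma wincr_integrable (i : 'I_n.+1) (a b : R) : (i <= p)%N -> 0 <= a -> a <= b ->
  P.-integrable setT (EFin \o wincr W i a b).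
Proof.
move=> ip a0 ab.
have H0 w : `|(cst 0 : Om -> R) w| <= 0 by rewrite normr0.
exact: (@wiener_mean _ _ _ P n p W N F hnoise i a b (cst 0) setT 0 ip a0 ab
  (fun E _ => adapted_cst 0 E a0) H0 (filtT a0)).1.
Qed.

Lemma filt_preim_meas t (Y : Om -> R) : 0 <= t ->
  (forall E, measurable E -> F t (Y @^-1` E)) -> measurable_fun setT Y.
Proof. by move=> t0 FY _ E mE; rewrite setTI; exact: (filt_meas hnoise t0 (FY E mE)). Qed.

Section SimpleProcess.
Variable i : 'I_n.+1.
Hypothesis ip : (i <= p)%N.
Variable S : simple_process F.

Let T := sp_time S.

Let T0 k : 0 <= T k.
Proof. by apply: le_trans (sp_time_ge0 S) (sp_time_nd S (leq0n k)). Qed.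

Let TS k : T k <= T k.+1.
Proof. exact: (sp_time_nd S (leqnSn k)). Qed.

Let term k t w : R := sp_val S k w * wincr W i (Num.min (T k) t) (Num.min (T k.+1) t) w.

Let term_integrable k t : 0 <= t -> P.-integrable setT (EFin \o term k t).
Proof.
move=> t0; have [M HM] := sp_val_bound S k.
have mins : Num.min (T k) t <= Num.min (T k.+1) t.
  by rewrite le_min !ge_min lexx TS !orbT.
have wi : P.-integrable setT (EFin \o wincr W i (Num.min (T k) t) (Num.min (T k.+1) t)).
  by apply: wincr_integrable => //; rewrite le_min T0.
have Mwi := integrableZl measurableT M wi.
apply: le_integrable Mwi => //.
  apply/measurable_EFinP; apply: measurable_funM.
    by apply: (filt_preim_meas (T0 k)) => E mE; exact: sp_val_meas.
  by apply/measurable_EFinP; case/integrableP: wi.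
move=> w _ /=; rewrite lee_fin !normrM ler_wpM2r //.
exact: le_trans (HM w) (ler_norm _).
Qed.

(** What the [k]-th term gains between [s] and [t] is an increment starting at [Num.max s (T k)]; at
    that time both the past event and the coefficient of the term are known. *)
Let wincr_shift k s t w : s <= t -> T k <= t ->
  wincr W i (Num.min (T k) t) (Num.min (T k.+1) t) w -
  wincr W i (Num.min (T k) s) (Num.min (T k.+1) s) w =
  wincr W i (Num.max s (T k)) (Num.max s (Num.min (T k.+1) t)) w.
Proof.
move=> st kt; have kS := TS k; rewrite /wincr (min_l kt).
have [sk|ks] := orP (le_total s (T k)).
  have sS := le_trans sk kS.
  have smin : s <= Num.min (T k.+1) t by rewrite le_min sS st.
  by rewrite (min_r sk) (min_r sS) subrr subr0 (max_r sk) (max_r smin).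
rewrite (min_l ks) (max_l ks).
have [Ss|sS] := orP (le_total (T k.+1) s).
  by rewrite (min_l (le_trans Ss st)) (min_l Ss) (max_l Ss) !subrr.
have smin : s <= Num.min (T k.+1) t by rewrite le_min sS st.
by rewrite (min_r sS) (max_r smin) opprB addrA subrK.
Qed.

Let term_mean k s t A : 0 <= s -> s <= t -> F s A ->
  \int[P]_(w in A) term k t w = \int[P]_(w in A) term k s w.
Proof.
move=> s0 st FA; have t0 := le_trans s0 st; have mA := filt_meas hnoise s0 FA.
have ti u : 0 <= u -> P.-integrable A (EFin \o term k u).
  by move=> u0; apply: (integrableS measurableT) => //; exact: term_integrable.
apply/eqP; rewrite -subr_eq0 -RintegralB //; [|exact: ti..].
have [kt|tk] := leP (T k) t; last first.
  rewrite (_ : (fun w => _) = cst 0); first by rewrite /Rintegral integral0.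
  apply/funext => w; rewrite /term /wincr.
  have tS := le_trans (ltW tk) (TS k).
  have tk' := ltW tk.
  rewrite (min_r tk') (min_r tS) (min_r (le_trans st tk')) (min_r (le_trans st tS)).
  by rewrite !subrr.
have [M HM] := sp_val_bound S k.
apply/eqP; rewrite (_ : (fun w => _) = fun w => sp_val S k w *
    wincr W i (Num.max s (T k)) (Num.max s (Num.min (T k.+1) t)) w); last first.
  by apply/funext => w; rewrite /term -mulrBr wincr_shift.
have a0 : 0 <= Num.max s (T k) by rewrite le_max s0.
apply: (@wiener_mean _ _ _ P n p W N F hnoise i _ _ (sp_val S k) A M ip a0 _ _ HM _).2.
- have h : T k <= Num.min (T k.+1) t by rewrite le_min TS kt.
  by rewrite ge_max !le_max lexx h /= orbT.
- move=> E mE; apply: (filt_mono (noise_usual hnoise) (T0 k)); last exact: sp_val_meas.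
  by rewrite le_max lexx orbT.
- by apply: (filt_mono (noise_usual hnoise) s0) FA; rewrite le_max lexx.
Qed.

Lemma sp_integral_mean t : 0 <= t ->
  P.-integrable setT (EFin \o sp_integral S (W i) t) /\
  forall s A, 0 <= s -> s <= t -> F s A ->
  \int[P]_(w in A) sp_integral S (W i) t w = \int[P]_(w in A) sp_integral S (W i) s w.
Proof.
move=> t0.
have ti (A : set Om) u k : measurable A -> 0 <= u -> P.-integrable A (EFin \o term k u).
  by move=> mA u0; apply: (integrableS measurableT) => //; exact: term_integrable.
split.
  have [+ _] := @Rintegral_sum R _ _ P setT _ (index_enum 'I_(sp_size S)) (fun k w => term k t w)
    measurableT (fun k => ti _ _ _ measurableT t0).
  by apply: eq_integrable.
move=> s A s0 st FA; have mA := filt_meas hnoise s0 FA.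
have E u : 0 <= u -> \int[P]_(w in A) sp_integral S (W i) u w =
    \sum_(k < sp_size S) \int[P]_(w in A) term k u w.
  move=> u0; have [_ <-] := @Rintegral_sum R _ _ P A _ (index_enum 'I_(sp_size S))
    (fun k w => term k u w) mA (fun k => ti _ _ _ mA u0).
  by apply: eq_Rintegral.
by rewrite !E //; apply: eq_bigr => k _; exact: term_mean.
Qed.

Lemma sp_integral0 w : sp_integral S (W i) 0 w = 0.
Proof.
rewrite /sp_integral big1 // => k _.
by rewrite !min_r ?subrr ?mulr0 //; exact: T0.
Qed.

End SimpleProcess.

(** The simple integrals have equal integrals over [A] at [s] and [t], so the difference of the two
    approximation errors, integrated over [A], does not depend on the index [m]. It tends to 0 by
    convergence in [L^2], hence is 0. *)
Lemma ito_mean (i : 'I_n.+1) (Hf I : R -> Om -> R) : (i <= p)%N ->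
  is_ito_integral P F (W i) Hf I ->
  [/\ forall t, 0 <= t -> P.-integrable setT (EFin \o I t),
    forall A, F 0 A -> \int[P]_(w in A) I 0 w = 0 &
    forall s t A, 0 <= s -> s <= t -> F s A ->
      \int[P]_(w in A) I t w = \int[P]_(w in A) I s w].
Proof.
move=> ip [Iad _ [S Scv]].
have mI t : 0 <= t -> measurable_fun setT (I t).
  by move=> t0; apply: (filt_preim_meas t0) => E mE; exact: Iad.
pose f t m w := I t w - sp_integral (S m) (W i) t w.
have spi m t : 0 <= t -> P.-integrable setT (EFin \o sp_integral (S m) (W i) t).
  by move=> t0; have [] := sp_integral_mean ip (S m) t0.
have mf t m : 0 <= t -> measurable_fun setT (f t m).
  move=> t0; apply: measurable_funB; first exact: mI.
  by apply/measurable_EFinP; case/integrableP: (spi m t t0).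
have L2 t (A : set Om) : 0 <= t -> measurable A ->
    (\forall m \near \oo, P.-integrable setT (EFin \o f t m)) /\
    \int[P]_(w in A) f t m w @[m --> \oo] --> (0 : R).
  move=> t0 mA; apply: cvg_L2_Rintegral => //; first by move=> m; exact: mf.
  by have [_] := Scv t t0.
have Ii t : 0 <= t -> P.-integrable setT (EFin \o I t).
  move=> t0; have [[m _ /(_ m (leqnn m)) fi] _] := L2 t setT t0 measurableT.
  have := integrableD measurableT fi (spi m t t0).
  by apply: eq_integrable => // w _; rewrite /= -EFinD subrK.
have dec t A m : 0 <= t -> measurable A ->
    \int[P]_(w in A) f t m w =
    \int[P]_(w in A) I t w - \int[P]_(w in A) sp_integral (S m) (W i) t w.
  move=> t0 mA; rewrite -RintegralB //.
  - by apply: (integrableS measurableT) => //; exact: Ii.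
  - by apply: (integrableS measurableT) => //; exact: spi.
have main s t A : 0 <= s -> s <= t -> F s A ->
    \int[P]_(w in A) I t w = \int[P]_(w in A) I s w.
  move=> s0 st FA; have t0 := le_trans s0 st; have mA := filt_meas hnoise s0 FA.
  have c1 := (L2 t A t0 mA).2; have c2 := (L2 s A s0 mA).2.
  have : \int[P]_(w in A) f t m w - \int[P]_(w in A) f s m w @[m --> \oo] --> (0 - 0 : R).
    exact: cvgB.
  rewrite (_ : (fun m => _) = fun=> \int[P]_(w in A) I t w - \int[P]_(w in A) I s w).
    by move=> /cvg_cst_eq e; apply/eqP; rewrite -subr_eq0 e subrr.
  apply/funext => m; rewrite !dec // ((sp_integral_mean ip (S m) t0).2 s A s0 st FA).
  by rewrite opprB addrA subrK.
split => // A FA; have mA := filt_meas hnoise (lexx 0) FA.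
have := (L2 0 A (lexx 0) mA).2.
rewrite (_ : (fun m => _) = fun=> \int[P]_(w in A) I 0 w); first by move=> /cvg_cst_eq.
apply/funext => m; apply: eq_Rintegral => w _.
by rewrite /f (sp_integral0 i (S m)) subr0.
Qed.

End ItoMean.

Section LeftLimits.
Context {R : realType} {d : nat}.
Implicit Types (f : R -> 'M[R[i]]_d).

Lemma cvg_at_left_seq (u : R) (v : nat -> R) : (forall m, v m < u) ->
  v m @[m --> \oo] --> u -> v m @[m --> \oo] --> u^'-.
Proof.
move=> vu cv B uB; change (\forall m \near \oo, B (v m)).
have : \forall m \near \oo, v m < u -> B (v m) by exact: (cv _ uB).
by apply: filterS => m; apply; exact: vu.
Qed.

Lemma left_limP f u b j k : cadlag f -> 0 < u ->
  mxpart b j k (f v) @[v --> u^'-] --> mxpart b j k (left_lim f u).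
Proof. by move=> cf u0; rewrite mxpart_of; have [_ /(_ u u0)] := cf b j k. Qed.

Lemma left_lim_seq f u (v : nat -> R) b j k : cadlag f -> 0 < u ->
  (forall m, v m < u) -> v m @[m --> \oo] --> u ->
  mxpart b j k (f (v m)) @[m --> \oo] --> mxpart b j k (left_lim f u).
Proof.
move=> cf u0 vu cv.
apply: (@cvg_comp _ _ _ v (fun x => mxpart b j k (f x)) \oo (u^'-)).
  exact: cvg_at_left_seq.
exact: left_limP.
Qed.

Lemma state_left_lim f u : cadlag f -> (forall v, 0 <= v -> state (f v)) -> 0 < u ->
  state (left_lim f u).
Proof.
move=> cf sf u0; apply: (@state_cvg _ _ _ (u^'-) _ f); last first.
  by move=> b j k; exact: left_limP.
near=> v; apply: sf; near: v; exact: nbhs_left_ge.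
Unshelve. all: by end_near. Qed.

End LeftLimits.

Section StepFields.
Context {R : realType}.

Definition step_cell (K s t : R) m (lk : 'I_m.+1 * 'I_m.+1) : set (plane R) :=
  pcell (gpt 0 K m lk.1) (gpt 0 K m lk.1.+1) (gpt s t m lk.2) (gpt s t m lk.2.+1).

(** Each cell carries the value at its lower-left corner, which is known before the cell begins and
    so is independent of the count of the cell. *)
Definition step_field (K s t : R) m (y : R -> R -> R) (z : plane R) : R :=
  \sum_(lk : 'I_m.+1 * 'I_m.+1)
    y (gpt 0 K m lk.1) (gpt s t m lk.2) * \1_(step_cell K s t lk) z.

Lemma step_cell_sub K s t m (lk : 'I_m.+1 * 'I_m.+1) : 0 <= K -> s <= t ->
  step_cell K s t lk `<=` pcell 0 K s t.
Proof.
move=> K0 st z [z1 z2]; split => /=; rewrite in_itv /=.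
  exact: gcell_sub K0 (ltn_ord lk.1) z1.
exact: gcell_sub st (ltn_ord lk.2) z2.
Qed.

Lemma step_fieldE K s t m y z : pcell 0 K s t z ->
  step_field K s t m y z = y (lgrid 0 K m z.1) (lgrid s t m z.2).
Proof.
move=> [/=]; rewrite !in_itv /= => /andP[z1 z1'] /andP[z2 z2'].
have K0 := ltW (lt_le_trans z1 z1'); have st := ltW (lt_le_trans z2 z2').
have [l lm lz] := gcell_ex m z1 z1'; have [k km kz] := gcell_ex m z2 z2'.
rewrite /lgrid (gfun_cell _ K0 lm lz) (gfun_cell _ st km kz).
rewrite /step_field (bigD1 (Ordinal lm, Ordinal km)) //= indicE mem_set // mulr1.
rewrite big1 ?addr0 // => -[l' k'] ne; rewrite indicE memNset ?mulr0 // => -[/= l'z k'z].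
move/eqP: ne; apply; congr (_, _); apply: val_inj => /=.
  exact: gcell_unique K0 l'z lz.
exact: gcell_unique st k'z kz.
Qed.

End StepFields.

(** * Means of compensated jump integrals and of drift integrals *)

Section Means.
Context {R : realType} {dO : measure_display} {Om : measurableType dO}.
Variable P : probability Om R.
Context {d n : nat} {p : nat}.
Variables (W : 'I_n.+1 -> R -> Om -> R)
  (N : 'I_n.+1 -> Om -> {measure set (plane R) -> \bar R}).
Variable F : R -> set (set Om).
Hypothesis hnoise : sme_noise P p W N F.
Variable X : R -> Om -> 'M[R[i]]_d.
Hypothesis Xstate : forall t w, 0 <= t -> state (X t w).
Hypothesis Xadapted : forall b j k, adapted F (fun t w => mxpart b j k (X t w)).

Lemma sigmaF t : 0 <= t -> <<s F t >> = F t.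
Proof. by move=> t0; apply: sigma_algebra_id; exact: filt_sigma (noise_usual hnoise) _ t0. Qed.

Lemma Xpart_measF t b j k : 0 <= t ->
  measurable_fun setT ((fun w => mxpart b j k (X t w)) : g_sigma_algebraType (F t) -> R).
Proof.
move=> t0 _ E mE; rewrite setTI; apply: sub_sigma_algebra.
by apply: Xadapted.
Qed.

Lemma jump_app_F q C b j k x t (E : set R) : 0 <= t -> measurable E ->
  F t ((fun w => jump_app q C b j k x (X t w)) @^-1` E).
Proof.
move=> t0 mE; have := @measurable_jump_app R d _ (g_sigma_algebraType (F t)) setT (X t)
  q C b j k x measurableT (fun b j k => Xpart_measF b j k t0) measurableT E mE.
by rewrite setTI => h; rewrite -(sigmaF t0); exact: h.
Qed.

Lemma X_meas t b j k (A : set Om) : 0 <= t ->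
  measurable_fun A (fun w => mxpart b j k (X t w)).
Proof.
move=> t0; apply: measurable_funTS.
by apply: (filt_preim_meas hnoise t0) => E mE; exact: Xadapted.
Qed.

Section Window.
Variables (s t : R) (A : set Om).
Hypotheses (s0 : 0 <= s) (st : s < t) (FA : F s A).
Hypothesis Acadlag : forall w, A w -> cadlag (X ^~ w).

Let mA : measurable A := filt_meas hnoise s0 FA.

Let gpt_ge m k : s <= gpt s t m k.
Proof. by rewrite -{1}(gpt0 s t m) gpt_le // ltW. Qed.

Let FgptA m k : F (gpt s t m k) A.
Proof. exact: (filt_mono (noise_usual hnoise) s0 (gpt_ge m k)). Qed.

Let lgrid_left u b j k w : A w -> s < u -> u <= t ->
  mxpart b j k (X (lgrid s t m u) w) @[m --> \oo] --> mxpart b j k (left_lim (X ^~ w) u).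
Proof.
move=> Aw su ut; apply: (left_lim_seq (f := X ^~ w)).
- exact: Acadlag.
- exact: le_lt_trans s0 su.
- by move=> m; have [/andP[]] := lgridP m su ut.
- exact: cvg_lgrid.
Qed.

Section Jump.
Variables (i : 'I_n.+1) (C : 'M[R[i]]_d) (b : bool) (j k : 'I_d).
Hypothesis ip : (p < i)%N.
Let K := jump_bound C.
Let K0 : 0 <= K. Proof. exact/ltW/jump_bound_gt0. Qed.
Let Box := pcell 0 K s t.
Let mBox : measurable Box. Proof. exact: measurable_pcell. Qed.

Let stepJ q m z w := step_field K s t m (fun x v => jump_app q C b j k x (X v w)) z.
Let appJ q (z : plane R) w := jump_app q C b j k z.1 (left_lim (X ^~ w) z.2).

Definition jump_field (z : plane R) w : R :=
  mxpart b j k (jump_coef C (left_lim (X ^~ w) z.2) z.1).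

Let lgrid_state m u w : s < u -> u <= t -> state (X (lgrid s t m u) w).
Proof.
move=> su ut; apply: Xstate; have [/andP[h _] _] := lgridP m su ut.
exact: le_trans s0 h.
Qed.

(** Stated for a general random measure, to serve both the Poisson measure and its intensity. The
    order of the limits matters: first the grid, with a fixed cut-off [q] that makes the integrand
    continuous, then [q]. *)
Let jump_pass (mu : Om -> {measure set (plane R) -> \bar R}) (c : Om -> R) :
  (forall w, mu w Box = (c w)%:E) -> P.-integrable A (EFin \o c) ->
  (forall m lk, measurable_fun setT (fun w => fine (mu w (@step_cell R K s t m lk)))) ->
  [/\ bounded_field mu Box A 2 jump_field,
    forall q, \int[P]_(w in A) \int[mu w]_(z in Box) stepJ q m z w @[m --> \oo] -->
      \int[P]_(w in A) \int[mu w]_(z in Box) appJ q z w &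
    \int[P]_(w in A) \int[mu w]_(z in Box) appJ q z w @[q --> \oo] -->
      \int[P]_(w in A) \int[mu w]_(z in Box) jump_field z w].
Proof.
move=> muBox ci mcell.
have cell_sub m lk : @step_cell R K s t m lk `<=` Box by exact: step_cell_sub K0 (ltW st).
have bf0 q m : bounded_field mu Box A 2 (stepJ q m).
  split.
  - move=> w Aw; apply: measurable_step => lk; exact: measurable_pcell.
  - move=> w z Aw Bz; rewrite /stepJ step_fieldE //.
    move: Bz => [/=]; rewrite !in_itv /= => /andP[z1 z1'] /andP[z2 z2'].
    by apply: jump_app_le; [exact: lgrid_state|have [/andP[]] := lgridP m z1 z1'].
  - rewrite (_ : (fun w => _) = (fun w : Om => \sum_(lk : 'I_m.+1 * 'I_m.+1) jump_app q C b j k (gpt 0 K m lk.1)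
       (X (gpt s t m lk.2) w) * fine (mu w (step_cell K s t lk)))).
      apply: measurable_sum => lk; apply: measurable_funM.
        apply: measurable_jump_app => // b' j' k'; apply: X_meas.
        exact: le_trans s0 (gpt_ge _ _).
      by apply: measurable_funTS; exact: mcell.
    apply/funext => w; apply: (Rintegral_step _ mBox (muBox w)) => lk //.
    exact: measurable_pcell.
have lim1 q := field_limit mBox mA (ler0n R 2) (fun w _ => muBox w) ci (bf0 q) (g := appJ q).
have {}lim1 q : bounded_field mu Box A 2 (appJ q) /\
    \int[P]_(w in A) \int[mu w]_(z in Box) stepJ q m z w @[m --> \oo] -->
      \int[P]_(w in A) \int[mu w]_(z in Box) appJ q z w.
  apply: lim1 => w z Aw Bz; rewrite /stepJ.
  under eq_fun do rewrite step_fieldE //.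
  move: Bz => [/=]; rewrite !in_itv /= => /andP[z1 z1'] /andP[z2 z2'].
  apply: cvg_jump_app => //.
  - apply: (state_left_lim (f := X ^~ w)); [exact: Acadlag| |exact: le_lt_trans s0 z2].
    by move=> v v0; exact: Xstate.
  - exact: cvg_lgrid.
  - by move=> b' j' k'; exact: lgrid_left.
have [|bfJ cvJ] := field_limit mBox mA (ler0n R 2) (fun w _ => muBox w) ci
   (fun q => (lim1 q).1) (g := jump_field).
  move=> w z Aw [/=]; rewrite !in_itv /= => /andP[z1 z1'] /andP[z2 z2'].
  apply: cvg_jump_app_q => //.
  apply: (state_left_lim (f := X ^~ w)); [exact: Acadlag| |exact: le_lt_trans s0 z2].
  by move=> v v0; exact: Xstate.
split; [exact: bfJ|move=> q; exact: (lim1 q).2|exact: cvJ].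
Qed.

Let cN w := fine (N i w Box).
Let cP (_ : Om) : R := (K - 0) * (t - s).

Lemma jump_box_N w : N i w Box = (cN w)%:E.
Proof.
by rewrite /cN; have [m ->] := ppp_pcell_nat hnoise w 0 K s t ip.
Qed.

Lemma jump_box_P : @plane_measure R Box = ((K - 0) * (t - s))%:E.
Proof. by rewrite plane_pcell //; exact: ltW. Qed.

Let cNi : P.-integrable A (EFin \o cN).
Proof.
apply: (integrableS measurableT) => //.
have H0 w : `|(cst 0 : Om -> R) w| <= 0 by rewrite normr0.
exact: (poisson_mean hnoise ip K0 s0 (ltW st) (fun E _ => adapted_cst hnoise 0 E s0) H0
  (filtT hnoise s0)).1.
Qed.

Let cPi : P.-integrable A (EFin \o cP).
Proof. by apply: (integrableS measurableT) => //; exact: finite_measure_integrable_cst. Qed.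

(** For step fields the equality of means holds cell by cell, by [poisson_mean]; the two limits of
    [jump_pass] carry it to the true integrand. *)
Lemma jump_mean : [/\ bounded_field (N i) Box A 2 jump_field,
  bounded_field (fun=> @plane_measure R) Box A 2 jump_field,
  P.-integrable A (EFin \o (fun w => \int[N i w]_(z in Box) jump_field z w)),
  P.-integrable A (EFin \o (fun w => \int[@plane_measure R]_(z in Box) jump_field z w)) &
  \int[P]_(w in A) \int[N i w]_(z in Box) jump_field z w =
  \int[P]_(w in A) \int[@plane_measure R]_(z in Box) jump_field z w].
Proof.
have mNcell m lk : measurable_fun setT (fun w => fine (N i w (@step_cell R K s t m lk))).
  apply: measurableT_comp => //.
  exact: (ppp_meas (noise_poisson hnoise ip) (measurable_pcell _ _ _ _)).
have [bN lN1 lN2] := jump_pass jump_box_N cNi mNcell.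
have [bP lP1 lP2] := @jump_pass (fun=> @plane_measure R) _ (fun _ => jump_box_P) cPi
  (fun m lk => measurable_cst _).
split => //.
- exact: bf_integrable_out mBox mA (fun w _ => jump_box_N w) cNi bN.
- exact: bf_integrable_out mBox mA (fun w _ => jump_box_P) cPi bP.
suff e q : \int[P]_(w in A) \int[N i w]_(z in Box) appJ q z w =
    \int[P]_(w in A) \int[@plane_measure R]_(z in Box) appJ q z w.
  move: lN2; under eq_fun do rewrite e; move=> lN2.
  exact: (cvg_unique (@Rhausdorff R) lN2 lP2).
suff e' m : \int[P]_(w in A) \int[N i w]_(z in Box) stepJ q m z w =
    \int[P]_(w in A) \int[@plane_measure R]_(z in Box) stepJ q m z w.
  move: (lN1 q); under eq_fun do rewrite e'; move=> lN1q.
  exact: (cvg_unique (@Rhausdorff R) lN1q (lP1 q)).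
pose Y (lk : 'I_m.+1 * 'I_m.+1) w := jump_app q C b j k (gpt 0 K m lk.1) (X (gpt s t m lk.2) w).
have stepE (mu : {measure set (plane R) -> \bar R}) c w : mu Box = c%:E ->
    \int[mu]_(z in Box) stepJ q m z w =
    \sum_lk Y lk w * fine (mu (step_cell K s t lk)).
  move=> muB; apply: (Rintegral_step _ mBox muB) => lk; first exact: measurable_pcell.
  exact: step_cell_sub K0 (ltW st).
have g0 (lk : 'I_m.+1 * 'I_m.+1) : 0 <= gpt s t m lk.2 := le_trans s0 (gpt_ge m lk.2).
have YM lk w : `|Y lk w| <= 2.
  apply: jump_app_le; first exact: Xstate.
  by rewrite -{1}(gpt0 0 K m) gpt_le.
have YF (lk : 'I_m.+1 * 'I_m.+1) (E : set R) : measurable E -> F (gpt s t m lk.2) (Y lk @^-1` E).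
  exact: jump_app_F.
have pm (lk : 'I_m.+1 * 'I_m.+1) := poisson_mean hnoise (x1 := gpt 0 K m lk.1)
  (x2 := gpt 0 K m lk.1.+1) (t2 := gpt s t m lk.2.+1) ip
  (gpt_le m K0 (leqnSn _)) (g0 lk) (gpt_le m (ltW st) (leqnSn _)) (YF lk) (YM lk) (FgptA m lk.2).
have mY (lk : 'I_m.+1 * 'I_m.+1) : measurable_fun setT (Y lk) by exact: (filt_preim_meas hnoise (g0 lk) (YF lk)).
under eq_Rintegral do rewrite (stepE _ _ _ (jump_box_N _)).
under [RHS]eq_Rintegral do rewrite (stepE _ _ _ jump_box_P).
rewrite (Rintegral_sum _ mA _).2; last first.
  move=> lk; have [Ni _] := pm lk.
  have Ni2 := integrableZl mA 2 (integrableS measurableT mA (@subsetT _ _) Ni).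
  apply: le_integrable Ni2 => //.
    by apply/measurable_EFinP; apply: measurable_funTS; apply: measurable_funM.
  move=> w _ /=; rewrite lee_fin (normrM (Y lk w)) (normrM 2) ler_wpM2r //.
  exact: le_trans (YM lk w) (ler_norm _).
rewrite (Rintegral_sum _ mA _).2; last first.
  move=> lk; have Yi : P.-integrable A (EFin \o Y lk).
    by apply: (@integrable_bounded _ _ _ P _ _ 2) => //; exact: measurable_funTS.
  have := integrableZr mA (fine (@plane_measure R (step_cell K s t lk))) Yi.
  by apply: eq_integrable.
apply: eq_bigr => lk _; have [_ ->] := pm lk.
rewrite RintegralZr //; last first.
  by apply: (@integrable_bounded _ _ _ P _ _ 2) => //; exact: measurable_funTS.
congr (_ * _); rewrite plane_pcell //; apply: gpt_le => //; exact: ltW.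
Qed.

End Jump.

Section Drift.
Variables (g : 'M[R[i]]_d -> R) (M : R).
Hypothesis gl : rlin g.
Hypothesis gM : forall rho, state rho -> `|g rho| <= M.
Let mu : {measure set (measurableTypeR R) -> \bar R} := @lebesgue_measure R.
Let D : set (measurableTypeR R) := `]s, t].
Let mD : measurable D. Proof. exact: measurable_itv. Qed.
Let muD : mu D = (t - s)%:E.
Proof.
transitivity (@lebesgue_measure R `]s, t]) => //.
by rewrite lebesgue_measure_itv /= lte_fin st.
Qed.

Definition drift_field (u : R) w : R := g (left_lim (X ^~ w) u).

Let step_drift m u w := \sum_(k < m.+1) g (X (gpt s t m k) w) * \1_(gcell s t m k) u.

Let step_driftE m u w : s < u -> u <= t -> step_drift m u w = g (X (lgrid s t m u) w).
Proof. by move=> su ut; exact: (gfun_lgrid m (fun v => g (X v w))). Qed.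

Lemma measurable_gX v (B : set Om) : 0 <= v -> measurable_fun B (fun w => g (X v w)).
Proof.
by move=> v0; apply: measurable_rlin => // b j k; exact: X_meas.
Qed.

(** The mean of the time integral is reached through Riemann sums of means at grid points, without
    exchanging the two integrals. *)
Lemma drift_mean : 0 <= M -> [/\ bounded_field (fun=> mu) D A M drift_field,
  P.-integrable A (EFin \o (fun w => \int[mu]_(u in D) drift_field u w)) &
  \sum_(k < m.+1) (\int[P]_(w in A) g (X (gpt s t m k) w)) * ((t - s) / m.+1%:R)
    @[m --> \oo] --> \int[P]_(w in A) \int[mu]_(u in D) drift_field u w].
Proof.
move=> M0; have gpt0 m k : 0 <= gpt s t m k := le_trans s0 (gpt_ge m k).
have mucell m (k : 'I_m.+1) : fine (mu (gcell s t m k)) = (t - s) / m.+1%:R.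
  transitivity (fine (@lebesgue_measure R `]gpt s t m k, gpt s t m k.+1])) => //.
  rewrite lebesgue_measure_itv /= lte_fin -(gpt_step s t m k).
  by rewrite ifT // -subr_gt0 gpt_step divr_gt0 // subr_gt0.
have int_step m w : \int[mu]_(u in D) step_drift m u w =
    \sum_(k < m.+1) g (X (gpt s t m k) w) * ((t - s) / m.+1%:R).
  rewrite /step_drift (Rintegral_step _ mD muD) => [|k|k u].
  - by apply: eq_bigr => k _; rewrite mucell.
  - exact: measurable_gcell.
  - by move/(gcell_sub (ltW st) (ltn_ord k)); rewrite /D /= in_itv.
have ci : P.-integrable A (EFin \o (fun=> t - s)).
  by apply: (integrableS measurableT) => //; exact: finite_measure_integrable_cst.
have bf m : bounded_field (fun=> mu) D A M (step_drift m).
  split.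
  - move=> w Aw; apply: measurable_step => k; exact: measurable_gcell.
  - move=> w u Aw; rewrite /D /= in_itv /= => /andP[su ut]; rewrite step_driftE //.
    apply/gM/Xstate; have [/andP[h _] _] := lgridP m su ut.
    exact: le_trans s0 h.
  - under eq_fun do rewrite int_step.
    apply: measurable_sum => k; apply: measurable_funM => //.
    exact: measurable_gX.
have [|bfD cv] := @field_limit R _ Om P _ _ (fun=> mu) D A M (fun=> t - s) step_drift
  drift_field mD mA M0 (fun w _ => muD) ci bf.
  move=> w u Aw; rewrite /D /= in_itv /= => /andP[su ut].
  under eq_fun do rewrite step_driftE //.
  by apply: rlin_cvg => // b j k; exact: lgrid_left.
split => //; first exact: (@bf_integrable_out R _ Om P _ _ (fun=> mu) D A M (fun=> t - s) drift_field
  mD mA (fun w _ => muD) ci bfD).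
apply: cvg_trans cv; apply: near_eq_cvg; apply: nearW => m.
have gi k : P.-integrable A (EFin \o (fun w => g (X (gpt s t m k) w))).
  apply: (@integrable_bounded _ _ _ P _ _ M) => //; first exact: measurable_gX.
  by move=> w _; apply/gM/Xstate.
under eq_Rintegral do rewrite int_step.
rewrite (Rintegral_sum _ mA _).2 => [|k].
  by apply: eq_bigr => k _; rewrite RintegralZr.
by have := integrableZr mA ((t - s) / m.+1%:R) (gi k); apply: eq_integrable.
Qed.

End Drift.
End Window.
End Means.

(** * Evolution of the means of a solution *)

Section Solution.
Context {R : realType} {dO : measure_display} {Om : measurableType dO}.
Variable P : probability Om R.
Context {d n : nat} {p : nat}.
Variables (W : 'I_n.+1 -> R -> Om -> R)
  (N : 'I_n.+1 -> Om -> {measure set (plane R) -> \bar R}).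
Variable F : R -> set (set Om).
Hypothesis hnoise : sme_noise P p W N F.
Variables (H : 'M[R[i]]_d) (C : 'I_n.+1 -> 'M[R[i]]_d).

Let L := Lindblad H C.

Lemma L_rlin b j k : rlin (fun M => mxpart b j k (L M)).
Proof. exact: rlin_mxpart (Lindblad_linear H C) b j k. Qed.

Definition Lbound : R := \sum_(a : @partidx d) rlin_bound (fun M => pmx a (L M)).

Lemma Lbound_ge0 : 0 <= Lbound.
Proof. by apply: sumr_ge0 => a _; exact: rlin_bound_ge0. Qed.

Lemma Lbound_le b j k M c : (forall b j k, `|mxpart b j k M| <= c) -> 0 <= c ->
  `|mxpart b j k (L M)| <= Lbound * c.
Proof.
move=> Mc c0; apply: le_trans (rlin_le (L_rlin b j k) Mc) _.
rewrite ler_wpM2r // /Lbound (bigD1 (b, (j, k))) //= lerDl.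
by apply: sumr_ge0 => a _; exact: rlin_bound_ge0.
Qed.

Lemma Lbound_state b j k rho : state rho -> `|mxpart b j k (L rho)| <= Lbound.
Proof.
by move=> sr; rewrite -[Lbound]mulr1; apply: Lbound_le => // b' j' k'; exact: state_mxpart.
Qed.

Variables (rho0 : 'M[R[i]]_d) (X : R -> Om -> 'M[R[i]]_d).
Hypothesis sol : sme_solution P p W N H C F rho0 X.

Let Xstate t w : 0 <= t -> state (X t w). Proof. exact: (sol_state sol). Qed.
Let Xadapted b j k : adapted F (fun t w => mxpart b j k (X t w)).
Proof. exact: (sol_adapted sol). Qed.

Lemma Xpart_integrable t b j k (A : set Om) : 0 <= t -> measurable A ->
  P.-integrable A (EFin \o (fun w => mxpart b j k (X t w))).
Proof.
move=> t0 mA; apply: (@integrable_bounded _ _ _ P _ _ 1) => //.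
  exact: (X_meas hnoise Xadapted).
by move=> w _; apply/state_mxpart/Xstate.
Qed.

(** An unnormalised conditional mean given [A]; [A = setT] gives the mean state. *)
Definition mean_on (A : set Om) t : 'M[R[i]]_d :=
  of_mxpart (fun b j k => \int[P]_(w in A) mxpart b j k (X t w)).

Lemma rlin_mean_on g A t : rlin g -> 0 <= t -> measurable A ->
  P.-integrable A (EFin \o (fun w => g (X t w))) /\
  \int[P]_(w in A) g (X t w) = g (mean_on A t).
Proof.
move=> gl t0 mA.
have pi (a : partidx) : P.-integrable A (EFin \o (fun w => pmx a (X t w) * g (unit_mx a))).
  have := integrableZr mA (g (unit_mx a)) (Xpart_integrable a.1 a.2.1 a.2.2 t0 mA).
  by apply: eq_integrable.
have [si se] := Rintegral_sum (index_enum (@partidx d : finType)) mA pi.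
split.
  by apply: eq_integrable si => // w _ /=; rewrite (rlinE _ gl).
under eq_Rintegral do rewrite (rlinE _ gl).
rewrite se (rlinE (mean_on A t) gl); apply: eq_bigr => a _.
rewrite RintegralZr //; last exact: Xpart_integrable.
by rewrite /pmx mxpart_of.
Qed.

Lemma Rintegral_full_set (A G0 : set Om) (f : Om -> R) : measurable A -> measurable G0 ->
  P (~` G0) = 0%E -> P.-integrable A (EFin \o f) ->
  \int[P]_(w in A) f w = \int[P]_(w in A `&` G0) f w.
Proof.
move=> mA mG P0 fi; rewrite /Rintegral; congr fine.
rewrite (negligible_integral (measurableC mG) mA fi P0) setDE setCK //.
Qed.

Section Increments.
Variables (G0 : set Om) (Ito : 'I_n.+1 -> R -> Om -> 'M[R[i]]_d).
Hypothesis FG0 : F 0 G0.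
Hypothesis G0cadlag : forall w, G0 w -> cadlag (X ^~ w).
Hypothesis G0eq : forall w, G0 w -> forall t, 0 <= t -> sme_equation p N H C rho0 X Ito w t.
Hypothesis Itoint : forall i : 'I_n.+1, (i <= p)%N -> forall b j k,
  is_ito_integral P F (W i)
    (fun s w => mxpart b j k (Gop (C i) (left_lim (X ^~ w) s)))
    (fun t w => mxpart b j k (Ito i t w)).

Variables (b : bool) (j k : 'I_d).

Let mu : {measure set (measurableTypeR R) -> \bar R} := @lebesgue_measure R.
Let drift w (u : measurableTypeR R) := mxpart b j k (L (left_lim (X ^~ w) u)).
Let jump i w (z : plane R) := mxpart b j k (jump_coef (C i) (left_lim (X ^~ w) z.2) z.1).
Let K i := jump_bound (C i).

Let drift_integrable w t : G0 w -> 0 <= t -> mu.-integrable `]0, t] (EFin \o drift w).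
Proof.
move=> Gw; rewrite le_eqVlt => /predU1P[<-|t0].
  by rewrite set_itvoc0; exact: integrable_set0.
have [bf _ _] := drift_mean hnoise Xstate Xadapted (lexx 0) t0 FG0 G0cadlag
  (L_rlin b j k) (@Lbound_state b j k) Lbound_ge0.
apply: (@integrable_bounded_on _ _ _ mu _ (drift w) (t - 0) Lbound) => //.
- transitivity (@lebesgue_measure R `]0, t]) => //.
  by rewrite lebesgue_measure_itv /= lte_fin t0.
- exact: (bf_meas bf Gw).
- by move=> u u0; exact: (bf_le bf Gw u0).
Qed.

Let drift_split w s t : G0 w -> 0 <= s -> s <= t ->
  \int[mu]_(u in `]0, t]) drift w u =
  \int[mu]_(u in `]0, s]) drift w u + \int[mu]_(u in `]s, t]) drift w u.
Proof.
move=> Gw s0 st.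
have e : [set` `]0, t]] = [set` `]0, s]] `|` [set` `]s, t]] :> set (measurableTypeR R).
  by rewrite -itv_bndbnd_setU // bnd_simp.
rewrite e Rintegral_setU //; last first.
- apply/disj_setPS => u [] /=; rewrite !in_itv /= => /andP[_ us] /andP[su _].
  by have := lt_le_trans su us; rewrite ltxx.
- by rewrite -e; apply: drift_integrable => //; exact: le_trans st.
Qed.

Let jump_out i w z : G0 w -> 0 < (z.2 : R) -> ~ (0 < (z.1 : R) <= K i) -> jump i w z = 0.
Proof.
move=> Gw z0 zK.
have sl : state (left_lim (X ^~ w) z.2).
  apply: (state_left_lim (f := X ^~ w)) => //; first exact: G0cadlag.
  by move=> v v0; exact: Xstate.
rewrite /jump mxpart_jump; last by case: sl.
case: ifP => // /andP[x0 xr]; exfalso; apply: zK.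
by rewrite x0 ltW //; apply: lt_trans xr _; exact: jump_rate_lt.
Qed.

(** The equation integrates over all marks, a strip unbounded in the mark; the integrand vanishes
    for marks outside []0, K i]], which leaves a bounded box. *)
Let jump_strip i w t (nu : {measure set (plane R) -> \bar R}) : G0 w ->
  \int[nu]_(z in [set z | 0 < (z.2 : R) <= t]) jump i w z =
  \int[nu]_(z in pcell 0 (K i) 0 t) jump i w z.
Proof.
move=> Gw; set S := [set z | _].
have -> : pcell 0 (K i) 0 t = S `&` [set z : plane R | 0 < (z.1 : R) <= K i].
  by apply/seteqP; split => z [z1 z2]; split => //; move: z1 z2; rewrite /S /= !in_itv.
rewrite -Rintegral_indicr; apply: eq_Rintegral => z /set_mem /= /andP[z0 zt].
rewrite indicE; case: (boolP (_ \in _)) => [_|zK]; first by rewrite mul1r.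
by rewrite mul0r; apply: jump_out => // zK'; move/negP: zK; apply; exact/mem_set.
Qed.

Let jump_split i w s t (nu : {measure set (plane R) -> \bar R}) c : G0 w ->
  0 <= s -> s <= t -> nu (pcell 0 (K i) 0 t) = c%:E ->
  measurable_fun (pcell 0 (K i) 0 t) (jump i w) ->
  (forall z, pcell 0 (K i) 0 t z -> `|jump i w z| <= 2) ->
  \int[nu]_(z in pcell 0 (K i) 0 t) jump i w z =
  \int[nu]_(z in pcell 0 (K i) 0 s) jump i w z +
  \int[nu]_(z in pcell 0 (K i) s t) jump i w z.
Proof.
move=> Gw s0 st nuc mj jle.
have e : pcell 0 (K i) 0 t = pcell 0 (K i) 0 s `|` pcell 0 (K i) s t.
  apply/seteqP; split => [z [z1]|z [|] [z1]] /=; rewrite !in_itv /=.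
  - move=> /andP[z0 zt]; have [zs|sz] := leP (z.2 : R) s; [left|right]; split => //=.
      by rewrite in_itv /= z0.
    by rewrite in_itv /= sz.
  - by move=> /andP[z0 zs]; split => //=; rewrite in_itv /= z0 (le_trans zs).
  - by move=> /andP[sz zt]; split => //=; rewrite in_itv /= zt (le_lt_trans s0).
rewrite e Rintegral_setU //; try exact: measurable_pcell.
- by rewrite -e; apply: (integrable_bounded_on _ nuc mj jle); exact: measurable_pcell.
- apply/disj_setPS => z [[_ /=]]; rewrite in_itv /= => /andP[_ zs] [_ /=].
  by rewrite in_itv /= => /andP[sz _]; have := lt_le_trans sz zs; rewrite ltxx.
Qed.

Let jump_at i w t (nu : {measure set (plane R) -> \bar R}) : R :=
  \int[nu]_(z in [set z | 0 < (z.2 : R) <= t]) jump i w z.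

Let jump_incr (i : 'I_n.+1) w s t : (p < i)%N -> G0 w -> 0 <= s -> s < t ->
  (jump_at i w t (N i w) = jump_at i w s (N i w) +
    \int[N i w]_(z in pcell 0 (K i) s t) jump i w z) /\
  (jump_at i w t (@plane_measure R) = jump_at i w s (@plane_measure R) +
    \int[@plane_measure R]_(z in pcell 0 (K i) s t) jump i w z).
Proof.
move=> ip Gw s0 st; have t0 := le_lt_trans s0 st.
have [bN bP _ _ _] := jump_mean hnoise Xstate Xadapted (lexx 0) t0 FG0 G0cadlag
  (C i) b j k ip.
rewrite /jump_at !jump_strip //; split.
  apply: (jump_split (nu := N i w) Gw s0 (ltW st) (jump_box_N hnoise 0 t (C i) ip w)).
    exact: (bf_meas bN Gw).
  by move=> z; exact: (bf_le bN Gw).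
apply: (jump_split (nu := @plane_measure R) Gw s0 (ltW st) (jump_box_P t0 (C i))).
  exact: (bf_meas bP Gw).
by move=> z; exact: (bf_le bP Gw).
Qed.

Let Xform w t : G0 w -> 0 <= t -> mxpart b j k (X t w) =
  mxpart b j k rho0 + \int[mu]_(u in `]0, t]) drift w u +
  \sum_(i < n.+1 | (i <= p)%N) mxpart b j k (Ito i t w) +
  \sum_(i < n.+1 | (p < i)%N) (jump_at i w t (N i w) - jump_at i w t (@plane_measure R)).
Proof.
move=> Gw t0; rewrite (G0eq Gw t0).
have r := @mxpart_rlin R d b j k; rewrite !(rlinD _ _ r) !(rlin_sum _ _ _ r).
rewrite /mxint mxpart_of; congr (_ + _); apply: eq_bigr => i ip.
by rewrite (rlinB _ _ r) !mxpart_of.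
Qed.

Definition noise_incr s t (i : 'I_n.+1) w : R :=
  if (i <= p)%N then mxpart b j k (Ito i t w) - mxpart b j k (Ito i s w)
  else \int[N i w]_(z in pcell 0 (K i) s t) jump i w z -
    \int[@plane_measure R]_(z in pcell 0 (K i) s t) jump i w z.

Lemma X_increment w s t : G0 w -> 0 <= s -> s < t ->
  mxpart b j k (X t w) - mxpart b j k (X s w) =
  \int[mu]_(u in `]s, t]) drift w u + \sum_i noise_incr s t i w.
Proof.
move=> Gw s0 st; have t0 := le_trans s0 (ltW st).
rewrite (Xform Gw t0) (Xform Gw s0) (drift_split Gw s0 (ltW st)).
rewrite [X in _ = _ + X](bigID (fun i : 'I_n.+1 => (i <= p)%N)) /=.
rewrite [X in _ = _ + (X + _)](_ : _ = \sum_(i < n.+1 | (i <= p)%N) mxpart b j k (Ito i t w) -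
  \sum_(i < n.+1 | (i <= p)%N) mxpart b j k (Ito i s w)); last first.
  by rewrite -sumrB; apply: eq_bigr => i ip; rewrite /noise_incr ip.
rewrite [X in _ = _ + (_ + X)](_ : _ =
  \sum_(i < n.+1 | (p < i)%N) (jump_at i w t (N i w) - jump_at i w t (@plane_measure R)) -
  \sum_(i < n.+1 | (p < i)%N) (jump_at i w s (N i w) - jump_at i w s (@plane_measure R))).
  by ring.
rewrite -sumrB; apply: eq_big => [i|i]; rewrite -ltnNge // => ip.
have [-> ->] := jump_incr ip Gw s0 st.
by rewrite /noise_incr leqNgt ip /=; ring.
Qed.

Lemma noise_incr_mean s t A (i : 'I_n.+1) : 0 <= s -> s < t -> F s A -> A `<=` G0 ->
  P.-integrable A (EFin \o noise_incr s t i) /\ \int[P]_(w in A) noise_incr s t i w = 0.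
Proof.
move=> s0 st FA AG; have t0 := le_trans s0 (ltW st).
have mA : measurable A := filt_meas hnoise s0 FA.
rewrite /noise_incr; case: (boolP (i <= p)%N) => ip.
  have [Ii _ Im] := ito_mean hnoise ip (Itoint ip b j k).
  have IA u : 0 <= u -> P.-integrable A (EFin \o (fun w => mxpart b j k (Ito i u w))).
    by move=> u0; apply: (integrableS measurableT) => //; exact: Ii.
  split; first by have := integrableB mA (IA t t0) (IA s s0); apply: eq_integrable.
  rewrite RintegralB //; [|exact: IA..].
  by rewrite (Im s t A s0 (ltW st) FA) subrr.
rewrite -ltnNge in ip.
have [_ _ iN iP e] := jump_mean hnoise Xstate Xadapted s0 st FA
  (fun w Aw => G0cadlag (AG w Aw)) (C i) b j k ip.
split; first by have := integrableB mA iN iP; apply: eq_integrable.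
by rewrite RintegralB // e subrr.
Qed.

Lemma mean_increment s t A : 0 <= s -> s < t -> F s A -> A `<=` G0 ->
  \int[P]_(w in A) mxpart b j k (X t w) - \int[P]_(w in A) mxpart b j k (X s w) =
  \int[P]_(w in A) \int[mu]_(u in `]s, t]) drift w u.
Proof.
move=> s0 st FA AG; have t0 := le_trans s0 (ltW st).
have mA : measurable A := filt_meas hnoise s0 FA.
rewrite -RintegralB //; [|exact: Xpart_integrable..].
rewrite (eq_Rintegral _ _ (g := fun w => \int[mu]_(u in `]s, t]) drift w u +
  \sum_i noise_incr s t i w)); last first.
  by move=> w /set_mem Aw; rewrite X_increment //; exact: AG.
have [_ di _] := drift_mean hnoise Xstate Xadapted s0 st FA
  (fun w Aw => G0cadlag (AG w Aw)) (L_rlin b j k) (@Lbound_state b j k) Lbound_ge0.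
have [ni ne] := Rintegral_sum (index_enum 'I_n.+1) mA
  (fun i => (noise_incr_mean i s0 st FA AG).1).
rewrite RintegralD // ne big1 ?addr0 // => i _.
exact: (noise_incr_mean i s0 st FA AG).2.
Qed.

(** At time 0 the equation still contains the values of the Ito integrals; they are removed by their
    vanishing mean on events of [F 0]. *)
Lemma mean_start A : F 0 A -> A `<=` G0 ->
  \int[P]_(w in A) mxpart b j k (X 0 w) = mxpart b j k rho0 * fine (P A).
Proof.
move=> FA AG; have mA : measurable A := filt_meas hnoise (lexx 0) FA.
have e w : G0 w -> mxpart b j k (X 0 w) = mxpart b j k rho0 +
    \sum_(i < n.+1 | (i <= p)%N) mxpart b j k (Ito i 0 w).
  move=> Gw; rewrite (Xform Gw (lexx 0)) set_itvoc0 Rintegral_set0 addr0.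
  rewrite [X in _ + X]big1 ?addr0 // => i ip; rewrite /jump_at.
  rewrite (_ : [set z : plane R | _] = set0) ?Rintegral_set0 ?subrr //.
  apply/seteqP; split => // z /= /andP[z0 z1].
  by have := lt_le_trans z0 z1; rewrite ltxx.
rewrite (eq_Rintegral _ _ (g := fun w => mxpart b j k rho0 +
  \sum_(i < n.+1 | (i <= p)%N) mxpart b j k (Ito i 0 w))); last first.
  by move=> w /set_mem /AG; exact: e.
pose J (i : 'I_n.+1) w : R := if (i <= p)%N then mxpart b j k (Ito i 0 w) else 0.
have JP i : P.-integrable A (EFin \o J i) /\ \int[P]_(w in A) J i w = 0.
  rewrite /J; case: (boolP (i <= p)%N) => ip; last first.
    by split; [exact: integrable0|rewrite /Rintegral integral0].
  have [Ii I0 _] := ito_mean hnoise ip (Itoint ip b j k).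
  split; last exact: I0.
  by apply: (integrableS measurableT) => //; exact: Ii.
have [Ji Je] := Rintegral_sum (index_enum 'I_n.+1) mA (fun i => (JP i).1).
under eq_Rintegral do rewrite big_mkcond.
rewrite (@RintegralD _ _ _ P A (cst (mxpart b j k rho0)) (fun w => \sum_i J i w)) //.
  rewrite Je big1 ?addr0; last by move=> i _; exact: (JP i).2.
  by rewrite Rintegral_cst.
by apply: (integrableS measurableT) => //; exact: finite_measure_integrable_cst.
Qed.

End Increments.
End Solution.

Section MeanEvolution.
Context {R : realType} {dO : measure_display} {Om : measurableType dO}.
Variable P : probability Om R.
Context {d n : nat} {p : nat}.
Variables (W : 'I_n.+1 -> R -> Om -> R)
  (N : 'I_n.+1 -> Om -> {measure set (plane R) -> \bar R}).
Variable F : R -> set (set Om).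
Hypothesis hnoise : sme_noise P p W N F.
Variables (H : 'M[R[i]]_d) (C : 'I_n.+1 -> 'M[R[i]]_d).
Variables (rho0 : 'M[R[i]]_d) (X : R -> Om -> 'M[R[i]]_d).
Hypothesis sol : sme_solution P p W N H C F rho0 X.

Let L := Lindblad H C.
Let B := Lbound H C.
Let B0 : 0 <= B := Lbound_ge0 H C.
Let Xstate t w : 0 <= t -> state (X t w). Proof. exact: (sol_state sol). Qed.
Let Xadapted b j k : adapted F (fun t w => mxpart b j k (X t w)).
Proof. exact: (sol_adapted sol). Qed.
Let mu : {measure set (measurableTypeR R) -> \bar R} := @lebesgue_measure R.

(** Completeness places the full-measure set of regular paths in [F 0], so that a past event
    intersected with it is again a past event. *)
Lemma good_set : exists (G0 : set Om) (Ito : 'I_n.+1 -> R -> Om -> 'M[R[i]]_d),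
  [/\ F 0 G0, P (~` G0) = 0%E, forall w, G0 w -> cadlag (X ^~ w),
    forall w, G0 w -> forall t, 0 <= t -> sme_equation p N H C rho0 X Ito w t &
    forall i : 'I_n.+1, (i <= p)%N -> forall b j k,
      is_ito_integral P F (W i)
       (fun s w => mxpart b j k (Gop (C i) (left_lim (X ^~ w) s)))
       (fun t w => mxpart b j k (Ito i t w))].
Proof.
have [Ito [II Ieq]] := sol_eq sol.
pose G0 := [set w | cadlag (X ^~ w) /\ forall t, 0 <= t -> sme_equation p N H C rho0 X Ito w t].
have NG : P.-negligible (~` G0) by exact: (filterI (sol_cadlag sol) Ieq).
have u := noise_usual hnoise.
have [_ FC _] := filt_sigma u (lexx 0).
exists G0, Ito; split => //.
- by rewrite -(setCK G0) -setTD; apply: FC; exact: (filt_complete u NG).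
- apply: measure_negligible => //; exact: (noise_complete hnoise NG).
- by move=> w [].
- by move=> w [].
Qed.

Lemma mean_good A t (g : 'M[R[i]]_d -> R) (G0 : set Om) : rlin g -> 0 <= t ->
  measurable A -> measurable G0 -> P (~` G0) = 0%E ->
  \int[P]_(w in A) g (X t w) = \int[P]_(w in A `&` G0) g (X t w).
Proof.
move=> gl t0 mA mG PG; apply: Rintegral_full_set => //.
exact: (rlin_mean_on hnoise sol gl t0 mA).1.
Qed.

Lemma mean_on_good A t (G0 : set Om) : 0 <= t ->
  measurable A -> measurable G0 -> P (~` G0) = 0%E ->
  mean_on P X A t = mean_on P X (A `&` G0) t.
Proof.
move=> t0 mA mG PG; apply: mxpart_inj => b j k; rewrite !mxpart_of.
exact: mean_good (mxpart_rlin b j k) t0 mA mG PG.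
Qed.

Lemma mean_on_start : mean_on P X setT 0 = rho0.
Proof.
have [G0 [Ito [FG PG Gc Ge Gi]]] := good_set.
have mG : measurable G0 := filt_meas hnoise (lexx 0) FG.
rewrite (mean_on_good (lexx 0) measurableT mG PG) setTI.
apply: mxpart_inj => b j k; rewrite mxpart_of.
rewrite (mean_start hnoise Ge Gi b j k FG) //.
have := probDI P measurableT mG; rewrite setTI setTD PG add0e probability_setT => <-.
by rewrite mulr1.
Qed.

Lemma prob_le1_fine (A : set Om) : measurable A -> fine (P A) <= 1.
Proof.
move=> mA; rewrite -lee_fin fineK ?fin_num_measure //; exact: probability_le1.
Qed.

Lemma mean_first_order s t A b j k : 0 <= s -> s <= t -> F s A ->
  `|mxpart b j k (mean_on P X A t) - mxpart b j k (mean_on P X A s)| <= B * (t - s).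
Proof.
move=> s0; rewrite le_eqVlt => /predU1P[<- _|st FA]; first by rewrite !subrr mulr0 normr0.
have t0 := le_trans s0 (ltW st).
have [G0 [Ito [FG PG Gc Ge Gi]]] := good_set.
have mG : measurable G0 := filt_meas hnoise (lexx 0) FG.
have mA : measurable A := filt_meas hnoise s0 FA.
rewrite !(mean_on_good _ mA mG PG) // !mxpart_of.
have FAG : F s (A `&` G0).
  by apply: (filt_setI hnoise s0) => //; apply: (filt_mono (noise_usual hnoise) (lexx 0) s0).
have mAG := filt_meas hnoise s0 FAG.
rewrite (mean_increment hnoise sol FG Gc Ge Gi b j k s0 st FAG) //.
have AGc w : (A `&` G0) w -> cadlag (X ^~ w) by move=> [_ /Gc].
have [bf di _] := drift_mean hnoise Xstate Xadapted s0 st FAG AGc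
  (L_rlin H C b j k) (@Lbound_state R d n H C b j k) B0.
have Dst : mu [set` `]s, t]] = (t - s)%:E.
  transitivity (@lebesgue_measure R `]s, t]) => //.
  by rewrite lebesgue_measure_itv /= lte_fin st.
have [c Pc] : exists c, P (A `&` G0) = c%:E.
  by exists (fine (P (A `&` G0))); rewrite fineK // fin_num_measure.
have Bts : 0 <= B * (t - s) by rewrite mulr_ge0 // subr_ge0 ltW.
apply: le_trans (Rintegral_le_bound (M := B * (t - s)) mAG Pc _ _) _.
- exact: bf_int_meas bf.
- move=> w AGw; apply: (Rintegral_le_bound (mu := mu) _ Dst) => //.
    exact: bf_meas bf _ AGw.
  by move=> u; exact: bf_le bf _ _ AGw.
- rewrite ler_piMr //; have := prob_le1_fine mAG; by rewrite Pc.
Qed.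

(** The integrated drift is compared with the drift frozen at [s]. By [mean_first_order] the mean
    moves by at most [B * (t - s)] on the interval, the operator contributes another [B], and
    integration the second factor [t - s]. *)
Lemma mean_step s t A b j k : 0 <= s -> s <= t -> F s A ->
  `|mxpart b j k (mean_on P X A t) - mxpart b j k (mean_on P X A s) -
    (t - s) * mxpart b j k (L (mean_on P X A s))| <= B ^+ 2 * (t - s) ^+ 2.
Proof.
move=> s0; rewrite le_eqVlt => /predU1P[<- _|st FA].
  by rewrite !subrr mul0r subrr normr0 expr0n mulr0.
have t0 := le_trans s0 (ltW st).
have [G0 [Ito [FG PG Gc Ge Gi]]] := good_set.
have mG : measurable G0 := filt_meas hnoise (lexx 0) FG.
have mA : measurable A := filt_meas hnoise s0 FA.
rewrite !(mean_on_good _ mA mG PG) // !mxpart_of.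
have FAG : F s (A `&` G0).
  by apply: (filt_setI hnoise s0) => //; apply: (filt_mono (noise_usual hnoise) (lexx 0) s0).
have mAG := filt_meas hnoise s0 FAG.
have AGc w : (A `&` G0) w -> cadlag (X ^~ w) by move=> [_ /Gc].
pose l := mxpart b j k (L (mean_on P X (A `&` G0) s)).
pose S m := \sum_(k0 < m.+1) (\int[P]_(w in A `&` G0)
  mxpart b j k (L (X (gpt s t m k0) w))) * ((t - s) / m.+1%:R).
(* The double integral is available as the limit of the sums [S m], so the bound is proved for each
   sum. *)
suff key (I : R) : S m @[m --> \oo] --> I -> `|I - (t - s) * l| <= B ^+ 2 * (t - s) ^+ 2.
  rewrite (mean_increment hnoise sol FG Gc Ge Gi b j k s0 st FAG) //; apply: key.
  have [_ _] := drift_mean hnoise Xstate Xadapted s0 st FAG AGc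
    (L_rlin H C b j k) (@Lbound_state R d n H C b j k) B0.
  exact.
move=> cv1.
have cv2 : `|S m - (t - s) * l| @[m --> \oo] --> `|I - (t - s) * l|.
  by apply: cvg_norm; apply: cvgB; [exact: cv1|exact: cvg_cst].
apply: (cvgr_to_le cv2); apply: nearW => m; rewrite /S.
have -> : (t - s) * l = \sum_(k0 < m.+1) l * ((t - s) / m.+1%:R).
  by rewrite sumr_const card_ord -[RHS]mulr_natr -[RHS]mulrA divfK ?pnatr_eq0 // mulrC.
rewrite /= -sumrB; apply: le_trans (ler_norm_sum _ _ _) _.
apply: (@le_trans _ _ (\sum_(k0 < m.+1) (B ^+ 2 * (t - s)) * ((t - s) / m.+1%:R))); last first.
  rewrite sumr_const card_ord -[leLHS]mulr_natr -[leLHS]mulrA divfK ?pnatr_eq0 //.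
  by rewrite -mulrA -expr2.
apply: ler_sum => k0 _; rewrite -mulrBl normrM [X in _ * X <= _]ger0_norm; last first.
  by rewrite divr_ge0 // subr_ge0 ltW.
rewrite ler_wpM2r //; first by rewrite divr_ge0 // subr_ge0 ltW.
have sg : s <= gpt s t m k0 by rewrite -{1}(gpt0 s t m) gpt_le // ltW.
have gt : gpt s t m k0 <= t by have := gpt_le m (ltW st) (ltnW (ltn_ord k0)); rewrite gptS.
rewrite (rlin_mean_on hnoise sol (L_rlin H C b j k) (le_trans s0 sg) mAG).2 /l.
rewrite -(rlinB _ _ (L_rlin H C b j k)) expr2 -mulrA.
apply: Lbound_le; last by rewrite mulr_ge0 // subr_ge0 ltW.
move=> b' j' k'; rewrite (rlinB _ _ (mxpart_rlin b' j' k')).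
apply: le_trans (mean_first_order b' j' k' s0 sg FAG) _.
by rewrite ler_wpM2l // lerD2r.
Qed.

End MeanEvolution.

(** * Maximal inequality and almost sure decay *)

Lemma rlinN {R : realType} {d : nat} (g : 'M[R[i]]_d -> R) : rlin g -> rlin (fun M => - g M).
Proof. by move=> gl a M M'; rewrite gl mulrN opprD. Qed.

Section Supermartingale.
Context {R : realType} {dO : measure_display} {Om : measurableType dO}.
Variable P : probability Om R.
Context {d n : nat} {p : nat}.
Variables (W : 'I_n.+1 -> R -> Om -> R)
  (N : 'I_n.+1 -> Om -> {measure set (plane R) -> \bar R}).
Variable F : R -> set (set Om).
Hypothesis hnoise : sme_noise P p W N F.
Variables (H : 'M[R[i]]_d) (C : 'I_n.+1 -> 'M[R[i]]_d).
Variables (rho0 : 'M[R[i]]_d) (X : R -> Om -> 'M[R[i]]_d).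
Hypothesis sol : sme_solution P p W N H C F rho0 X.

Let Xstate t w : 0 <= t -> state (X t w). Proof. exact: (sol_state sol). Qed.
Let Xadapted b j k : adapted F (fun t w => mxpart b j k (X t w)).
Proof. exact: (sol_adapted sol). Qed.

Variables (u : 'M[R[i]]_d -> R).
Hypothesis ul : rlin u.
Hypothesis uL : forall rho, state rho -> u (Lindblad H C rho) <= 0.
Hypothesis u0 : forall rho, state rho -> 0 <= u rho.

Let uLl : rlin (fun M => u (Lindblad H C M)).
Proof. by move=> a M M'; rewrite Lindblad_linear ul. Qed.

Let ui t (A : set Om) : 0 <= t -> measurable A ->
  P.-integrable A (EFin \o (fun w => u (X t w))).
Proof. by move=> t0 mA; exact: (rlin_mean_on hnoise sol ul t0 mA).1. Qed.

(** The drift of [u] is nonpositive on states, hence on their integral over [A], and [mean_step]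
    supplies the quadratic error for [quad_nonincreasing]. The event stays fixed in [F r] while the
    times vary beyond [r]. *)
Lemma supermartingale r s t A : 0 <= r -> F r A -> r <= s -> s <= t ->
  \int[P]_(w in A) u (X t w) <= \int[P]_(w in A) u (X s w).
Proof.
move=> r0 FA; pose k := rlin_bound u * Lbound H C ^+ 2.
have mA : measurable A := filt_meas hnoise r0 FA.
apply: (quad_nonincreasing (k := k) (g := fun t => \int[P]_(w in A) u (X t w))).
move=> {}s {}t rs st; have s0 := le_trans r0 rs; have t0 := le_trans s0 st.
have FsA : F s A by exact: (filt_mono (noise_usual hnoise) r0 rs).
rewrite (rlin_mean_on hnoise sol ul t0 mA).2 (rlin_mean_on hnoise sol ul s0 mA).2.
set mt := mean_on P X A t; set ms := mean_on P X A s.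
have uLms : u (Lindblad H C ms) <= 0.
  have oL : rlin (fun M => - u (Lindblad H C M)).
    exact: rlinN uLl.
  rewrite -oppr_ge0 -(rlin_mean_on hnoise sol oL s0 mA).2.
  by apply: Rintegral_ge0 => w _; rewrite oppr_ge0; apply/uL/Xstate.
apply: (@le_trans _ _ (u mt - u ms - (t - s) * u (Lindblad H C ms))).
  rewrite lerDl oppr_ge0 mulr_ge0_le0 // subr_ge0 //.
rewrite -(rlinZ _ _ ul) -!(rlinB _ _ ul) /k -mulrA.
apply: le_trans (ler_norm _) _; apply: rlin_le => // b j k'.
have r' := @mxpart_rlin R d b j k'.
rewrite (rlinB _ _ r') (rlinB _ _ r') (rlinZ _ _ r').
exact: (mean_step hnoise sol).
Qed.

Lemma level_filt t lam : 0 <= t -> F t [set w | u (X t w) <= lam].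
Proof.
move=> t0; rewrite -(sigmaF hnoise t0).
have mu : measurable_fun setT ((fun w => u (X t w)) : g_sigma_algebraType (F t) -> R).
  apply: (measurable_rlin (T := g_sigma_algebraType (F t)) (X := X t) ul) => b j k.
  exact: (Xpart_measF Xadapted b j k t0).
have := mu measurableT `]-oo, lam]%classic (measurable_itv _); rewrite setTI.
rewrite (_ : _ @^-1` _ = [set w | u (X t w) <= lam]) //.
Qed.

Section Maximal.
Variables (tau : nat -> R) (lam : R).
Hypothesis tau0 : 0 <= tau 0.
Hypothesis tau_nd : forall k l, (k <= l)%N -> tau k <= tau l.

(** The [k] times involved have indices [0] to [k.-1], so [below k.+1] is decided at time
    [tau k]. *)
Let below k : set Om := [set w | forall l, (l < k)%N -> u (X (tau l) w) <= lam].

Let tau_ge0 k : 0 <= tau k. Proof. exact: le_trans tau0 (tau_nd (leq0n k)). Qed.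

Let belowS k : below k.+1 = below k `&` [set w | u (X (tau k) w) <= lam].
Proof.
apply/seteqP; split => w /= => [h|[h hk] l]; first by split => [l lk|]; apply: h => //; exact: ltnW.
by rewrite ltnS leq_eqVlt => /predU1P[->//|]; exact: h.
Qed.

Let below_filt k : F (tau k) (below k.+1).
Proof.
elim: k => [|k ih]; rewrite belowS; apply: (filt_setI hnoise (tau_ge0 _)); try exact: level_filt.
  rewrite (_ : below 0 = setT); first exact: (filtT hnoise).
  by apply/seteqP; split.
exact: (filt_mono (noise_usual hnoise) (tau_ge0 k) (tau_nd (leqnSn k))).
Qed.

Lemma measurable_below k : measurable (below k).
Proof.
case: k => [|k]; last exact: (filt_meas hnoise (tau_ge0 k)).
by rewrite (_ : below 0 = setT) //; apply/seteqP; split.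
Qed.
Let mbelow := measurable_below.

(** Optional stopping by hand: paths that first exceed [lam] at [tau k] exchange their integral for
    [lam] times their probability, and the others move on to the next time by the supermartingale
    property. *)
Lemma discrete_maximal k :
  lam * fine (P (~` below k)) + \int[P]_(w in below k) u (X (tau k) w) <=
  u (mean_on P X setT (tau 0)).
Proof.
elim: k => [|k ih].
  rewrite (_ : below 0 = setT); last by apply/seteqP; split.
  rewrite setCT measure0 mulr0 add0r.
  by rewrite (rlin_mean_on hnoise sol ul (tau_ge0 0) measurableT).2.
apply: le_trans ih; pose E := below k `\` below k.+1.
have mE : measurable E by exact: measurableD.
have kS : below k = below k.+1 `|` E.
  by rewrite /E belowS setDIr setDv set0U setUIDK.
have PS : P (~` below k.+1) = (P (~` below k) + P E)%E.
  rewrite (_ : ~` below k.+1 = ~` below k `|` E); last first.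
    apply/seteqP; split => w; first by have [|] := pselect (below k w); [right|left].
    by case=> [nk|[]//]; rewrite belowS => -[].
  rewrite measureU //; first exact: measurableC.
  by apply/seteqP; split => // w [/= nk []].
have disj : [disjoint below k.+1 & E] by apply/disj_setPS => w [? []].
rewrite [X in _ <= _ + X](_ : _ = \int[P]_(w in below k.+1) u (X (tau k) w) +
  \int[P]_(w in E) u (X (tau k) w)); last first.
  by rewrite {1}kS Rintegral_setU // -kS; exact: ui.
rewrite PS fineD ?fin_num_measure //; last exact: measurableC.
have lE : lam * fine (P E) <= \int[P]_(w in E) u (X (tau k) w).
  rewrite -Rintegral_cst //; apply: le_Rintegral => //.
  - by apply: (integrableS measurableT) => //; exact: finite_measure_integrable_cst.
  - exact: ui.
  - move=> w []; rewrite belowS => wk /not_andP[//|/negP]; rewrite -ltNge => /ltW.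
    exact.
have sE := supermartingale (tau_ge0 k) (below_filt k) (lexx _) (tau_nd (leqnSn k)).
by rewrite mulrDr -!addrA lerD2l addrC lerD.
Qed.

Lemma discrete_maximal_prob k :
  lam * fine (P (~` below k)) <= u (mean_on P X setT (tau 0)).
Proof.
apply: le_trans (discrete_maximal k); rewrite lerDl.
by apply: Rintegral_ge0 => w _; apply/u0/Xstate.
Qed.

End Maximal.

(** [bad] is the lower limit of the events that the level is exceeded on the grid of index [m], so
    the bound common to all grids holds for it. By right continuity a value above [lam] persists for
    a while and is seen by every fine grid. *)
Lemma cadlag_maximal (G0 : set Om) (a b lam : R) : (forall w, G0 w -> cadlag (X ^~ w)) ->
  0 <= a -> a < b -> 0 <= lam ->
  exists bad, [/\ measurable bad, lam * fine (P bad) <= u (mean_on P X setT a) &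
    forall w, G0 w -> ~ bad w -> forall t : R, a <= t -> t <= b -> u (X t w) <= lam].
Proof.
move=> Gc a0 ab lam0.
(* A grid with [m.+1] steps has [m.+2] points. *)
pose E m : set Om := ~` [set w | forall l, (l < m.+2)%N -> u (X (gpt a b m l) w) <= lam].
have g0 m : 0 <= gpt a b m 0 by rewrite gpt0.
have gnd m := fun k l => @gpt_le R a b m k l (ltW ab).
have mE m : measurable (E m) by apply: measurableC; exact: (measurable_below lam (g0 m) (gnd m)).
pose B M := \bigcap_(m in [set m | (M <= m)%N]) E m.
have mB M : measurable (B M) by apply: bigcap_measurable => [|m _]; [exists M; exact: leqnn|exact: mE].
have mbad : measurable (\bigcup_M B M) by apply: bigcup_measurable.
exists (\bigcup_M B M); split => //.
  have Bc : P \o B @ \oo --> P (\bigcup_M B M).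
    apply: nondecreasing_cvg_mu => // k l kl; apply/subsetPset => w Bw m /= lm; apply: Bw => /=.
    exact: leq_trans lm.
  have {}Bc : fine (P (B M)) @[M --> \oo] --> fine (P (\bigcup_M B M)).
    by apply: fine_cvg; rewrite fineK ?fin_num_measure.
  apply: (cvgr_to_le (f := fun M => lam * fine (P (B M))) (F := \oo)); first by apply: cvgMl_tmp; exact: Bc.
  apply: nearW => M /=.
  apply: (@le_trans _ _ (lam * fine (P (E M)))).
    rewrite ler_wpM2l // fine_le ?fin_num_measure //.
    by apply: le_measure; rewrite ?inE // => w; apply; exact: leqnn.
  by have := discrete_maximal_prob lam (g0 M) (gnd M) M.+2; rewrite gpt0.
move=> w Gw nbad t at_ tb; rewrite leNgt; apply/negP => lt; apply: nbad.
move: at_; rewrite le_eqVlt => /predU1P[ta|at_].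
  exists 0 => // m _ h; have := h 0 isT; rewrite gpt0 ta leNgt lt; exact.
have tp : 0 <= t by exact: le_trans (ltW at_).
have uc : u (X v w) @[v --> t^'+] --> u (X t w).
  by apply: rlin_cvg => // b' j k; have [h _] := Gc w Gw b' j k; exact: h.
have [e /= e0 he] := cvgr_gt _ uc _ lt.
have [M _ hM] : \forall m \near \oo, (b - a) / m.+1%:R < e.
  exact: (cvgr_lt _ (cvg_c_divS _)).
exists M => // m /= Mm h.
(* The first grid point at or after [t] lies within one mesh of it, where the value still exceeds
   [lam]. *)
have [k km] := gcell_ex m at_ tb; rewrite /gcell /= in_itv /= => /andP[k1 k2].
have := h k.+1 km; rewrite leNgt => /negP; apply.
move: k2; rewrite le_eqVlt => /predU1P[<-//|k2]; apply: he => //=.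
rewrite ltr0_norm ?subr_lt0 // opprB; apply: le_lt_trans (hM m Mm).
by rewrite -(gpt_step a b m k) lerB //; exact: ltW.
Qed.

Lemma as_geometric_decay (T c : R) : 0 < T ->
  (forall j, u (mean_on P X setT (j%:R * T)) <= c * 2^-1 ^+ j) ->
  {ae P, forall w, exists J : nat, forall (j : nat) (t : R), (J <= j)%N ->
    j%:R * T <= t -> t <= j.+1%:R * T -> u (X t w) <= (3 / 4) ^+ j}.
Proof.
move=> T0 uc; have [G0 [Ito [FG PG Gc _ _]]] := good_set hnoise sol.
have mG : measurable G0 := filt_meas hnoise (lexx 0) FG.
have q0 j : 0 <= (3 / 4) ^+ j :> R by apply: exprn_ge0; lra.
have jT j : 0 <= j%:R * T by rewrite mulr_ge0 // ltW.
have jTS j : j%:R * T < j.+1%:R * T by rewrite ltr_pM2r // ltr_nat.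
have [bad badP] := choice (fun j => cadlag_maximal Gc (jT j) (jTS j) (q0 j)).
have mbad j : measurable (bad j) by have [] := badP j.
(* Dividing the mean bound [c * 2^-1 ^+ j] by the level [(3 / 4) ^+ j] leaves the summable ratio
   [2 / 3]; the sum is at most [3 * c]. *)
have Pbad j : (P (bad j) <= (c * (2 / 3) ^+ j)%:E)%E.
  have [_ h _] := badP j.
  rewrite -[P _]fineK ?fin_num_measure // lee_fin.
  have q1 : 0 < (3 / 4) ^+ j :> R by apply: exprn_gt0; lra.
  rewrite -(ler_pM2l q1); apply: (le_trans h); apply: le_trans (uc j) _.
  rewrite mulrCA -exprMn (_ : 3 / 4 * (2 / 3) = 2^-1) //; lra.
have P0 : P (lim_sup_set bad) = 0%E.
  apply: lim_sup_set_cvg0 => //; apply: (@le_lt_trans _ _ (3 * c)%:E); last exact: ltry.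
  apply: lime_le; first by apply: is_cvg_nneseries => ? _ _; exact: measure_ge0.
  apply: nearW => k.
  have : (\sum_(0 <= j < k) P (bad j) <= (3 * c * (1 - (2 / 3) ^+ k))%:E)%E.
    elim: k => [|k ih]; first by rewrite big_nil expr0 subrr mulr0.
    rewrite big_nat_recr //=; apply: (le_trans (leeD ih (Pbad k))).
    by rewrite -EFinD lee_fin exprS; lra.
  move=> h; apply: (le_trans h); rewrite lee_fin.
  have c0 : 0 <= c by have := le_trans (measure_ge0 P (bad 0)) (Pbad 0); rewrite lee_fin expr0 mulr1.
  rewrite ler_piMr ?mulr_ge0 // gerBl exprn_ge0 //; lra.
have mls : measurable (lim_sup_set bad).
  by apply: bigcap_measurable => [|k _]; [exists 0|apply: bigcup_measurable => // j _; exact: mbad].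
have N1 : P.-negligible (~` G0) by apply/negligibleP => //; exact: measurableC.
have N2 : P.-negligible (lim_sup_set bad) by exact/negligibleP.
apply: negligibleS (negligibleU N1 N2) => w /= nw.
have [Gw|] := pselect (G0 w); [right|by left] => J _ /=.
apply: contrapT => nb; apply: nw; exists J => j t Jj jt tj.
have [_ _ h] := badP j; apply: h => // bj; apply: nb.
by exists j.
Qed.

End Supermartingale.

(** * Exponential rates *)

(** The decay [ln (4 / 3) / T] loses a factor 2 because the bound is on the square, and another 2
    because half of it is spent on absorbing the constants. *)
Lemma exp_rate_geometric {R : realType} (v : R -> R) (K T : R) (J : nat) : 0 < T ->
  (forall (j : nat) (t : R), (J <= j)%N -> j%:R * T <= t -> t <= j.+1%:R * T ->
    v t ^+ 2 <= K * (3 / 4) ^+ j) ->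
  (exp_rate v <= (- (ln (4 / 3) / (4 * T)))%:E)%E.
Proof.
move=> T0 vK; set l := ln _.
have l0 : 0 < l by apply: ln_gt0; lra.
(* [k] collects the constant of the bound, made positive for the logarithm, and one extra [l], as
   [j] may be nearly as small as [t / T - 1]. Beyond [t0] half of the decay [t / T * l] exceeds
   [k]. *)
pose k := ln (`|K| + 1) + l.
pose t0 := Num.max 1 (Num.max (J%:R * T) (2 * T * k / l)).
rewrite /exp_rate limf_esupE; apply: (@le_trans _ _
  (ereal_sup ((fun t : R => (t^-1%:E * lne (v t)%:E)%E) @` [set t | t0 < t]))).
  by apply: ereal_inf_lbound; exists [set t | t0 < t] => //; exists t0; split => //; exact: num_real.
apply: ge_ereal_sup => _ [t /= t0t <-].
move: t0t; rewrite /t0 !gt_max => /and3P[t1 tJ tk].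
have tp : 0 < t by lra.
(* In the first case the logarithm is [-oo], and so is its product with the positive [t^-1]. *)
have [v0|v0] := leP (v t) 0.
  by rewrite gt0_muleNy ?lte_fin ?invr_gt0 ?leNye.
rewrite -EFinM lee_fin.
pose j := Num.truncn (t / T).
have tT0 : 0 <= t / T by rewrite divr_ge0 // ltW.
have /andP[j1 j2] : j%:R <= t / T < j.+1%:R by exact: truncn_itv.
have Jj : (J <= j)%N by rewrite truncn_ge_nat // ler_pdivlMr // ltW.
have jt : j%:R * T <= t by rewrite -ler_pdivlMr.
have tj : t <= j.+1%:R * T by rewrite -ler_pdivrMr // ltW.
have K0 : 0 < `|K| + 1 by rewrite ltr_wpDl.
have q0 : 0 < (3 / 4) ^+ j :> R by apply: exprn_gt0; lra.
have h : v t ^+ 2 <= (`|K| + 1) * (3 / 4) ^+ j.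
  apply: (le_trans (vK j t Jj jt tj)); rewrite ler_pM2r //.
  by apply: (le_trans (ler_norm K)); rewrite lerDl.
have : 2 * ln (v t) <= ln (`|K| + 1) - j%:R * l.
  have q : ln (3 / 4 : R) = - l.
    by rewrite /l -lnV ?invf_div // posrE; lra.
  have : ln (v t ^+ 2) <= ln ((`|K| + 1) * (3 / 4) ^+ j).
    by rewrite ler_ln ?posrE // ?exprn_gt0 // mulr_gt0.
  rewrite lnXn // lnM ?posrE // lnXn; last lra.
  by rewrite q mulNrn -[l *+ j]mulr_natl -[ln (v t) *+ 2]mulr_natl.
move=> h2.
have h3 : 2 * ln (v t) <= k - t / T * l.
  apply: (le_trans h2); move: j2; rewrite /k -natr1 => j2.
  have := ler_wpM2r (ltW l0) (ltW j2); rewrite mulrDl mul1r; lra.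
have h4 : k <= t / T * l / 2.
  move: tk; rewrite ltr_pdivrMr // => tk.
  have T2 : 0 < 2 * T by lra.
  rewrite -(ler_pM2l T2).
  have -> : 2 * T * (t / T * l / 2) = t * l by field; rewrite gt_eqF.
  exact: ltW.
rewrite ler_pdivrMl //.
rewrite (_ : _ * - _ = - (t / T * l / 4)); first lra.
by field; rewrite gt_eqF.
Qed.

(** * From GAS to exponential rates *)

Section Main.
Context {R : realType} {dO : measure_display} {Om : measurableType dO}.
Variable P : probability Om R.
Context {d n : nat} {p : nat}.
Variables (W : 'I_n.+1 -> R -> Om -> R)
  (N : 'I_n.+1 -> Om -> {measure set (plane R) -> \bar R}).
Variable F : R -> set (set Om).
Hypothesis hnoise : sme_noise P p W N F.
Variables (H : 'M[R[i]]_d) (C : 'I_n.+1 -> 'M[R[i]]_d).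

Lemma mean_stateE (X : R -> Om -> 'M[R[i]]_d) t : mean_state P X t = mean_on P X setT t.
Proof.
apply: mxpart_inj => b j k; rewrite !mxpart_of unlock.
by [].
Qed.

Section OneSolution.
Variables (rho0 : 'M[R[i]]_d) (X : R -> Om -> 'M[R[i]]_d).
Hypothesis sol : sme_solution P p W N H C F rho0 X.

Lemma mean_on_state t : 0 <= t -> state (mean_on P X setT t).
Proof.
move=> t0; have Xs w : state (X t w) by exact: (sol_state sol).
have e g : rlin g -> g (mean_on P X setT t) = \int[P]_w g (X t w).
  by move=> gl; rewrite (rlin_mean_on hnoise sol gl t0 measurableT).2.
split.
  apply/psdP => v; have ql := qform_linear v v; split.
    rewrite (e _ (rlin_Im ql)) (eq_Rintegral _ _ (g := cst 0)) ?Rintegral_prob_cst //.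
    by move=> w _; have [/psdP /(_ v) []] := Xs w.
  rewrite (e _ (rlin_Re ql)); apply: Rintegral_ge0 => w _.
  by have [/psdP /(_ v) []] := Xs w.
have tl c M M' : \tr (c *: M + M' : 'M[R[i]]_d) = c * \tr M + \tr M' by rewrite linearP.
apply/eqP; rewrite eq_complex; apply/andP; split; apply/eqP.
  rewrite (e _ (rlin_Re tl)) (eq_Rintegral _ _ (g := cst 1)) ?Rintegral_prob_cst //.
  by move=> w _; rewrite (Xs w).2.
rewrite (e _ (rlin_Im tl)) (eq_Rintegral _ _ (g := cst 0)) ?Rintegral_prob_cst //.
by move=> w _; rewrite (Xs w).2.
Qed.

End OneSolution.

Variables (rho : 'M[R[i]]_d -> R -> Om -> 'M[R[i]]_d).
Hypothesis hsol : forall rho0 : 'M[R[i]]_d, state rho0 ->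
     sme_solution P p W N H C F rho0 (rho rho0).
Variables (HS HR : {vspace 'cV[R[i]]_d}) (PS PR : 'M[R[i]]_d).
Hypotheses (hHR : is_orthocomp HS HR)
  (hPS : is_orthoproj HS PS) (hPR : is_orthoproj HR PR).

Lemma Vfun_cvg (M : R -> 'M[R[i]]_d) :
  hsnorm (M t - PS *m M t *m PS) @[t --> +oo] --> (0 : R) ->
  Vfun PR (M t) @[t --> +oo] --> (0 : R).
Proof.
move=> h; have h' := cvgMl_tmp (a := rlin_bound (Vfun PR)) h; rewrite mulr0 in h'.
apply/norm_cvg0P; apply: (@squeeze_cvgr _ _ _ _ (fun=> 0)
  (fun t => rlin_bound (Vfun PR) * hsnorm (M t - PS *m M t *m PS))).
- by apply: nearW => t; rewrite normr_ge0; exact: (Vfun_hsnorm _ hHR hPS hPR).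
- exact: cvg_cst.
- exact: h'.
Qed.

Lemma gas_mean_cvg : gas_mean P PS rho -> forall rho0, state rho0 ->
  Vfun PR (mean_on P (rho rho0) setT t) @[t --> +oo] --> (0 : R).
Proof.
move=> G rho0 s0.
have <- : mean_state P (rho rho0) = mean_on P (rho rho0) setT.
  by apply/funext => t; exact: mean_stateE.
by apply: Vfun_cvg; exact: G.
Qed.

(** Bounded convergence: [Vfun PR] is bounded on states, and the exceptional null set is removed
    from the domain of integration. *)
Lemma gas_as_cvg : gas_as P PS rho -> forall rho0, state rho0 ->
  Vfun PR (mean_on P (rho rho0) setT t) @[t --> +oo] --> (0 : R).
Proof.
move=> G rho0 s0; have sol := hsol s0; have Vl := Vfun_rlin PR.
have [B [mB PB sB]] := G rho0 s0.
have mD := measurableC mB.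
have Dc w : (~` B) w -> Vfun PR (rho rho0 t w) @[t --> +oo] --> (0 : R).
  by move=> Bw; apply: Vfun_cvg; apply: contrapT => nc; apply: Bw; exact: sB.
have Xi t : 0 <= t -> P.-integrable setT (EFin \o (fun w => Vfun PR (rho rho0 t w))).
  by move=> t0; exact: (rlin_mean_on hnoise sol Vl t0 measurableT).1.
(* The absolute value replaces negative times, at which the process is unconstrained, so that
   dominated convergence applies along an arbitrary sequence tending to infinity. *)
have e t : 0 <= t -> Vfun PR (mean_on P (rho rho0) setT t) =
    \int[P]_(w in ~` B) Vfun PR (rho rho0 `|t| w).
  move=> t0; rewrite -(rlin_mean_on hnoise sol Vl t0 measurableT).2 (ger0_norm t0).
  rewrite (Rintegral_full_set measurableT mD) ?setTI ?setCK //; exact: Xi.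
suff h : \int[P]_(w in ~` B) Vfun PR (rho rho0 `|t| w) @[t --> +oo] --> (0 : R).
  apply: cvg_trans h; apply: near_eq_cvg.
  by apply: filterS (nbhs_pinfty_ge (num_real (0 : R))) => t t0; rewrite e.
apply/cvg_pinftyP => v voo.
have vn : `|v m| @[m --> \oo] --> +oo.
  apply/cvgryPge => A; apply: filterS ((cvgryPge v).1 voo A) => m.
  by move=> /le_trans; apply; exact: ler_norm.
have -> : (0 : R) = \int[P]_(w in ~` B) cst 0 w by rewrite Rintegral_cst // mul0r.
apply: (Rintegral_dominated (g := cst (rlin_bound (Vfun PR) * 1)) mD _ _ _ _).2.
- move=> m; apply: measurable_rlin => // b j k.
  exact: (X_meas hnoise (sol_adapted sol)).
- by move=> w Bw; exact: (cvg_comp (fun m => `|v m|)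
    (fun t => Vfun PR (rho rho0 t w)) vn (Dc w Bw)).
- by apply: (integrableS measurableT) => //; exact: finite_measure_integrable_cst.
- move=> m w _; apply: rlin_le => // b j k; apply: state_mxpart.
  exact: (sol_state sol).
Qed.

Hypothesis hV : forall rho0, state rho0 ->
  Vfun PR (mean_on P (rho rho0) setT t) @[t --> +oo] --> (0 : R).

Lemma state_lyapunov : exists (u : 'M[R[i]]_d -> R) (K c T : R), [/\ 0 < T, rlin u,
    forall sg, state sg -> u (Lindblad H C sg) <= 0 /\ 0 <= u sg,
    forall sg, state sg -> Vfun PR sg ^+ 2 <= K * u sg &
    forall sg (j : nat), state sg ->
      u (mean_on P (rho sg) setT (j%:R * T)) <= c * 2^-1 ^+ j].
Proof.
pose D := #|{: @partidx d}|.
pose xinv (x : 'cV[R]_D) : 'M[R[i]]_d := of_mxpart (fun b j k => x (enum_rank (b, (j, k))) 0).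
have xiK sg : xinv (xi sg) = sg.
  by apply: mxpart_inj => b j k; rewrite mxpart_of mxE enum_rankK.
pose S (x : 'cV[R]_D) := exists2 sg : 'M[R[i]]_d, state sg & x = xi sg.
(* The initial state is read back from its coordinates, since the solutions [rho] are indexed by
   matrices. *)
pose m (x : 'cV[R]_D) t := xi (mean_on P (rho (xinv x)) setT t).
have mS sg t : state sg -> 0 <= t -> S (m (xi sg) t).
  move=> sgs t0; rewrite /m xiK; eexists; last by [].
  exact: (mean_on_state (hsol sgs)).
have Vl := Vfun_rlin PR.
have [] := @lyapunov_functional R D S m (xi_op (Lindblad H C)) (xi_dual (Vfun PR))
  (D%:R * Lbound H C ^+ 2) (D%:R * 1).
- move=> _ s t [sg sgs ->] s0 st; rewrite /m xiK -mulrA; apply: rmxnorm1_le => a.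
  rewrite (xi_opE _ (@Lindblad_linear R d n H C)) !mxE.
  exact: (mean_step hnoise (hsol sgs)) (filtT hnoise s0).
- move=> _ t [sg sgs ->] t0; have [sg' sgs' ->] := mS sg t sgs t0.
  by apply: rmxnorm1_le => a; rewrite mxE; exact: state_mxpart.
- by move=> _ [sg sgs ->]; rewrite /m xiK (mean_on_start hnoise (hsol sgs)).
- move=> phi phi0 _ t [sg sgs ->] t0; exact: (phi0 _ (mS sg t sgs t0)).
- move=> _ t [sg sgs ->] t0; have [sg' sgs' ->] := mS sg t sgs t0.
  rewrite xi_dualE //; apply: (Vfun_ge0 hPR); exact: sgs'.1.
- move=> _ [sg sgs ->]; rewrite /m xiK.
  have -> : (fun t => pairmx (xi_dual (Vfun PR)) (xi (mean_on P (rho sg) setT t))) =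
      (fun t => Vfun PR (mean_on P (rho sg) setT t)).
    by apply/funext => t; rewrite xi_dualE.
  exact: hV.
move=> U [K [c [T [T0 UL U0 UV UT]]]].
exists (fun M => pairmx U (xi M)), K, c, T; split => //.
- exact: pairmx_xi_rlin.
- move=> sg sgs; have Ssg : S (xi sg) by exists sg.
  split; last exact: U0.
  rewrite -(xi_opE _ (@Lindblad_linear R d n H C)) -pairmxA UL // xi_dualE // oppr_le0.
  by apply: (Vfun_ge0 hPR); exact: sgs.1.
- move=> sg sgs; have Ssg : S (xi sg) by exists sg.
  by have := UV _ Ssg; rewrite xi_dualE.
- move=> sg j sgs; have Ssg : S (xi sg) by exists sg.
  by have := UT _ j Ssg; rewrite /m xiK.
Qed.

Lemma exponential_rate : exists2 alpha : R, 0 < alpha &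
  forall rho0, state rho0 ->
    (exp_rate (fun t => Vfun PR (mean_state P (rho rho0) t)) <= (- alpha)%:E)%E /\
    {ae P, forall w, (exp_rate (fun t => Vfun PR (rho rho0 t w)) <= (- alpha)%:E)%E}.
Proof.
have [u [K [c [T [T0 ul uL uV uT]]]]] := state_lyapunov.
exists (ln (4 / 3) / (4 * T)).
  by apply: divr_gt0; [apply: ln_gt0|]; lra.
move=> rho0 s0; have sol := hsol s0.
have uL' sg : state sg -> u (Lindblad H C sg) <= 0 by move=> /uL[].
have u0' sg : state sg -> 0 <= u sg by move=> /uL[].
have jT (j : nat) : 0 <= j%:R * T by rewrite mulr_ge0 // ltW.
have q0 (j : nat) : 0 <= (3 / 4) ^+ j :> R by apply: exprn_ge0; lra.
split.
  (* The mean of [u] decays along multiples of [T], and monotonicity covers the times between. The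
     ratio [2^-1] is weakened to [3 / 4] so that both conclusions share one rate. *)
  apply: (@exp_rate_geometric _ _ (`|K| * `|c|) T 0 T0) => j t _ jt tj.
  have t0 : 0 <= t := le_trans (jT j) jt.
  have mt := mean_on_state sol t0; rewrite mean_stateE.
  apply: le_trans (uV _ mt) _; apply: le_trans (ler_wpM2r (u0' _ mt) (ler_norm K)) _.
  rewrite -mulrA ler_wpM2l //.
  have := supermartingale hnoise sol ul uL' (jT j) (filtT hnoise (jT j)) (lexx _) jt.
  rewrite (rlin_mean_on hnoise sol ul t0 measurableT).2.
  rewrite (rlin_mean_on hnoise sol ul (jT j) measurableT).2 => /le_trans; apply.
  apply: le_trans (uT _ j s0) _; apply: (@le_trans _ _ (`|c| * 2^-1 ^+ j)).
    by rewrite ler_wpM2r ?ler_norm // exprn_ge0.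
  by rewrite ler_wpM2l // lerXn2r // ?nnegrE; lra.
have : {ae P, forall w, exists J : nat, forall (j : nat) (t : R), (J <= j)%N ->
    j%:R * T <= t -> t <= j.+1%:R * T -> u (rho rho0 t w) <= (3 / 4) ^+ j}.
  apply: (as_geometric_decay hnoise sol ul uL' u0' T0 (c := c)) => j; exact: uT.
apply: filterS => w [J hJ]; apply: (@exp_rate_geometric _ _ `|K| T J T0) => j t Jj jt tj.
have t0 : 0 <= t := le_trans (jT j) jt.
have st := sol_state sol w t0.
apply: le_trans (uV _ st) _; apply: le_trans (ler_wpM2r (u0' _ st) (ler_norm K)) _.
by rewrite ler_wpM2l //; exact: hJ.
Qed.

End Main.

Theorem theorem1p3
  (R : realType) (dO : measure_display) (Om : measurableType dO)
  (P : probability Om R) (F : R -> set (set Om))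
  (d n p : nat) (hpn : (p <= n)%N)
  (H : 'M[R[i]]_d) (hH : selfadjoint H) (C : 'I_n.+1 -> 'M[R[i]]_d)
  (W : 'I_n.+1 -> R -> Om -> R)
  (N : 'I_n.+1 -> Om -> {measure set (plane R) -> \bar R})
  (hnoise : sme_noise P p W N F)
  (rho : 'M[R[i]]_d -> R -> Om -> 'M[R[i]]_d)
  (hsol : forall rho0 : 'M[R[i]]_d, state rho0 ->
     sme_solution P p W N H C F rho0 (rho rho0))
  (HS HR : {vspace 'cV[R[i]]_d}) (hHR : is_orthocomp HS HR)
  (PS PR : 'M[R[i]]_d) (hPS : is_orthoproj HS PS) (hPR : is_orthoproj HR PR)
  (hGAS : gas_mean P PS rho \/ gas_as P PS rho) :
  exists alpha0 : R,
    [/\ 0 < alpha0,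
        forall rho0 : 'M[R[i]]_d, state rho0 ->
          (exp_rate (fun t => Vfun PR (mean_state P (rho rho0) t))
             <= (- alpha0)%:E)%E /\
          {ae P, forall w,
            (exp_rate (fun t => Vfun PR (rho rho0 t w)) <= (- alpha0)%:E)%E}
      & SP_condition p C HR PR ->
        exists beta0 : R, alpha0 <= beta0 /\
          forall rho0 : 'M[R[i]]_d, state rho0 ->
            {ae P, forall w,
              (exp_rate (fun t => Vfun PR (rho rho0 t w))
                 <= (- beta0)%:E)%E}].
Proof.
(* Either form of GAS enters through the decay of [Vfun PR] along the mean paths. *)
have hV rho0 : state rho0 ->
    Vfun PR (mean_on P (rho rho0) setT t) @[t --> +oo] --> (0 : R).
  move=> s0; case: hGAS => G.
    exact: (gas_mean_cvg hHR hPS hPR G s0).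
  exact: (gas_as_cvg hnoise hsol hHR hPS hPR G s0).
have [alpha a0 rate] := exponential_rate hnoise hsol hPR hV.
exists alpha; split => // _; exists alpha; split => // rho0 s0.
by have [] := rate rho0 s0.
Qed.
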